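(* Let $m$ be a positive integer, and let $u,v,z,s$ be complex numbers with $\Re u>0$, $\Re v>0$, $u\neq v$, and such that either $z\in\mathbb{C}\setminus[1,\infty)$ and $\Re s>-m$, or $z=1$ and $\Re s>1-m$. For $m>1$ define $$F_{m,u,v}(x_1,\dots,x_m)=(x_1x_2\cdots x_m)^{v-1}\bigl(x_1^{u-v}+(x_1x_2)^{u-v}+\cdots+(x_1x_2\cdots x_{m-1})^{u-v}\bigr).$$ Then, for $m>1$, $$\int_{[0,1]^m}\frac{F_{m,u,v}(x_1,\dots,x_m)}{1-z\,x_1x_2\cdots x_m}\,\bigl(-\ln (x_1x_2\cdots x_m)\bigr)^s\,dx_1\cdots dx_m=\frac{\Gamma(s+m-1)}{(m-2)!}\cdot\frac{\Phi(z,s+m-1,v)-\Phi(z,s+m-1,u)}{u-v},$$ and, for $m\ge 1$, $$\int_{[0,1]^m}\frac{(x_1x_2\cdots x_m)^{u-1}}{1-z\,x_1x_2\cdots x_m}\,\bigl(-\ln (x_1x_2\cdots x_m)\bigr)^s\,dx_1\cdots dx_m=\frac{\Gamma(s+m)}{(m-1)!}\,\Phi(z,s+m,u).$$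
   Context: Complex powers are $\zeta^s=\exp(s\log\zeta)$ with $\log$ the principal branch of the logarithm; in particular $x^w=\exp(w\ln x)$ for real $x>0$. The Lerch transcendent $\Phi(z,s,u)$ is defined, for $\Re u>0$, as the analytic continuation of the series $\Phi(z,s,u)=\sum_{n\ge 0}\frac{z^n}{(u+n)^s}$, which converges for $\Re u>0$ if either $|z|<1$, or $|z|=1$ and $\Re s>1$. For fixed $u$ with $\Re u>0$, $\Phi$ is holomorphic in $z\in\mathbb{C}\setminus[1,\infty)$ and in all complex $s$. For $z=1$, $\Phi(1,s,u)$ denotes the analytic continuation in $s$ of $\sum_{n\ge0}(u+n)^{-s}$ (the Hurwitz zeta function). The right-hand sides are understood as holomorphic functions of $s$ on the stated domain: at values of $s$ where an expression has a removable singularity (the point $s=1-m$ when $z\ne1$, or $s=2-m$ when $z=1$, in the first formula), it is interpreted by its limit in $s$. *)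

(* Defs.v *)
From HB Require Import structures.
From mathcomp Require Import all_boot all_order all_algebra.
From mathcomp Require Import complex.
From mathcomp Require Import all_classical all_reals all_analysis.

Set Implicit Arguments.
Unset Strict Implicit.
Unset Printing Implicit Defensive.

Import Order.TTheory GRing.Theory Num.Theory.
Import numFieldNormedType.Exports.

Local Open Scope classical_set_scope.
Local Open Scope ring_scope.
Local Open Scope complex_scope.

(* The usual topology of the complex plane, that is the one of [R[i]] as a
   numeric field; the library does not declare it on [complex R]. *)
HB.instance Definition _ (R : realType) :=
  PseudoPointedMetric.copy R[i] R[i]^o.

Section LebesgueTuple.
Context {R : realType}.
Local Notation rT := (measurableTypeR R).

Section Cons.
Variable n : nat.

Definition tuple_cons (p : rT * n.-tuple rT) : n.+1.-tuple rT :=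
  [the n.+1.-tuple rT of p.1 :: p.2].

Lemma measurable_tuple_cons : measurable_fun setT tuple_cons.
Proof. exact: measurable_cons. Qed.

Definition tuple_uncons (t : n.+1.-tuple rT) : rT * n.-tuple rT :=
  (thead t, [tuple of behead t]).

Lemma measurable_tuple_uncons : measurable_fun setT tuple_uncons.
Proof.
apply: measurable_fun_pair; first exact: measurable_tnth.
exact: measurable_behead.
Qed.

Lemma tuple_consK : cancel tuple_cons tuple_uncons.
Proof.
move=> [x t]; rewrite /tuple_uncons; congr pair => //.
exact: val_inj.
Qed.

Variable mu : {sigma_finite_measure set (n.-tuple rT) -> \bar R}.

Definition lebesgue_cons : set (n.+1.-tuple rT) -> \bar R :=
  pushforward (@lebesgue_measure R \x mu)%E tuple_cons.

Let lebesgue_cons0 : lebesgue_cons set0 = 0%E.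
Proof. by rewrite /lebesgue_cons /pushforward preimage_set0 measure0. Qed.

Let lebesgue_cons_ge0 A : (0 <= lebesgue_cons A)%E.
Proof. exact: (measure_ge0 (@lebesgue_measure R \x mu)%E). Qed.

Let lebesgue_cons_sigma_additive : semi_sigma_additive lebesgue_cons.
Proof.
move=> F mF tF mUF; rewrite /lebesgue_cons /pushforward preimage_bigcup.
apply: (measure_semi_sigma_additive (s := (@lebesgue_measure R \x mu)%E)).
- by move=> n'; rewrite -[X in measurable X]setTI; exact: measurable_tuple_cons.
- apply/trivIsetP => /= i j _ _ ij; rewrite -preimage_setI.
  by move/trivIsetP : tF => /(_ _ _ _ _ ij) ->//; rewrite preimage_set0.
- by rewrite -preimage_bigcup -[X in measurable X]setTI;
    exact: measurable_tuple_cons.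
Qed.

HB.instance Definition _ := isMeasure.Build _ _ _ lebesgue_cons
  lebesgue_cons0 lebesgue_cons_ge0 lebesgue_cons_sigma_additive.

Lemma lebesgue_cons_sigma_finite : sigma_finite setT lebesgue_cons.
Proof.
have /sigma_finiteP[F [FT ndF Foo]] := sigma_finiteT (@lebesgue_measure R).
have /sigma_finiteP[G [GT ndG Goo]] := sigma_finiteT mu.
exists (fun k => tuple_uncons @^-1` (F k `*` G k)).
  rewrite -preimage_bigcup; apply/esym; rewrite -subTset => t _ /=.
  have : (\bigcup_i F i) (tuple_uncons t).1 by rewrite -FT.
  have : (\bigcup_i G i) (tuple_uncons t).2 by rewrite -GT.
  move=> [j _ Gj] [i _ Fi]; exists (maxn i j) => //; split.
  - by move: Fi; exact/subsetPset/ndF/leq_maxl.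
  - by move: Gj; exact/subsetPset/ndG/leq_maxr.
move=> k; have [mF Foo'] := Foo k; have [mG Goo'] := Goo k; split.
  by rewrite -[X in measurable X]setTI; apply: measurable_tuple_uncons => //;
    exact: measurableX.
rewrite /lebesgue_cons /pushforward -comp_preimage.
rewrite (_ : tuple_uncons \o tuple_cons = id); last first.
  by apply/funext => p /=; rewrite tuple_consK.
by rewrite preimage_id product_measure1E// lte_mul_pinfty// ge0_fin_numE.
Qed.

HB.instance Definition _ :=
  Measure_isSigmaFinite.Build _ _ _ lebesgue_cons lebesgue_cons_sigma_finite.

End Cons.

(* Lebesgue measure on R^n, as the n-fold product measure *)
Fixpoint lebesgue_tuple (n : nat) :
    {sigma_finite_measure set (n.-tuple rT) -> \bar R} :=
  match n with
  | 0 => (\d_[tuple] : {sigma_finite_measure set (0.-tuple rT) -> \bar R})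
  | k.+1 => lebesgue_cons (lebesgue_tuple k)
  end.

Lemma lebesgue_tuple_box (n : nat) (A : 'I_n -> set rT) :
  (forall i, measurable (A i)) ->
  lebesgue_tuple n [set x | forall i, A i (tnth x i)] =
    (\prod_(i < n) (@lebesgue_measure R) (A i))%E.
Proof.
elim: n A => [|n IH] A mA /=.
  rewrite big_ord0 diracE mem_set//= => -[].
  by [].
rewrite /lebesgue_cons /pushforward big_ord_recl -IH//.
rewrite -product_measure1E//; last first.
  rewrite (_ : mkset _ =
      \bigcap_(i in [set: 'I_n]) ((@tnth n rT)^~ i @^-1` A (lift ord0 i))).
    apply: fin_bigcap_measurable; first exact: finite_finset.
    move=> i _; rewrite -[X in measurable X]setTI.
    exact: measurable_tnth.
  by apply/seteqP; split => [x /= h i _|x /= h i]; exact: h.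
congr ((_ \x _)%E _); apply/seteqP; split => -[x t] /=.
  by move=> h; split=> [|i]; [exact: (h ord0)|have := h (lift ord0 i); rewrite tnthS].
move=> [h0 h] i; case: (unliftP ord0 i) => [j ->|->//].
by rewrite tnthS.
Qed.

Definition unit_cube (n : nat) : set (n.-tuple rT) :=
  [set x | forall i, 0 <= tnth x i <= 1].

End LebesgueTuple.

Section ComplexFunctions.
Context {R : realType}.
Local Notation C := R[i].
Implicit Types (z s u v w a : C) (D U : set C) (f g F : C -> C).

Definition cexp z : C :=
  (expR (complex.Re z))%:C * (cos (complex.Im z) +i* sin (complex.Im z)).

(* principal argument, in ]-pi, pi] for z != 0 *)
Definition carg z : R :=
  let t := acos (complex.Re z / Normc.normc z) in
  if 0 <= complex.Im z then t else - t.

Definition clog z : C := ln (Normc.normc z) +i* carg z.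

Definition cpow z w : C := cexp (w * clog z).

Definition cintegrable d (T : measurableType d)
    (mu : {measure set T -> \bar R}) (D : set T) (h : T -> C) : Prop :=
  mu.-integrable D (fun x => (complex.Re (h x))%:E) /\
  mu.-integrable D (fun x => (complex.Im (h x))%:E).

Definition cintegral d (T : measurableType d)
    (mu : {measure set T -> \bar R}) (D : set T) (h : T -> C) : C :=
  (\int[mu]_(x in D) complex.Re (h x)) +i* (\int[mu]_(x in D) complex.Im (h x)).

Definition gamma_integral s : C :=
  cintegral (@lebesgue_measure R) `]0, +oo[
    (fun t => cpow t%:C (s - 1) * (expR (- t))%:C).

(* The least k such that Re s + k > 0. *)
Definition gamma_shift s : nat :=
  if 0 < complex.Re s then 0%N else (`|Num.floor (- complex.Re s)|%N).+1.

(* Euler's integral for Re s > 0, continued to C \ {0, -1, -2, ...} by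
   Gamma(s) = Gamma(s + k) / (s (s + 1) ... (s + k - 1)). *)
Definition Gamma s : C :=
  gamma_integral (s + (gamma_shift s)%:R) /
    \prod_(j < gamma_shift s) (s + j%:R).

Definition analytic_at f a : Prop :=
  exists (c : nat -> C) (r : C), 0 < r /\
    forall w, `|w - a| < r ->
      series (fun n => c n * (w - a) ^+ n) @ \oo --> f w.

Definition analytic_on D f : Prop := forall a, D a -> analytic_at f a.

(* The analytic continuation of f from U to the domain D; it is unique on D
   when D is open and connected and U contains a nonempty open set.  Its values
   off D are irrelevant. *)
Definition continuation U f D : C -> C :=
  xget (fun=> 0) [set g | analytic_on D g /\ forall w, U w -> g w = f w].

Definition slit_plane : set C :=
  [set z | ~ (complex.Im z = 0 /\ 1 <= complex.Re z)].

Definition lerch_series z s u : C :=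
  limn (series (fun n => z ^+ n / cpow (u + n%:R) s)).

Definition lerch_region z s : Prop :=
  `|z| < 1 \/ (`|z| = 1 /\ 1 < complex.Re s).

(* For z in the slit plane, the series is continued in z (s being fixed); at
   z = 1 it is continued in s, from the half-plane Re s > 1 to C \ {1}. *)
Definition lerch z s u : C :=
  if z == 1 then
    continuation [set s' | lerch_region 1 s']
                 (fun s' => lerch_series 1 s' u) [set s' | s' <> 1] s
  else
    continuation [set z' | slit_plane z' /\ lerch_region z' s]
                 (fun z' => lerch_series z' s u) slit_plane z.

(* The expression F takes the value w at s, where its value at the removable
   singularity p is by convention its limit. *)
Definition has_value F (p s w : C) : Prop :=
  if s == p then F @ s^' --> w else F s = w.

End ComplexFunctions.

Section Integrands.
Context {R : realType} {m : nat}.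
Local Notation C := R[i].
Implicit Types (x : m.-tuple (measurableTypeR R)).

Definition prod_first (j : nat) x : R := \prod_(i < m | (i < j)%N) tnth x i.

Definition prod_all x : R := \prod_(i < m) tnth x i.

Definition F_uv (u v : C) x : C :=
  cpow (prod_all x)%:C (v - 1) *
  \sum_(1 <= j < m) cpow (prod_first j x)%:C (u - v).

End Integrands.

(* Main.v *)
(** Substituting [x_i = e^-t_i], the product [x_1 ... x_m] of the coordinates of a
    uniform point of the cube becomes [e^-t] with [t] of density
    [t^(m-1) e^-t / (m-1)!], and the sum over [j] of the joint laws of
    [x_1 ... x_j = e^-a] and [x_1 ... x_m = e^-t] has density
    [t^(m-2) e^-t / (m-2)!] on [0 < a < t].  As the integral of [e^-(u-v)a] over
    [0 < a < t] is [(1 - e^-(u-v)t) / (u-v)], both integrals reduce to integrals over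
    the half-line of [t^(s-1) e^-ut / (1 - z e^-t)], respectively of
    [t^(s-1) (e^-vt - e^-ut) / (1 - z e^-t)].

    Expanding the geometric series identifies these with [Gamma(s) Phi(z, s, u)],
    respectively its difference between [v] and [u], where the series converges.
    Elsewhere [Phi] is an analytic continuation along segments, so it suffices to
    exhibit one analytic function extending the series: in [z] this is the integral
    itself, after one step of summation by parts for [-1 < Re s <= 0]; at [z = 1] the
    expansion of [t / (1 - e^-t)] in powers of [1 - e^-t] continues the integral to
    [1 - k < Re s] for every [k].  At the removable singularities, the integral of the
    difference is analytic in [s]. *)
From HB Require Import structures.
Require Import Defs.
From mathcomp Require Import all_boot all_order all_algebra.
From mathcomp Require Import complex ring lra.
From mathcomp Require Import all_classical all_reals all_analysis measurable_realfun.
Import Order.TTheory GRing.Theory Num.Theory.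
Import numFieldNormedType.Exports.
Local Open Scope classical_set_scope.
Local Open Scope ring_scope.
Local Open Scope complex_scope.
Set Implicit Arguments.
Unset Strict Implicit.
Unset Printing Implicit Defensive.

(** In the first formula the argument of [lerch] has real part above -1 (above 0 when z = 1), one
    unit to the left of the half-plane where the integrals attached to [v] and to [u] converge
    separately. Their difference still converges there, since it vanishes to one more order at t =
    0; hence the kernel [dker].

    As [lerch] is a chosen continuation, nothing is known of it until some analytic extension is
    exhibited on the whole domain. Analytic means expandable in a power series at each point, so
    products, reciprocals and integrals with a parameter are all expanded explicitly, under Cauchy
    bounds on the coefficients.

    Two facts about Euler's integral carry the rest. Its value for complex [u] follows from a
    derivative along a path from 1 to [u], in place of a contour rotation. The absence of zeros,
    required in order to divide by Gamma, follows from the functional equation, which moves a zero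
    arbitrarily far to the right, where the kernel is too concentrated for its integral to
    vanish. *)

Local Notation Re := complex.Re.
Local Notation Im := complex.Im.
Local Notation normc := Normc.normc.

(** * Analytic functions of a complex variable *)

Section ComplexNumbers.
Context {R : realType}.
Local Notation C := R[i].
Implicit Types (x y z w : C) (a b : R).

Lemma ReD x y : Re (x + y) = Re x + Re y. Proof. by case: x; case: y. Qed.
Lemma ImD x y : Im (x + y) = Im x + Im y. Proof. by case: x; case: y. Qed.
Lemma ReN x : Re (- x) = - Re x. Proof. by case: x. Qed.
Lemma ImN x : Im (- x) = - Im x. Proof. by case: x. Qed.
Lemma ReB x y : Re (x - y) = Re x - Re y. Proof. by rewrite ReD ReN. Qed.
Lemma ImB x y : Im (x - y) = Im x - Im y. Proof. by rewrite ImD ImN. Qed.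
Lemma ReM x y : Re (x * y) = Re x * Re y - Im x * Im y.
Proof. by case: x; case: y. Qed.
Lemma ImM x y : Im (x * y) = Re x * Im y + Im x * Re y.
Proof. by case: x; case: y. Qed.
Lemma Re_real a : Re a%:C = a. Proof. by []. Qed.
Lemma Im_real a : Im a%:C = 0. Proof. by []. Qed.
Lemma Re_nat n : Re (n%:R : C) = n%:R.
Proof. by elim: n => // n IH; rewrite -addn1 !natrD ReD IH. Qed.
Lemma Im_nat n : Im (n%:R : C) = 0.
Proof. by elim: n => // n IH; rewrite -addn1 !natrD ImD IH addr0. Qed.
Lemma ReMr a x : Re (a%:C * x) = a * Re x. Proof. by rewrite ReM mul0r subr0. Qed.
Lemma ImMr a x : Im (a%:C * x) = a * Im x. Proof. by rewrite ImM mul0r addr0. Qed.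
Lemma Re_sum I (r : seq I) (P : pred I) (F : I -> C) :
  Re (\sum_(i <- r | P i) F i) = \sum_(i <- r | P i) Re (F i).
Proof. by elim/big_rec2: _ => [|i a x _ <-]; rewrite ?ReD. Qed.
Lemma Im_sum I (r : seq I) (P : pred I) (F : I -> C) :
  Im (\sum_(i <- r | P i) F i) = \sum_(i <- r | P i) Im (F i).
Proof. by elim/big_rec2: _ => [|i a x _ <-]; rewrite ?ImD. Qed.

Lemma complex_ext x y : Re x = Re y -> Im x = Im y -> x = y.
Proof. by case: x y => [a b] [c d] /= -> ->. Qed.

Lemma rcD a b : (a + b)%:C = a%:C + b%:C. Proof. exact: rmorphD. Qed.
Lemma rcN a : (- a)%:C = - a%:C. Proof. exact: rmorphN. Qed.
Lemma rcB a b : (a - b)%:C = a%:C - b%:C. Proof. exact: rmorphB. Qed.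
Lemma rcM a b : (a * b)%:C = a%:C * b%:C. Proof. exact: rmorphM. Qed.
Lemma rcV a : (a^-1)%:C = a%:C^-1. Proof. exact: fmorphV. Qed.
Lemma rcX a n : (a ^+ n)%:C = a%:C ^+ n. Proof. exact: rmorphXn. Qed.
Lemma rc_nat n : (n%:R)%:C = n%:R :> C. Proof. exact: rmorph_nat. Qed.

Lemma normE x : `|x| = (normc x)%:C. Proof. by []. Qed.
Lemma normc_ge0 x : 0 <= normc x.
Proof. by case: x => a b; rewrite /normc sqrtr_ge0. Qed.
Lemma normc_real a : normc a%:C = `|a|.
Proof. by rewrite /= expr0n /= addr0 sqrtr_sqr. Qed.
Lemma normc_nat n : normc (n%:R : C) = n%:R.
Proof. by rewrite -rc_nat normc_real ger0_norm. Qed.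
Lemma normcM x y : normc (x * y) = normc x * normc y. Proof. exact: Normc.normcM. Qed.
Lemma normcV x : normc x^-1 = (normc x)^-1. Proof. exact: Normc.normcV. Qed.
Lemma normc_div x y : normc (x / y) = normc x / normc y.
Proof. by rewrite normcM normcV. Qed.
Lemma normcX x n : normc (x ^+ n) = normc x ^+ n.
Proof.
elim: n => [|n IH]; first by rewrite !expr0 Normc.normc1.
by rewrite !exprS normcM IH.
Qed.
Lemma le_normcD x y : normc (x + y) <= normc x + normc y. Proof. exact: le_normcD. Qed.
Lemma normcN x : normc (- x) = normc x. Proof. exact: normcN. Qed.
Lemma normc_distC x y : normc (x - y) = normc (y - x).
Proof. by rewrite -normcN opprB. Qed.
Lemma le_normcB x y : normc (x - y) <= normc x + normc y.
Proof. by rewrite (le_trans (le_normcD _ _))// normcN. Qed.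
Lemma normc_eq0 x : (normc x == 0) = (x == 0).
Proof.
by apply/eqP/eqP => [/Normc.eq0_normc//|->]; exact: Normc.normc0.
Qed.
Lemma normc_gt0 x : (0 < normc x) = (x != 0).
Proof. by rewrite lt0r normc_eq0 normc_ge0 andbT. Qed.
Lemma le_normc_sum I (r : seq I) (P : pred I) (F : I -> C) :
  normc (\sum_(i <- r | P i) F i) <= \sum_(i <- r | P i) normc (F i).
Proof.
apply: (big_ind2 (fun x a => normc x <= a)) => //.
- by rewrite Normc.normc0.
- by move=> x a y b xa yb; rewrite (le_trans (le_normcD _ _))// lerD.
Qed.
Lemma normc_ge_Re x : `|Re x| <= normc x.
Proof.
by case: x => a b; rewrite /= -sqrtr_sqr ler_wsqrtr// lerDl sqr_ge0.
Qed.
Lemma normc_ge_Im x : `|Im x| <= normc x.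
Proof.
by case: x => a b; rewrite /= -sqrtr_sqr ler_wsqrtr// lerDr sqr_ge0.
Qed.
Lemma normc_le_ReIm x : normc x <= `|Re x| + `|Im x|.
Proof.
case: x => a b /=; rewrite -(@ger0_norm _ (`|a| + `|b|)) ?addr_ge0//.
rewrite -sqrtr_sqr ler_wsqrtr// sqrrD !real_normK ?num_real//.
by rewrite -addrA lerD2l lerDr mulrn_wge0// mulr_ge0.
Qed.
Lemma normc_sqr x : normc x ^+ 2 = Re x ^+ 2 + Im x ^+ 2.
Proof. by case: x => a b /=; rewrite sqr_sqrtr// addr_ge0// sqr_ge0. Qed.

Lemma cvgcP {T : Type} {F : set_system T} {FF : Filter F} (f : T -> C) (l : C) :
  f @ F --> l <-> forall e, 0 < e -> \forall t \near F, normc (f t - l) < e.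
Proof.
split.
- move=> fl e e0.
  have /(@cvgrPdist_lt _ R[i]^o) /(_ e%:C) := fl.
  rewrite ltcR => /(_ e0); apply: filterS => t /=.
  by rewrite normE ltcR normc_distC.
- move=> H; apply/(@cvgrPdist_lt _ R[i]^o) => -[e e'].
  rewrite ltcE/= => /andP[/eqP -> e0].
  have := H e e0; apply: filterS => t h.
  by rewrite normE -[e +i* 0]/(e%:C) ltcR normc_distC.
Qed.

Lemma cvgc_normcP {T : Type} {F : set_system T} {FF : Filter F} (f : T -> C) (l : C) :
  f @ F --> l <-> normc (f t - l) @[t --> F] --> (0 : R).
Proof.
split.
- move=> /cvgcP H; apply/cvgrPdist_lt => e /H; apply: filterS => t.
  by rewrite sub0r normrN ger0_norm// normc_ge0.
- move=> /cvgrPdist_lt H; apply/cvgcP => e /H; apply: filterS => t.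
  by rewrite sub0r normrN ger0_norm// normc_ge0.
Qed.

Lemma cvgc_ReIm {T : Type} {F : set_system T} {FF : Filter F} (f : T -> C) (l : C) :
  f @ F --> l <-> Re (f t) @[t --> F] --> Re l /\ Im (f t) @[t --> F] --> Im l.
Proof.
split.
- move=> /cvgcP H; split; apply/cvgrPdist_lt => e /H; apply: filterS => t.
  + by rewrite normc_distC -ReB; exact: (le_lt_trans (normc_ge_Re _)).
  + by rewrite normc_distC -ImB; exact: (le_lt_trans (normc_ge_Im _)).
- move=> [/cvgrPdist_lt H1 /cvgrPdist_lt H2]; apply/cvgcP => e e0.
  have e2 : 0 < e / 2 by rewrite divr_gt0.
  apply: filterS2 (H1 _ e2) (H2 _ e2) => t.
  rewrite -ReB -ImB => h1 h2; rewrite normc_distC.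
  by rewrite (le_lt_trans (normc_le_ReIm _))// (splitr e) ltrD.
Qed.

Lemma cvgc_unique {T : Type} {F : set_system T} {FF : ProperFilter F} (f : T -> C) (l l' : C) :
  f @ F --> l -> f @ F --> l' -> l = l'.
Proof.
move=> /cvgc_ReIm[a b] /cvgc_ReIm[c d]; apply: complex_ext.
- exact: cvg_unique a c.
- exact: cvg_unique b d.
Qed.

Lemma cvgc_lim {T : Type} {F : set_system T} {FF : ProperFilter F} (f : T -> C) (l : C) :
  f @ F --> l -> lim (f @ F) = l.
Proof.
move=> fl; apply/esym/(cvgc_unique fl).
by apply/cvg_ex; exists l.
Qed.

Lemma cvgcD {T : Type} {F : set_system T} {FF : Filter F} (f g : T -> C) (l m : C) :
  f @ F --> l -> g @ F --> m -> (f t + g t) @[t --> F] --> l + m.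
Proof.
move=> /cvgc_ReIm[a b] /cvgc_ReIm[c d]; apply/cvgc_ReIm; split.
- by rewrite ReD; under eq_fun do rewrite ReD; exact: cvgD.
- by rewrite ImD; under eq_fun do rewrite ImD; exact: cvgD.
Qed.

Lemma cvgcM {T : Type} {F : set_system T} {FF : Filter F} (f g : T -> C) (l m : C) :
  f @ F --> l -> g @ F --> m -> (f t * g t) @[t --> F] --> l * m.
Proof.
move=> /cvgc_ReIm[a b] /cvgc_ReIm[c d]; apply/cvgc_ReIm; split.
- by rewrite ReM; under eq_fun do rewrite ReM; apply: cvgB; exact: cvgM.
- by rewrite ImM; under eq_fun do rewrite ImM; apply: cvgD; exact: cvgM.
Qed.

Lemma cvgc_cst {T : Type} {F : set_system T} {FF : Filter F} (l : C) :
  (fun=> l : C) @ F --> l.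
Proof. exact: cvg_cst. Qed.

Lemma cvgcMl {T : Type} {F : set_system T} {FF : Filter F} (f : T -> C) (k l : C) :
  f @ F --> l -> (k * f t) @[t --> F] --> k * l.
Proof. by apply: cvgcM; exact: cvgc_cst. Qed.

Lemma cvgcN {T : Type} {F : set_system T} {FF : Filter F} (f : T -> C) (l : C) :
  f @ F --> l -> (- f t) @[t --> F] --> - l.
Proof.
by move=> fl; rewrite -mulN1r; under eq_fun do rewrite -mulN1r; exact: cvgcMl.
Qed.

Lemma cvgcB {T : Type} {F : set_system T} {FF : Filter F} (f g : T -> C) (l m : C) :
  f @ F --> l -> g @ F --> m -> (f t - g t) @[t --> F] --> l - m.
Proof. by move=> fl /cvgcN; exact: cvgcD. Qed.

Lemma squeeze_cvgc {T : Type} {F : set_system T} {FF : Filter F} (f : T -> C) (l : C) (h : T -> R) :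
  (\forall t \near F, normc (f t - l) <= h t) -> h @ F --> (0 : R) -> f @ F --> l.
Proof.
move=> fh h0; apply/cvgc_normcP; apply: (@squeeze_cvgr _ _ _ _ (cst 0) h) => //.
- by near=> t; rewrite /= normc_ge0 /=; near: t.
- exact: cvg_cst.
Unshelve. all: by end_near. Qed.

Lemma cvgc_shiftS (f : nat -> C) (l : C) :
  (fun n => f n.+1) @ \oo --> l <-> f @ \oo --> l.
Proof.
split=> /cvgc_ReIm[a b]; apply/cvgc_ReIm; split.
- by move: a; rewrite (@cvg_shiftS _ (fun n => Re (f n))).
- by move: b; rewrite (@cvg_shiftS _ (fun n => Im (f n))).
- by rewrite (@cvg_shiftS _ (fun n => Re (f n))).
- by rewrite (@cvg_shiftS _ (fun n => Im (f n))).
Qed.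

End ComplexNumbers.

(** * Power series with Cauchy bounds on their coefficients *)

Section PowerSeries.
Context {R : realType}.
Local Notation C := R[i].
Implicit Types (f g h : C -> C) (a b w : C) (c d x y : nat -> C) (A B q rho : R).

Lemma seriesC_E x n : series x n = \sum_(k < n) x k.
Proof. by rewrite /series/= big_mkord. Qed.

Lemma sum_geometric_le q n : 0 <= q < 1 -> \sum_(k < n) q ^+ k <= (1 - q)^-1.
Proof.
move=> /andP[q0 q1]; have q1' : 0 < 1 - q by rewrite subr_gt0.
rewrite -[leRHS]mul1r ler_pdivlMr// mulrC -opprB mulNr -subrX1.
by rewrite opprB lerBlDr lerDl exprn_ge0.
Qed.

Lemma bernoulli_le q n : 0 <= q -> 1 + n%:R * q <= (1 + q) ^+ n.
Proof.
move=> q0; elim: n => [|n IH]; first by rewrite mul0r addr0 expr0.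
have q1 : 0 <= 1 + q by rewrite addr_ge0.
rewrite exprS (le_trans _ (ler_wpM2l q1 IH))//.
have : 0 <= n%:R * (q * q) by rewrite !mulr_ge0.
rewrite -addn1 natrD; lra.
Qed.

Lemma cvg_mulr_expr q : 0 <= q < 1 -> (n%:R * q ^+ n) @[n --> \oo] --> (0 : R).
Proof.
move=> /andP[q0 q1].
have [->|qn0] := eqVneq q 0.
  apply: cvg_near_cst; exists 1%N => // n /= n0.
  by rewrite expr0n gtn_eqF// mulr0.
have {q0 qn0}q0 : 0 < q by rewrite lt0r qn0.
(* Write [q = p * p]: Bernoulli's inequality for [p^-1] bounds [n p^n] by a constant, and the other
   factor [p^n] tends to 0. *)
pose p := Num.sqrt q.
have p0 : 0 < p by rewrite sqrtr_gt0.
have pp : q = p * p by rewrite -expr2 sqr_sqrtr// ltW.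
have p1 : p < 1.
  by rewrite ltNge; apply/negP => p1; move: q1; rewrite pp ltNge mulr_ege1.
have K0 : 0 < p^-1 - 1 by rewrite subr_gt0 invf_gt1.
apply: (@squeeze_cvgr _ _ _ _ (cst 0) (fun n => (p^-1 - 1)^-1 * p ^+ n)).
- near=> n => /=; rewrite mulr_ge0 ?exprn_ge0 ?(ltW q0)//=.
  rewrite pp exprMn mulrA ler_wpM2r ?exprn_ge0 ?(ltW p0)//.
  rewrite -[leRHS]mulr1 ler_pdivlMl// mulrA -ler_pdivlMr ?exprn_gt0// div1r -exprVn.
  have := bernoulli_le n (ltW K0).
  rewrite [X in _ <= X ^+ _](_ : _ = p^-1); last by ring.
  by apply: le_trans; rewrite mulrC lerDr.
- exact: cvg_cst.
- rewrite -[X in _ --> X](mulr0 (p^-1 - 1)^-1); apply: cvgMr => //.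
  by apply: cvg_expr; rewrite ger0_norm// ltW.
Unshelve. all: by end_near. Qed.

(** The bound [A] is a Cauchy estimate: inside the disc it dominates every term by a geometric one,
    which makes the tails and the products of series explicit. *)
Definition pseries_on f a c A rho :=
  [/\ 0 < rho, forall n, normc (c n) * rho ^+ n <= A &
  forall w, normc (w - a) < rho -> series (fun n => c n * (w - a) ^+ n) @ \oo --> f w].

Lemma pseries_on_shrink f a c A rho rho' :
  pseries_on f a c A rho -> 0 < rho' <= rho -> pseries_on f a c A rho'.
Proof.
move=> [r0 cA cf] /andP[r'0 r'r]; split => // [n|w wr].
- apply: le_trans (cA n); rewrite ler_wpM2l ?normc_ge0//.
  by rewrite lerXn2r// nnegrE ltW.
- by apply: cf; exact: lt_le_trans r'r.
Qed.

Lemma pseries_on_ge0 f a c A rho : pseries_on f a c A rho -> 0 <= A.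
Proof.
by move=> [r0 + _] => /(_ 0%N); apply: le_trans; rewrite expr0 mulr1 normc_ge0.
Qed.

Lemma pseries_coef_le f a c A rho : pseries_on f a c A rho ->
  forall n w, normc (c n * (w - a) ^+ n) <= A * (normc (w - a) / rho) ^+ n.
Proof.
move=> fc n w; have [r0 cA _] := fc.
rewrite normcM normcX expr_div_n mulrCA [leLHS]mulrC.
rewrite ler_wpM2l ?exprn_ge0 ?normc_ge0//.
by rewrite ler_pdivlMr ?exprn_gt0.
Qed.

(** The terms from [k] on are dominated by a geometric series of ratio [|w - a| / rho]. The value
    [f w] is replaced, up to an arbitrary [e], by a partial sum of index [k + N]. *)
Lemma pseries_tail f a c A rho k w : pseries_on f a c A rho ->
  normc (w - a) < rho ->
  normc (f w - \sum_(n < k) c n * (w - a) ^+ n) <=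
    A * (normc (w - a) / rho) ^+ k / (1 - normc (w - a) / rho).
Proof.
move=> fc wr; have [r0 cA /(_ w wr) cf] := fc.
have A0 := pseries_on_ge0 fc.
set q := normc (w - a) / rho.
have q01 : 0 <= q < 1.
  by rewrite divr_ge0 ?normc_ge0 ?(ltW r0)//= ltr_pdivrMr// mul1r.
set S := \sum_(n < k) _.
apply/ler_addgt0Pr => e e0.
have /cvgcP/(_ e e0) [N _ HN] := cf.
have /HN/= : (N <= k + N)%N by rewrite leq_addl.
rewrite seriesC_E => lt_e.
have -> : f w - S = - (\sum_(k0 < k + N) c k0 * (w - a) ^+ k0 - f w) +
   (\sum_(k0 < k + N) c k0 * (w - a) ^+ k0 - S) by ring.
rewrite (le_trans (le_normcD _ _))// addrC lerD//; last by rewrite normcN ltW.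
rewrite big_split_ord/= -/S addrAC subrr add0r.
rewrite (le_trans (le_normc_sum _ _ _))//.
apply: (@le_trans _ _ (\sum_(i < N) A * q ^+ k * q ^+ i)).
  by apply: ler_sum => i _; rewrite -mulrA -exprD; exact: (pseries_coef_le fc).
rewrite -big_distrr/= ler_wpM2l ?mulr_ge0 ?exprn_ge0//; first by case/andP: q01.
exact: sum_geometric_le.
Qed.

Lemma Re_series x n : Re (series x n) = series (fun k => Re (x k)) n.
Proof. by rewrite /series/= Re_sum. Qed.

Lemma Im_series x n : Im (series x n) = series (fun k => Im (x k)) n.
Proof. by rewrite /series/= Im_sum. Qed.

Lemma cvg_series_terms0 x (l : C) : series x @ \oo --> l -> x @ \oo --> (0 : C).
Proof.
move=> /cvgc_ReIm[].
under eq_fun do rewrite Re_series; under [in X in _ -> X -> _]eq_fun do rewrite Im_series.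
by move=> c1 c2; apply/cvgc_ReIm; split; apply: cvg_series_cvg_0; apply/cvg_ex;
  eexists; [exact: c1|exact: c2].
Qed.

Lemma cvgc_bounded x (l : C) : x @ \oo --> l -> exists M, forall n, normc (x n) <= M.
Proof.
move=> /cvgc_normcP v0.
have /cvg_seq_bounded : cvgn (fun n => normc (x n - l)) by apply/cvg_ex; eexists; exact: v0.
move=> [M [_ HM]]; exists (M + 1 + normc l) => n.
have := HM (M + 1); rewrite ltrDl ltr01 => /(_ isT n I) /=.
rewrite ger0_norm ?normc_ge0// => h.
by rewrite -(subrK l (x n)) (le_trans (le_normcD _ _))// lerD2r.
Qed.

(** Convergence at one point at distance [r / 2] makes the terms bounded there, and this is the
    Cauchy bound; the price is half of the radius. *)
Lemma analytic_pseries f a : analytic_at f a -> exists c A rho, pseries_on f a c A rho.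
Proof.
move=> [c [[r r'] []]]; rewrite ltcE/= => /andP[/eqP-> r0] cf.
have r2 : 0 < r / 2 by rewrite divr_gt0.
have w0 : normc (a + (r / 2)%:C - a) = r / 2.
  by rewrite addrAC subrr add0r normc_real gtr0_norm.
have : `|a + (r / 2)%:C - a| < r +i* 0.
  by rewrite normE w0 -[r +i* 0]/(r%:C) ltcR ltr_pdivrMr// ltr_pMr// ltr1n.
move=> /cf /cvg_series_terms0/cvgc_bounded[M HM].
exists c, M, (r / 2); split => // [n|w wr].
- by have := HM n; rewrite normcM normcX w0.
- apply: cf; rewrite normE -[r +i* 0]/(r%:C) ltcR (lt_trans wr)//.
  by rewrite ltr_pdivrMr// ltr_pMr// ltr1n.
Qed.

Lemma pseries_analytic f a c rho : 0 < rho ->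
  (forall w, normc (w - a) < rho ->
    series (fun n => c n * (w - a) ^+ n) @ \oo --> f w) -> analytic_at f a.
Proof.
move=> r0 cf; exists c, rho%:C; split; first by rewrite ltcR.
by move=> w; rewrite normE ltcR => /cf.
Qed.

Lemma pseries_at0 f a c A rho : pseries_on f a c A rho -> c 0%N = f a.
Proof.
move=> [r0 _] /(_ a); rewrite subrr Normc.normc0 => /(_ r0) H.
apply: cvgc_unique H; apply/cvgc_shiftS.
rewrite (_ : (fun n => _) = fun=> c 0%N); first exact: cvgc_cst.
apply/funext => n; rewrite seriesC_E big_ord_recl expr0 mulr1 big1 ?addr0//.
by move=> i _; rewrite expr0n mulr0.
Qed.

Lemma analytic_near f a : analytic_at f a -> exists K e, [/\ 0 <= K, 0 < e &
  forall w, normc (w - a) < e -> normc (f w - f a) <= K * normc (w - a)].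
Proof.
move=> /analytic_pseries[c [A [rho fc]]]; have [r0 _ _] := fc.
exists (2 * A / rho), (rho / 2); split.
- by rewrite divr_ge0 ?(ltW r0)// mulr_ge0// (pseries_on_ge0 fc).
- by rewrite divr_gt0.
- move=> w wr.
  have wr' : normc (w - a) < rho.
    by rewrite (lt_trans wr)// ltr_pdivrMr// ltr_pMr// ltr1n.
  have := @pseries_tail f a c A rho 1 w fc wr'.
  rewrite big_ord1 expr0 mulr1 (pseries_at0 fc) expr1 => /le_trans; apply.
  (* On half of the radius the ratio is below 1/2, so the denominator of the tail bound costs at
     most a factor 2. *)
  have q2 : normc (w - a) / rho < 1 / 2 by rewrite ltr_pdivrMr//; lra.
  rewrite ler_pdivrMr; last by rewrite subr_gt0; lra.
  rewrite [leRHS](_ : _ = (A * (normc (w - a) / rho)) * (2 * (1 - normc (w - a) / rho))); last by ring.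
  rewrite ler_peMr//; last by lra.
  by rewrite mulr_ge0 ?(pseries_on_ge0 fc)// divr_ge0 ?normc_ge0// ltW.
Qed.

Lemma nbhscP a (P : set C) :
  nbhs a P <-> exists2 e : R, 0 < e & forall w, normc (w - a) < e -> P w.
Proof.
split.
- move=> /(@nbhs_ballP _ R[i]^o) [[e e'] /=]; rewrite ltcE/= => /andP[/eqP -> e0] H.
  exists e => // w we; apply: H.
  by rewrite /ball/= normE -[e +i* 0]/(e%:C) ltcR normc_distC.
- move=> [e e0 H]; apply/(@nbhs_ballP _ R[i]^o); exists e%:C => /=; first by rewrite ltcR.
  by move=> w; rewrite /ball/= normE ltcR => we; apply: H; rewrite normc_distC.
Qed.

Lemma analytic_cvg f a : analytic_at f a -> f @ a --> f a.
Proof.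
move=> /analytic_near[K [e [K0 e0 H]]]; apply/(@cvgcP _ _ _ (nbhs_filter (a : R[i]^o))) => d d0.
have K1 : 0 < K + 1 by rewrite ltr_wpDl.
apply/nbhscP; exists (Num.min e (d / (K + 1))).
  by rewrite lt_min e0 divr_gt0.
move=> t; rewrite lt_min => /andP[/H h1 h2].
rewrite (le_lt_trans h1)// (@le_lt_trans _ _ ((K + 1) * normc (t - a)))//.
  by rewrite ler_wpM2r ?normc_ge0// lerDl.
by rewrite -ltr_pdivlMl// mulrC.
Qed.

Lemma eq_cvgc x y (l : C) : (forall n, x n = y n) -> x @ \oo --> l -> y @ \oo --> l.
Proof. by move=> /funext ->. Qed.

Lemma cvgc_near_cst x (l : C) N : (forall n, (N <= n)%N -> x n = l) -> x @ \oo --> l.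
Proof.
move=> xl; apply/cvgcP => e e0; exists N => // n /= Nn.
by rewrite xl// subrr Normc.normc0.
Qed.

Lemma analytic_cst (k : C) a : analytic_at (fun=> k) a.
Proof.
apply: (@pseries_analytic _ _ (fun n => if n == 0%N then k else 0) 1) => // w _.
apply/cvgc_shiftS; rewrite (_ : (fun n => _) = fun=> k); first exact: cvgc_cst.
apply/funext => n; rewrite seriesC_E big_ord_recl expr0 mulr1 big1 ?addr0//.
by move=> i _; rewrite mul0r.
Qed.

Lemma analytic_id a : analytic_at id a.
Proof.
apply: (@pseries_analytic _ _ (fun n => if n is m.+1 then (m == 0%N)%:R else a) 1) => // w _.
apply: (@cvgc_near_cst _ _ 2) => -[|[|n]]// _.
rewrite seriesC_E !big_ord_recl/= expr0 expr1 mulr1 mul1r big1 ?addr0.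
  by rewrite addrC subrK.
by move=> i _; rewrite mul0r.
Qed.

Lemma eq_analytic_at f g a e : 0 < e -> (forall w, normc (w - a) < e -> f w = g w) ->
  analytic_at f a -> analytic_at g a.
Proof.
move=> e0 fg /analytic_pseries[c [A [rho fc]]]; have [r0 _ _] := fc.
have [m0 _ H] : pseries_on f a c A (Num.min e rho).
  by apply: pseries_on_shrink fc _; rewrite lt_min e0 r0 ge_min lexx orbT.
apply: (pseries_analytic m0) => w wm.
rewrite -fg; first exact: H.
by move: wm; rewrite lt_min => /andP[].
Qed.

Lemma analyticD f g a : analytic_at f a -> analytic_at g a ->
  analytic_at (fun w => f w + g w) a.
Proof.
move=> /analytic_pseries[c [A [rho fc]]] /analytic_pseries[d [B [rho' gd]]].
have [r0 _ _] := fc; have [r'0 _ _] := gd.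
have [m0 _ H] : pseries_on f a c A (Num.min rho rho').
  by apply: pseries_on_shrink fc _; rewrite lt_min r0 r'0 ge_min lexx.
have [_ _ H'] : pseries_on g a d B (Num.min rho rho').
  by apply: pseries_on_shrink gd _; rewrite lt_min r0 r'0 ge_min lexx orbT.
apply: (@pseries_analytic _ _ (fun n => c n + d n) _ m0) => w wm.
apply: eq_cvgc (cvgcD (H w wm) (H' w wm)) => n.
by rewrite !seriesC_E -big_split/=; apply: eq_bigr => i _; rewrite mulrDl.
Qed.

(** Both sides run over the triangle [i + j < n], by diagonals and by rows. *)
Lemma sum_convolution x y n :
  \sum_(k < n) \sum_(i < k.+1) x i * y (k - i)%N =
  \sum_(i < n) x i * \sum_(j < n - i) y j.
Proof.
elim: n => [|n IH]; first by rewrite !big_ord0.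
rewrite big_ord_recr/= IH [RHS]big_ord_recr/= subSnn big_ord1.
rewrite [\sum_(i < n.+1) _]big_ord_recr/= subnn addrA; congr (_ + _).
rewrite -big_split/=; apply: eq_bigr => i _.
by rewrite subSn ?(ltnW (ltn_ord i))// big_ord_recr/= mulrDr.
Qed.

(** The partial sum of the product differs from [series x n * g w] by the sum of [x i] times the
    tail of [g] after [n - i] terms. Each such term is at most [A B q^n / (1 - q)], and [n q^n]
    tends to 0. *)
Lemma pseries_cauchy_product f g a c d A B r w :
  pseries_on f a c A r -> pseries_on g a d B r -> normc (w - a) < r ->
  series (fun n => (\sum_(i < n.+1) c i * d (n - i)%N) * (w - a) ^+ n) @ \oo --> f w * g w.
Proof.
move=> fc' gd' wm.
have A0 := pseries_on_ge0 fc'; have B0 := pseries_on_ge0 gd'.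
have [m0 _ H] := fc'; have [_ _ H'] := gd'.
pose x n := c n * (w - a) ^+ n; pose y n := d n * (w - a) ^+ n.
pose q := normc (w - a) / r.
have q01 : 0 <= q < 1.
  by rewrite divr_ge0 ?normc_ge0 ?(ltW m0)//= ltr_pdivrMr// mul1r.
have [q0 q1] := andP q01.
have q1' : 0 < 1 - q by rewrite subr_gt0.
rewrite (_ : series _ = fun n => series x n * g w -
    (series x n * g w - \sum_(i < n) x i * \sum_(j < n - i) y j)); last first.
  apply/funext => n; rewrite subKr seriesC_E -sum_convolution.
  apply: eq_bigr => k _; rewrite mulr_suml; apply: eq_bigr => i _.
  by rewrite /x /y mulrACA -exprD subnKC// -ltnS.
rewrite -[X in _ --> X]subr0; apply: cvgcB.
  by apply: cvgcM; [exact: H|exact: cvgc_cst].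
apply: (@squeeze_cvgc _ _ _ _ _ _ (fun n => A * B / (1 - q) * (n%:R * q ^+ n))); last first.
  rewrite -[X in _ --> X](mulr0 (A * B / (1 - q))).
  by apply: cvgMr; exact: cvg_mulr_expr.
apply: nearW => n; rewrite subr0 seriesC_E mulr_suml -sumrB.
rewrite (le_trans (le_normc_sum _ _ _))//.
apply: (@le_trans _ _ (\sum_(i < n) A * B / (1 - q) * q ^+ n)); last first.
  by rewrite sumr_const card_ord -[leLHS]mulr_natr -mulrA [q ^+ n * _]mulrC.
apply: ler_sum => i _; rewrite -mulrBr normcM.
apply: (@le_trans _ _ ((A * q ^+ i) * (B * q ^+ (n - i) / (1 - q)))).
  apply: ler_pM; rewrite ?normc_ge0//.
    exact: (pseries_coef_le fc').
  exact: (pseries_tail _ gd').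
rewrite le_eqVlt; apply/orP; left; apply/eqP.
have -> : q ^+ n = q ^+ i * q ^+ (n - i) by rewrite -exprD subnKC// ltnW.
by ring.
Qed.

Lemma analyticM f g a : analytic_at f a -> analytic_at g a ->
  analytic_at (fun w => f w * g w) a.
Proof.
move=> /analytic_pseries[c [A [rho fc]]] /analytic_pseries[d [B [rho' gd]]].
have [r0 _ _] := fc; have [r'0 _ _] := gd.
pose r := Num.min rho rho'.
have fc' : pseries_on f a c A r.
  by apply: pseries_on_shrink fc _; rewrite lt_min r0 r'0 ge_min lexx.
have gd' : pseries_on g a d B r.
  by apply: pseries_on_shrink gd _; rewrite lt_min r0 r'0 ge_min lexx orbT.
have [m0 _ _] := fc'.
apply: (@pseries_analytic _ _ (fun n => \sum_(i < n.+1) c i * d (n - i)%N) _ m0) => w wm.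
exact: pseries_cauchy_product fc' gd' wm.
Qed.

End PowerSeries.

(** * Reciprocals, the identity theorem along segments, analytic continuation *)

Section AnalyticInverse.
Context {R : realType}.
Local Notation C := R[i].
Implicit Types (f g h : C -> C) (a b w : C) (c d x y : nat -> C) (A B q rho : R).

(** Each coefficient of the reciprocal series depends on all the earlier ones, so the recursion
    carries the whole prefix as a list. *)
Fixpoint inv_coefs c n : seq C :=
  if n is m.+1 then
    rcons (inv_coefs c m)
      (- (c 0%N)^-1 * \sum_(i < m.+1) c i.+1 * nth 0 (inv_coefs c m) (m - i))
  else [:: (c 0%N)^-1].

Definition inv_coef c n := nth 0 (inv_coefs c n) n.

Lemma size_inv_coefs c n : size (inv_coefs c n) = n.+1.
Proof. by elim: n => //= n IH; rewrite size_rcons IH. Qed.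

Lemma nth_inv_coefs c n k : (k <= n)%N -> nth 0 (inv_coefs c n) k = inv_coef c k.
Proof.
elim: n => [|n IH]; first by rewrite leqn0 => /eqP ->.
rewrite leq_eqVlt => /orP[/eqP -> //|kn].
by rewrite /= nth_rcons size_inv_coefs kn IH.
Qed.

Lemma inv_coefS c n : inv_coef c n.+1 =
  - (c 0%N)^-1 * \sum_(i < n.+1) c i.+1 * inv_coef c (n - i)%N.
Proof.
rewrite {1}/inv_coef/= nth_rcons size_inv_coefs ltnn eqxx; congr (_ * _).
by apply: eq_bigr => i _; rewrite nth_inv_coefs// leq_subr.
Qed.

Lemma convolution_inv_coef c n : c 0%N != 0 ->
  \sum_(i < n.+1) c i * inv_coef c (n - i)%N = (n == 0%N)%:R.
Proof.
move=> c0; case: n => [|n]; first by rewrite big_ord1 /inv_coef/= divff.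
rewrite big_ord_recl/= subn0 inv_coefS mulrA mulrN divff// mulN1r.
by rewrite addrC subrr.
Qed.

Lemma inv_coef_le c A rho : c 0%N != 0 -> 0 < rho ->
  (forall n, normc (c n) * rho ^+ n <= A) ->
  exists M, 0 < M /\ forall n, normc (inv_coef c n) <= (normc (c 0%N))^-1 * M ^+ n.
Proof.
move=> c0 r0 cA; have nc0 : 0 < normc (c 0%N) by rewrite normc_gt0.
(* The maximum with 1 gives [K <= K ^ i.+1], so that one [M] serves every coefficient of [c]. *)
pose K := Num.max 1 (A / normc (c 0%N)).
have K1 : 1 <= K by rewrite le_max lexx.
have K0 : 0 < K by rewrite (lt_le_trans ltr01).
pose M := K / rho; have M0 : 0 < M by rewrite divr_gt0.
have cM i : normc (c i.+1) / normc (c 0%N) <= M ^+ i.+1.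
  rewrite /M expr_div_n ler_pdivlMr ?exprn_gt0// mulrAC.
  apply: (@le_trans _ _ (A / normc (c 0%N))); first by rewrite ler_pM2r ?invr_gt0.
  by rewrite (@le_trans _ _ K)// ?le_max ?lexx ?orbT// ler_eXnr.
(* The factor 2 absorbs the convolution: the powers [2 ^ i] with [i <= n] add up to less than
   [2 ^ n.+1]. *)
exists (2 * M); split; first by rewrite mulr_gt0.
elim/ltn_ind => -[_|n IH].
  by rewrite /inv_coef/= expr0 mulr1 normcV.
rewrite inv_coefS normcM normcN normcV ler_wpM2l ?invr_ge0 ?normc_ge0//.
rewrite (le_trans (le_normc_sum _ _ _))//.
apply: (@le_trans _ _ (\sum_(i < n.+1) M ^+ i.+1 * (2 * M) ^+ (n - i))).
  apply: ler_sum => i _; rewrite normcM.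
  have /IH h : (n - i < n.+1)%N by rewrite ltnS leq_subr.
  apply: (le_trans (ler_wpM2l (normc_ge0 _) h)).
  by rewrite mulrA ler_wpM2r// exprn_ge0// mulr_ge0// ltW.
rewrite [leLHS](_ : _ = M ^+ n.+1 * \sum_(i < n.+1) 2 ^+ (n - i)%N); last first.
  rewrite mulr_sumr; apply: eq_bigr => i _.
  rewrite [(2 * M) ^+ _]exprMn mulrCA [LHS]mulrC -exprD; congr (_ ^+ _ * _).
  by rewrite addSn subnKC// -ltnS.
rewrite [(2 * M) ^+ _]exprMn mulrC ler_wpM2r ?exprn_ge0 ?(ltW M0)//.
rewrite (reindex_inj rev_ord_inj)/=.
under eq_bigr => i _ do rewrite subSS subKn -1?ltnS//.
have := subrX1 (2 : R) n.+1; rewrite (_ : 2 - 1 = 1 :> R) ?mul1r; last by ring.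
by move=> <-; rewrite gerBl.
Qed.

Lemma cvgn_series_normc x : cvgn (series (fun n => normc (x n))) ->
  exists l : C, series x @ \oo --> l.
Proof.
move=> cx.
have cRe : cvgn (series (fun n => Re (x n))).
  apply: normed_cvg; apply: series_le_cvg cx => n //=; first exact: normc_ge0.
  exact: normc_ge_Re.
have cIm : cvgn (series (fun n => Im (x n))).
  apply: normed_cvg; apply: series_le_cvg cx => n //=; first exact: normc_ge0.
  exact: normc_ge_Im.
exists (limn (series (fun n => Re (x n))) +i* limn (series (fun n => Im (x n)))).
apply/cvgc_ReIm; split => /=.
- by under eq_fun do rewrite Re_series.
- by under eq_fun do rewrite Im_series.
Qed.

Lemma cvg_series_geometric x A q : 0 <= q < 1 ->
  (forall n, normc (x n) <= A * q ^+ n) -> exists l : C, series x @ \oo --> l.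
Proof.
move=> /andP[q0 q1] xA; apply: cvgn_series_normc.
apply: (series_le_cvg _ _ xA) => n; first exact: normc_ge0.
- by rewrite (le_trans (normc_ge0 _) (xA n)).
- have /is_cvg_geometric_series : `|q| < 1 by rewrite ger0_norm.
  exact.
Qed.

(** The formal reciprocal series converges near [a], and its Cauchy product with the series of [f]
    is 1, so its sum can only be the inverse of [f]. *)
Lemma analyticV f a : analytic_at f a -> f a != 0 -> analytic_at (fun w => (f w)^-1) a.
Proof.
move=> fa fa0; have [c [A [rho fc]]] := analytic_pseries fa.
have [r0 cA cf] := fc.
have c0 : c 0%N != 0 by rewrite (pseries_at0 fc).
have [M [M0 dM]] := inv_coef_le c0 r0 cA.
pose d := inv_coef c.
pose r := Num.min rho M^-1.
have rr0 : 0 < r by rewrite lt_min r0 invr_gt0.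
have Hd w : normc (w - a) < r -> exists l : C, series (fun n => d n * (w - a) ^+ n) @ \oo --> l.
  rewrite lt_min => /andP[_ wr].
  apply: (@cvg_series_geometric _ (normc (c 0%N))^-1 (M * normc (w - a))).
    by rewrite mulr_ge0 ?normc_ge0 ?(ltW M0)//= mulrC -ltr_pdivlMr// div1r.
  move=> n; rewrite normcM normcX exprMn mulrA.
  by apply: ler_wpM2r; [rewrite exprn_ge0 ?normc_ge0|exact: dM].
(* The sum of the reciprocal series, with dummy value 0 where it diverges. *)
pose D w := if pselect (exists l : C, series (fun n => d n * (w - a) ^+ n) @ \oo --> l) is left h
  then projT1 (cid h) else 0.
have HD w : normc (w - a) < r -> series (fun n => d n * (w - a) ^+ n) @ \oo --> D w.
  by move=> /Hd h; rewrite /D; case: pselect => // h'; case: cid.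
apply: (@pseries_analytic _ _ _ d _ rr0) => w wr.
suff -> : (f w)^-1 = D w by exact: HD.
have Dd : pseries_on D a d (normc (c 0%N))^-1 r.
  split=> // n; apply: le_trans (ler_wpM2r _ (dM n)) _; first by rewrite exprn_ge0// ltW.
  rewrite -mulrA -exprMn ler_piMr ?invr_ge0 ?normc_ge0//.
  rewrite exprn_ile1 ?mulr_ge0 ?(ltW M0) ?(ltW rr0)//.
  by rewrite -ler_pdivlMl// mulr1 ge_min lexx orbT.
have fc' : pseries_on f a c A r.
  by apply: pseries_on_shrink fc _; rewrite rr0 ge_min lexx.
have fD1 : f w * D w = 1.
  apply: cvgc_unique (pseries_cauchy_product fc' Dd wr) _.
  apply: (@cvgc_near_cst _ _ _ 1) => -[//|n] _.
  rewrite seriesC_E big_ord_recl convolution_inv_coef// expr0 mulr1.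
  by rewrite big1 ?addr0// => i _; rewrite convolution_inv_coef// mul0r.
have fw0 : f w != 0.
  by apply/negP => /eqP fw0; move: fD1; rewrite fw0 mul0r => /esym/eqP; rewrite oner_eq0.
by rewrite -[LHS]mulr1 -fD1 mulKf.
Qed.

Lemma analytic_sum (I : Type) (r : seq I) (F : I -> C -> C) a :
  (forall i, analytic_at (F i) a) -> analytic_at (fun w => \sum_(i <- r) F i w) a.
Proof.
move=> Fa; elim: r => [|i r IH].
  by under eq_fun do rewrite big_nil; exact: analytic_cst.
under eq_fun do rewrite big_cons.
exact: (@analyticD _ (F i) (fun w => \sum_(i <- r) F i w) a (Fa i) IH).
Qed.

Lemma analytic_prod (I : Type) (r : seq I) (F : I -> C -> C) a :
  (forall i, analytic_at (F i) a) -> analytic_at (fun w => \prod_(i <- r) F i w) a.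
Proof.
move=> Fa; elim: r => [|i r IH].
  by under eq_fun do rewrite big_nil; exact: analytic_cst.
under eq_fun do rewrite big_cons.
exact: (@analyticM _ (F i) (fun w => \prod_(i <- r) F i w) a (Fa i) IH).
Qed.

Lemma analyticB f g a : analytic_at f a -> analytic_at g a ->
  analytic_at (fun w => f w - g w) a.
Proof.
move=> fa ga.
have -> : (fun w => f w - g w) = (fun w => f w + (-1) * g w).
  by apply/funext => w; rewrite mulN1r.
exact: (@analyticD _ f (fun w => -1 * g w) a fa
  (@analyticM _ (fun=> -1) g a (analytic_cst _ _) ga)).
Qed.

(** If the coefficients before [m] vanish, then at a zero at distance [t] the tail bound reads
    [|c m| t^m <= K t^(m+1)]. Zeros with arbitrarily small [t] force [c m = 0]. *)
Lemma pseries_eq0 f a c A rho : pseries_on f a c A rho ->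
  (forall e, 0 < e -> exists w, 0 < normc (w - a) < e /\ f w = 0) ->
  forall n, c n = 0.
Proof.
move=> fc z; have [r0 _ _] := fc; have A0 := pseries_on_ge0 fc.
elim/ltn_ind => m IH; apply/eqP; rewrite -normc_eq0 eq_le normc_ge0 andbT.
apply/ler_addgt0Pr => e e0; rewrite add0r.
pose K := A / rho ^+ m.+1 * 2.
have K0 : 0 <= K by rewrite mulr_ge0// divr_ge0// exprn_ge0// ltW.
have [|w [/andP[w0 wlt] fw0]] := z (Num.min (rho / 2) (e / (K + 1))).
  by rewrite lt_min !divr_gt0// ltr_wpDl.
move: wlt; rewrite lt_min => /andP[w2 we].
have wr : normc (w - a) < rho.
  by rewrite (lt_trans w2)// ltr_pdivrMr// ltr_pMr// ltr1n.
have := pseries_tail m.+1 fc wr.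
rewrite fw0 sub0r normcN big_ord_recr/= big1 ?add0r; last first.
  by move=> i _; rewrite IH ?mul0r.
rewrite normcM normcX => h.
set t := normc (w - a) in w0 w2 we wr h.
have q2 : t / rho < 1 / 2 by rewrite ltr_pdivrMr//; lra.
have {}h : normc (c m) * t ^+ m <= (K * t) * t ^+ m.
  apply: (le_trans h); rewrite ler_pdivrMr; last by rewrite subr_gt0; lra.
  rewrite [leRHS](_ : _ = (A * (t / rho) ^+ m.+1) * (2 * (1 - t / rho))); last first.
    by rewrite expr_div_n exprSr /K; ring.
  rewrite ler_peMr//; last by lra.
  by rewrite mulr_ge0// exprn_ge0// divr_ge0// ltW.
move: h; rewrite ler_pM2r ?exprn_gt0// => /le_trans; apply.
rewrite (@le_trans _ _ ((K + 1) * t))//; first by rewrite ler_wpM2r ?(ltW w0)// lerDl.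
by rewrite mulrC -ler_pdivlMr ?(ltW we)// ltr_wpDl.
Qed.

Lemma pseries_zeros f a c A rho : pseries_on f a c A rho ->
  (forall e, 0 < e -> exists w, 0 < normc (w - a) < e /\ f w = 0) ->
  forall w, normc (w - a) < rho -> f w = 0.
Proof.
move=> fc z w wr; have [_ _ /(_ w wr) H] := fc.
apply: cvgc_unique H _; apply: (@cvgc_near_cst _ _ _ 0) => n _.
rewrite seriesC_E big1// => i _.
by rewrite (pseries_eq0 fc z) mul0r.
Qed.

(** Let [T] be the supremum of the [t] up to which [f] vanishes along the segment. Zeros accumulate
    at [p T] from the left, so [f] vanishes on a disc about [p T]; this reaches beyond [T] unless
    [T = 1]. *)
Lemma analytic_segment_eq0 f a b e :
  (forall t : R, 0 <= t <= 1 -> analytic_at f (a + t%:C * (b - a))) ->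
  0 < e -> (forall w, normc (w - a) < e -> f w = 0) -> f b = 0.
Proof.
move=> fa e0 f0.
have [->|ab] := eqVneq b a; first by apply: f0; rewrite subrr Normc.normc0.
have d0 : 0 < normc (b - a) by rewrite normc_gt0 subr_eq0.
set d := normc (b - a) in d0.
pose p (t : R) := a + t%:C * (b - a).
have pB t u : normc (p t - p u) = `|t - u| * d.
  by rewrite /p opprD addrACA subrr add0r -mulrBl -rcB normcM normc_real.
pose S := [set t : R | 0 <= t <= 1 /\ forall u, 0 <= u <= t -> f (p u) = 0].
have S0 : S 0.
  split; first by rewrite lexx ler01.
  move=> u u0; apply: f0; have -> : u = 0 by apply/eqP; rewrite eq_le andbC.
  by rewrite /p mul0r addr0 subrr Normc.normc0.
have supS : has_sup S.
  by split; [exists 0|exists 1 => t [/andP[]]].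
pose T := sup S.
have T0 : 0 <= T by apply: ub_le_sup => //; case: supS.
have T1 : T <= 1 by apply: ge_sup; [exists 0|move=> t [/andP[]]].
have zT u : 0 <= u < T -> f (p u) = 0.
  move=> /andP[u0 uT]; have [t [_ St] ut] := sup_gt (ex_intro _ _ S0) uT.
  by apply: St; rewrite u0 ltW.
have near0 u : 0 <= u -> u < e / d -> f (p u) = 0.
  move=> u0 ue; apply: f0; rewrite (_ : a = p 0); last by rewrite /p mul0r addr0.
  by rewrite pB subr0 ger0_norm// -ltr_pdivlMr.
have Tpos : 0 < T.
  rewrite lt_neqAle T0 andbT eq_sym; apply/negP => /eqP T00.
  pose u := Num.min 1 (e / d / 2).
  have u0 : 0 < u by rewrite lt_min ltr01 !divr_gt0.
  suff /(ub_le_sup (proj2 supS)) : S u by rewrite -/T T00 leNgt u0.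
  split; first by rewrite (ltW u0) ge_min lexx.
  move=> v /andP[v0 vu]; apply: near0 => //; apply: (le_lt_trans vu).
  by rewrite gt_min ltr_pdivrMr ?ltr_pMr ?divr_gt0 ?ltr1n ?orbT.
have [c [A [rho fc]]] : exists c A rho, pseries_on f (p T) c A rho.
  by apply: analytic_pseries; apply: fa; rewrite T0.
have [r0 _ _] := fc.
have zero w : normc (w - p T) < rho -> f w = 0.
  apply: (pseries_zeros fc) => eps eps0.
  (* A parameter strictly before [T], so that [p u] is a zero other than [p T]; it is within [eps],
     and [T / 2] keeps it nonnegative. *)
  pose u := Num.max (T / 2) (T - eps / d / 2).
  have uT : u < T.
    rewrite gt_max ltr_pdivrMr// ltr_pMr// ltr1n/= ltrBlDr ltrDl.
    by rewrite !divr_gt0.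
  have u0 : 0 <= u by rewrite le_max divr_ge0.
  exists (p u); split; last by apply: zT; rewrite u0.
  rewrite pB distrC gtr0_norm ?subr_gt0//.
  rewrite mulr_gt0 ?subr_gt0//= -ltr_pdivlMr//.
  apply: (@le_lt_trans _ _ (eps / d / 2)).
    by rewrite lerBlDl -lerBlDr le_max lexx orbT.
  by rewrite ltr_pdivrMr ?ltr_pMr ?divr_gt0 ?ltr1n.
have [T1'|T1'] := ltP T 1; last first.
  have -> : b = p T.
    have -> : T = 1 by apply/eqP; rewrite eq_le T1.
    by rewrite /p mul1r addrC subrK.
  by apply: zero; rewrite subrr Normc.normc0.
pose u := Num.min 1 (T + rho / d / 2).
have uT : T < u by rewrite lt_min T1' ltrDl !divr_gt0.
suff /(ub_le_sup (proj2 supS)) : S u by rewrite -/T leNgt uT.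
split; first by rewrite (le_trans T0 (ltW uT)) ge_min lexx.
move=> v /andP[v0 vu]; have [vT|vT] := ltP v T; first by apply: zT; rewrite v0.
apply: zero; rewrite pB ger0_norm ?subr_ge0// -ltr_pdivlMr//.
apply: (@le_lt_trans _ _ (rho / d / 2)).
  by rewrite lerBlDl (le_trans vu)// ge_min lexx orbT.
by rewrite ltr_pdivrMr ?ltr_pMr ?divr_gt0 ?ltr1n.
Qed.

Lemma analytic_segment_eq f g a b e :
  (forall t : R, 0 <= t <= 1 -> analytic_at f (a + t%:C * (b - a))) ->
  (forall t : R, 0 <= t <= 1 -> analytic_at g (a + t%:C * (b - a))) ->
  0 < e -> (forall w, normc (w - a) < e -> f w = g w) -> f b = g b.
Proof.
move=> fa ga e0 fg; apply/eqP; rewrite -subr_eq0; apply/eqP.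
apply: (@analytic_segment_eq0 (fun w => f w - g w) a b e _ e0) => [t t1|w /fg ->].
- exact: (analyticB (fa t t1) (ga t t1)).
- by rewrite subrr.
Qed.

(** The default of [xget] is returned only when no continuation exists, which the witness [g]
    excludes. The function chosen may still differ from [g]. *)
Lemma continuationP (U : set C) f (D : set C) g :
  analytic_on D g -> (forall w, U w -> g w = f w) ->
  analytic_on D (continuation U f D) /\ forall w, U w -> continuation U f D w = f w.
Proof.
move=> gD gU; rewrite /continuation.
by case: xgetP => [h -> //|/(_ g)[]].
Qed.

(** The chosen function and [g] coincide with [f] near [a], and the identity theorem carries their
    equality along the segment to [b]. *)
Lemma continuation_eq (U : set C) f (D : set C) g a b e :
  analytic_on D g -> (forall w, U w -> g w = f w) ->
  0 < e -> (forall w, normc (w - a) < e -> U w) ->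
  (forall t : R, 0 <= t <= 1 -> D (a + t%:C * (b - a))) ->
  continuation U f D b = g b.
Proof.
move=> gD gU e0 aU abD; have [hD hU] := continuationP gD gU.
apply: (@analytic_segment_eq _ _ a b e _ _ e0) => [t t1|t t1|w /aU Uw].
- by apply: hD; exact: abD.
- by apply: gD; exact: abD.
- by rewrite hU// gU.
Qed.

End AnalyticInverse.

(** * Integrals of complex functions *)

Section ComplexIntegral.
Context {R : realType} {disp : measure_display} {T : measurableType disp}.
Variable mu : {measure set T -> \bar R}.
Variable D : set T.
Hypothesis mD : measurable D.
Local Notation C := R[i].
Implicit Types (f g h : T -> C) (k : C) (M : T -> R).

Definition cmeasurable f :=
  measurable_fun D (fun x => Re (f x)) /\ measurable_fun D (fun x => Im (f x)).

Lemma cmeasurable_cst k : cmeasurable (fun=> k).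
Proof. by split; exact: measurable_cst. Qed.

Lemma cmeasurableD f g : cmeasurable f -> cmeasurable g -> cmeasurable (fun x => f x + g x).
Proof.
move=> [f1 f2] [g1 g2]; split.
- by under eq_fun do rewrite ReD; exact: measurable_funD.
- by under eq_fun do rewrite ImD; exact: measurable_funD.
Qed.

Lemma cmeasurableM f g : cmeasurable f -> cmeasurable g -> cmeasurable (fun x => f x * g x).
Proof.
move=> [f1 f2] [g1 g2]; split.
- by under eq_fun do rewrite ReM; apply: measurable_funB; exact: measurable_funM.
- by under eq_fun do rewrite ImM; apply: measurable_funD; exact: measurable_funM.
Qed.

Lemma cmeasurable_real M : measurable_fun D M -> cmeasurable (fun x => (M x)%:C).
Proof. by move=> mM; split => //; exact: measurable_cst. Qed.

Lemma cmeasurableN f : cmeasurable f -> cmeasurable (fun x => - f x).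
Proof.
move=> fm; under eq_fun do rewrite -mulN1r.
by apply: cmeasurableM => //; exact: cmeasurable_cst.
Qed.

Lemma cmeasurableB f g : cmeasurable f -> cmeasurable g -> cmeasurable (fun x => f x - g x).
Proof. by move=> fm /cmeasurableN; exact: cmeasurableD. Qed.

Lemma measurable_normc f : cmeasurable f -> measurable_fun D (fun x => normc (f x)).
Proof.
move=> [f1 f2].
have -> : (fun x => normc (f x)) =
    (@powR R ^~ 2^-1) \o (fun x => Re (f x) ^+ 2 + Im (f x) ^+ 2).
  apply/funext => x /=; rewrite powR12_sqrt ?addr_ge0 ?sqr_ge0//.
  by case: (f x).
apply: measurableT_comp; first exact: measurable_powR.
by apply: measurable_funD; exact: measurable_funX.
Qed.

Lemma measurable_invr M : measurable_fun D M -> (forall x, 0 <= M x) ->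
  measurable_fun D (fun x => (M x)^-1).
Proof.
move=> mM M0.
have -> : (fun x => (M x)^-1) = (@powR R ^~ (- 1)) \o M.
  by apply/funext => x /=; rewrite powR_inv1.
by apply: measurableT_comp => //; exact: measurable_powR.
Qed.

Lemma cmeasurableV f : cmeasurable f -> cmeasurable (fun x => (f x)^-1).
Proof.
move=> fm; have [f1 f2] := fm.
have m2 : measurable_fun D (fun x => (normc (f x) ^+ 2)^-1).
  apply: measurable_invr => [|x]; last exact: sqr_ge0.
  by apply: measurable_funX; exact: measurable_normc.
split.
- have -> : (fun x => Re (f x)^-1) = (fun x => Re (f x) * (normc (f x) ^+ 2)^-1).
    by apply/funext => x; rewrite normc_sqr; case: (f x).
  exact: measurable_funM.
- have -> : (fun x => Im (f x)^-1) = (fun x => - (Im (f x) * (normc (f x) ^+ 2)^-1)).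
    by apply/funext => x; rewrite normc_sqr; case: (f x).
  by apply: measurable_funN; exact: measurable_funM.
Qed.

Lemma cmeasurable_sum I (r : seq I) (F : I -> T -> C) :
  (forall i, cmeasurable (F i)) -> cmeasurable (fun x => \sum_(i <- r) F i x).
Proof.
move=> Fm; elim: r => [|i r IH].
  by under eq_fun do rewrite big_nil; exact: cmeasurable_cst.
by under eq_fun do rewrite big_cons; exact: cmeasurableD.
Qed.

Lemma eq_cmeasurable f g : (forall x, D x -> f x = g x) -> cmeasurable f -> cmeasurable g.
Proof.
move=> fg [f1 f2]; split.
- by apply: eq_measurable_fun f1 => x; rewrite inE => Dx; rewrite fg.
- by apply: eq_measurable_fun f2 => x; rewrite inE => Dx; rewrite fg.
Qed.

Lemma cintegrable_dom f M : cmeasurable f ->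
  (forall x, D x -> normc (f x) <= M x) -> mu.-integrable D (EFin \o M) ->
  cintegrable mu D f.
Proof.
move=> [f1 f2] fM iM; split; apply: (le_integrable mD _ _ iM).
- exact/measurable_EFinP.
- move=> x Dx /=; rewrite lee_fin (le_trans (normc_ge_Re _))//.
  by rewrite (le_trans (fM x Dx))// ler_norm.
- exact/measurable_EFinP.
- move=> x Dx /=; rewrite lee_fin (le_trans (normc_ge_Im _))//.
  by rewrite (le_trans (fM x Dx))// ler_norm.
Qed.

Lemma cintegrable_measurable f : cintegrable mu D f -> cmeasurable f.
Proof.
by move=> [/measurable_int/measurable_EFinP a /measurable_int/measurable_EFinP b].
Qed.

Lemma cintegrable_normc f : cintegrable mu D f ->
  mu.-integrable D (EFin \o (fun x => normc (f x))).
Proof.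
move=> fi; have [f1 f2] := fi.
apply: (le_integrable mD (g := fun x => (`|(Re (f x))%:E| + `|(Im (f x))%:E|)%E)).
- by apply/measurable_EFinP; apply: measurable_normc; exact: cintegrable_measurable.
- move=> x Dx /=; rewrite lee_fin ger0_norm ?normc_ge0//.
  by rewrite ger0_norm ?addr_ge0// normc_le_ReIm.
- by apply: integrableD => //; exact: integrable_abse.
Qed.

Lemma cintegrable_dom2 f g : cmeasurable f ->
  (forall x, D x -> normc (f x) <= normc (g x)) -> cintegrable mu D g ->
  cintegrable mu D f.
Proof.
by move=> fm fg /cintegrable_normc gi; exact: cintegrable_dom gi.
Qed.

Lemma eq_cintegrable f g : (forall x, D x -> f x = g x) ->
  cintegrable mu D f -> cintegrable mu D g.
Proof.
move=> fg fi; apply: (cintegrable_dom2 _ _ fi).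
  exact: eq_cmeasurable fg (cintegrable_measurable fi).
by move=> x Dx; rewrite fg.
Qed.

Lemma eq_cintegral f g : (forall x, D x -> f x = g x) ->
  cintegral mu D f = cintegral mu D g.
Proof.
by move=> fg; congr Complex; apply: eq_Rintegral => x; rewrite inE => Dx; rewrite fg.
Qed.

Lemma cintegrableD f g : cintegrable mu D f -> cintegrable mu D g ->
  cintegrable mu D (fun x => f x + g x).
Proof.
move=> [f1 f2] [g1 g2]; split.
- by under eq_fun do rewrite ReD EFinD; exact: integrableD.
- by under eq_fun do rewrite ImD EFinD; exact: integrableD.
Qed.

Lemma cintegralD f g : cintegrable mu D f -> cintegrable mu D g ->
  cintegral mu D (fun x => f x + g x) = cintegral mu D f + cintegral mu D g.
Proof.
move=> [f1 f2] [g1 g2]; apply: complex_ext; rewrite ?ReD ?ImD /=.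
- by under eq_Rintegral do rewrite ReD; exact: RintegralD.
- by under eq_Rintegral do rewrite ImD; exact: RintegralD.
Qed.

Lemma cintegrableZl k f : cintegrable mu D f -> cintegrable mu D (fun x => k * f x).
Proof.
move=> [f1 f2]; split.
- under eq_fun do rewrite ReM EFinB !EFinM.
  by apply: integrableB => //; exact: integrableZl.
- under eq_fun do rewrite ImM EFinD !EFinM.
  by apply: integrableD => //; exact: integrableZl.
Qed.

Lemma cintegralZl k f : cintegrable mu D f ->
  cintegral mu D (fun x => k * f x) = k * cintegral mu D f.
Proof.
move=> [f1 f2].
have I a (F : T -> R) : mu.-integrable D (EFin \o F) ->
    mu.-integrable D (EFin \o (fun x => a * F x)).
  by move=> iF; rewrite /comp; under eq_fun do rewrite EFinM; exact: integrableZl.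
apply: complex_ext; rewrite ?ReM ?ImM /=.
- under eq_Rintegral do rewrite ReM.
  by rewrite RintegralB ?RintegralZl//; exact: I.
- under eq_Rintegral do rewrite ImM.
  by rewrite RintegralD ?RintegralZl//; exact: I.
Qed.

Lemma cintegrableZr k f : cintegrable mu D f -> cintegrable mu D (fun x => f x * k).
Proof. by move=> /(cintegrableZl k); under eq_fun do rewrite mulrC. Qed.

Lemma cintegralZr k f : cintegrable mu D f ->
  cintegral mu D (fun x => f x * k) = cintegral mu D f * k.
Proof.
move=> fi; rewrite mulrC -cintegralZl//; apply: eq_cintegral => x _.
exact: mulrC.
Qed.

Lemma cintegrableB f g : cintegrable mu D f -> cintegrable mu D g ->
  cintegrable mu D (fun x => f x - g x).
Proof.
move=> fi /(cintegrableZl (-1)) gi; under eq_fun do rewrite -[X in _ + X]mulN1r.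
exact: cintegrableD.
Qed.

Lemma cintegralB f g : cintegrable mu D f -> cintegrable mu D g ->
  cintegral mu D (fun x => f x - g x) = cintegral mu D f - cintegral mu D g.
Proof.
move=> fi gi; rewrite -[X in _ = _ + X]mulN1r -cintegralZl// -cintegralD//.
  by apply: eq_cintegral => x _; rewrite mulN1r.
exact: cintegrableZl.
Qed.

Lemma cintegral_eq0 : cintegral mu D (fun=> 0 : C) = 0.
Proof.
have i0 : cintegrable mu D (fun=> 0 : C) by split; exact: integrable0.
rewrite -[RHS](mul0r (cintegral mu D (fun=> 0))) -cintegralZl//.
by apply: eq_cintegral => x _; rewrite mul0r.
Qed.

Lemma cintegrable_sum I (r : seq I) (F : I -> T -> C) :
  (forall i, cintegrable mu D (F i)) -> cintegrable mu D (fun x => \sum_(i <- r) F i x).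
Proof.
move=> Fi; elim: r => [|i r IH].
  by under eq_fun do rewrite big_nil; split; exact: integrable0.
by under eq_fun do rewrite big_cons; exact: cintegrableD.
Qed.

Lemma cintegral_sum I (r : seq I) (F : I -> T -> C) :
  (forall i, cintegrable mu D (F i)) ->
  cintegral mu D (fun x => \sum_(i <- r) F i x) = \sum_(i <- r) cintegral mu D (F i).
Proof.
move=> Fi; elim: r => [|i r IH].
  by rewrite big_nil -[RHS]cintegral_eq0; apply: eq_cintegral => x _; rewrite big_nil.
rewrite big_cons -IH -cintegralD//; last exact: cintegrable_sum.
by apply: eq_cintegral => x _; rewrite big_cons.
Qed.

(** The factor 2 comes from bounding the real and imaginary parts separately. *)
Lemma normc_cintegral_le f M : cmeasurable f ->
  (forall x, D x -> normc (f x) <= M x) -> mu.-integrable D (EFin \o M) ->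
  normc (cintegral mu D f) <= 2 * \int[mu]_(x in D) M x.
Proof.
move=> fm fM iM; have [f1 f2] := cintegrable_dom fm fM iM.
have H (F : T -> R) : mu.-integrable D (EFin \o F) -> (forall x, D x -> `|F x| <= M x) ->
    `|\int[mu]_(x in D) F x| <= \int[mu]_(x in D) M x.
  move=> iF FM; rewrite (le_trans (le_normr_Rintegral mD iF))//.
  by apply: le_Rintegral => //; exact: integrable_norm.
rewrite (le_trans (normc_le_ReIm _))// mulr_natl mulr2n lerD//.
- by apply: H => // x Dx; rewrite (le_trans (normc_ge_Re _))// fM.
- by apply: H => // x Dx; rewrite (le_trans (normc_ge_Im _))// fM.
Qed.

Lemma cvg_cintegral (f_ : nat -> T -> C) f M :
  (forall n, cmeasurable (f_ n)) ->
  (forall x, D x -> f_ ^~ x @ \oo --> f x) ->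
  (forall n x, D x -> normc (f_ n x) <= M x) -> mu.-integrable D (EFin \o M) ->
  cintegrable mu D f /\ cintegral mu D (f_ n) @[n --> \oo] --> cintegral mu D f.
Proof.
move=> fm ff fM iM.
have H (F_ : nat -> T -> R) (F : T -> R) : (forall n, measurable_fun D (F_ n)) ->
    (forall x, D x -> F_ ^~ x @ \oo --> F x) ->
    (forall n x, D x -> `|F_ n x| <= M x) ->
    mu.-integrable D (EFin \o F) /\
    \int[mu]_(x in D) F_ n x @[n --> \oo] --> \int[mu]_(x in D) F x.
  move=> mF FF FM.
  have mF' : measurable_fun D F by exact: measurable_fun_cvg FF.
  have [|||||i1 i2 i3] := @dominated_convergence _ T R mu D mD
      (fun n => EFin \o F_ n) (EFin \o F) (EFin \o M).
  - by move=> n; exact/measurable_EFinP.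
  - exact/measurable_EFinP.
  - by apply: aeW => x Dx; apply: cvg_EFin; [exact: nearW|exact: FF].
  - exact: iM.
  - by apply: aeW => x n Dx; rewrite /= lee_fin; exact: FM.
  split => //.
  apply: (@fine_cvg _ _ _ _ (fun n => \int[mu]_(x in D) (F_ n x)%:E)%E).
  by rewrite fineK//; exact: integrable_fin_num.
have [a1 a2] := H (fun n x => Re (f_ n x)) (fun x => Re (f x))
  (fun n => (fm n).1) (fun x Dx => (iffLR (cvgc_ReIm _ _) (ff x Dx)).1)
  (fun n x Dx => le_trans (normc_ge_Re _) (fM n x Dx)).
have [b1 b2] := H (fun n x => Im (f_ n x)) (fun x => Im (f x))
  (fun n => (fm n).2) (fun x Dx => (iffLR (cvgc_ReIm _ _) (ff x Dx)).2)
  (fun n x Dx => le_trans (normc_ge_Im _) (fM n x Dx)).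
by split => //; apply/cvgc_ReIm.
Qed.

(** Termwise integration of a power series whose Cauchy bound [M x] is integrable in [x]: with
    [q = |w - a| / rho], all partial sums are dominated by [M x / (1 - q)]. *)
Lemma analytic_integral (f : C -> T -> C) (c : nat -> T -> C) M (a : C) (rho : R) :
  0 < rho -> (forall n, cmeasurable (c n)) ->
  (forall n x, D x -> normc (c n x) * rho ^+ n <= M x) ->
  mu.-integrable D (EFin \o M) ->
  (forall w x, normc (w - a) < rho -> D x ->
    series (fun n => c n x * (w - a) ^+ n) @ \oo --> f w x) ->
  analytic_at (fun w => cintegral mu D (f w)) a.
Proof.
move=> r0 cm cM iM cf.
have ci n : cintegrable mu D (c n).
  apply: (@cintegrable_dom _ (fun x => (rho ^+ n)^-1 * M x)) => //.
  - by move=> x Dx; rewrite ler_pdivlMl ?exprn_gt0// mulrC; exact: cM.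
  - by rewrite /comp; under eq_fun do rewrite EFinM; exact: integrableZl.
apply: (@pseries_analytic _ _ _ (fun n => cintegral mu D (c n)) rho) => // w wr.
pose q := normc (w - a) / rho.
have [q0 q1] : 0 <= q /\ q < 1.
  by rewrite divr_ge0 ?normc_ge0 ?(ltW r0)//= ltr_pdivrMr// mul1r.
have [||||_] := @cvg_cintegral
  (fun N x => series (fun n => c n x * (w - a) ^+ n) N) (f w) (fun x => (1 - q)^-1 * M x).
- move=> n; under eq_fun do rewrite seriesC_E.
  by apply: cmeasurable_sum => i; apply: cmeasurableM => //; exact: cmeasurable_cst.
- by move=> x; exact: cf.
- move=> n x Dx; rewrite seriesC_E (le_trans (le_normc_sum _ _ _))//.
  have M0 : 0 <= M x by apply: le_trans (cM 0%N x Dx); rewrite expr0 mulr1 normc_ge0.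
  apply: (@le_trans _ _ (\sum_(i < n) q ^+ i * M x)).
    apply: ler_sum => i _; rewrite normcM normcX /q expr_div_n mulrAC mulrC -mulrA.
    rewrite ler_wpM2l ?exprn_ge0 ?normc_ge0//.
    by rewrite ler_pdivlMr ?exprn_gt0//; exact: cM.
  by rewrite -mulr_suml ler_wpM2r// sum_geometric_le// q0.
- by rewrite /comp; under eq_fun do rewrite EFinM; exact: integrableZl.
apply: eq_cvgc => N; rewrite seriesC_E.
transitivity (cintegral mu D (fun x => \sum_(n < N) (c n x * (w - a) ^+ n))).
  by apply: eq_cintegral => x _; rewrite seriesC_E.
rewrite (@cintegral_sum _ _ (fun (n : 'I_N) x => c n x * (w - a) ^+ n)).
  by apply: eq_bigr => i _; rewrite cintegralZr.
by move=> i; exact: cintegrableZr.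
Qed.

End ComplexIntegral.

(** * Complex exponential and complex powers *)

Section ComplexExponential.
Context {R : realType}.
Local Notation C := R[i].
Implicit Types (z w : C) (t : R).

Lemma Re_cexp z : Re (cexp z) = expR (Re z) * cos (Im z).
Proof. by rewrite /cexp ReMr. Qed.

Lemma Im_cexp z : Im (cexp z) = expR (Re z) * sin (Im z).
Proof. by rewrite /cexp ImMr. Qed.

Lemma cexpD z w : cexp (z + w) = cexp z * cexp w.
Proof.
apply: complex_ext.
- by rewrite Re_cexp [RHS]ReM !Re_cexp !Im_cexp ReD ImD expRD cosD; ring.
- by rewrite Im_cexp [RHS]ImM !Re_cexp !Im_cexp ReD ImD expRD sinD; ring.
Qed.

Lemma cexp0 : cexp (0 : C) = 1.
Proof. by apply: complex_ext; rewrite ?Re_cexp ?Im_cexp/= expR0 ?cos0 ?sin0 mul1r. Qed.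

Lemma normc_cexp z : normc (cexp z) = expR (Re z).
Proof.
rewrite /cexp normcM normc_real ger0_norm ?expR_ge0//= cos2Dsin2 sqrtr1.
by rewrite mulr1.
Qed.

Lemma cexp_neq0 z : cexp z != 0.
Proof. by rewrite -normc_gt0 normc_cexp expR_gt0. Qed.

Lemma cexpN z : cexp (- z) = (cexp z)^-1.
Proof.
by apply: (mulfI (cexp_neq0 z)); rewrite -cexpD subrr cexp0 divff// cexp_neq0.
Qed.

Lemma cexp_real t : cexp t%:C = (expR t)%:C.
Proof.
by apply: complex_ext; rewrite ?Re_cexp ?Im_cexp/= ?cos0 ?sin0 ?mulr1 ?mulr0.
Qed.

Lemma cexpMn z n : cexp (n%:R * z) = cexp z ^+ n.
Proof.
elim: n => [|n IH]; first by rewrite mul0r cexp0 expr0.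
by rewrite -addn1 natrD mulrDl mul1r cexpD IH addn1 exprSr.
Qed.

Lemma clog_real t : 0 < t -> clog t%:C = (ln t)%:C.
Proof.
move=> t0; rewrite /clog normc_real gtr0_norm//; congr Complex.
by rewrite /carg Im_real Re_real lexx normc_real gtr0_norm// divff ?gt_eqF// acos1.
Qed.

Lemma cpow_real t w : 0 < t -> cpow t%:C w = cexp (w * (ln t)%:C).
Proof. by move=> t0; rewrite /cpow clog_real. Qed.

Lemma cexp_clog z : z != 0 -> cexp (clog z) = z.
Proof.
move=> z0; have n0 : 0 < normc z by rewrite normc_gt0.
have x1 : -1 <= Re z / normc z <= 1.
  rewrite -ler_norml normrM normfV [X in _ / X]ger0_norm ?normc_ge0//.
  by rewrite ler_pdivrMr// mul1r normc_ge_Re.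
(* This is the sine of the [acos] in [carg]; the test on the sign of [Im z] there removes the
   absolute value. *)
have y0 : Num.sqrt (1 - (Re z / normc z) ^+ 2) = `|Im z| / normc z.
  rewrite -(@ger0_norm _ (`|Im z| / normc z)) ?divr_ge0 ?normc_ge0//.
  rewrite -sqrtr_sqr; congr Num.sqrt.
  rewrite !expr_div_n real_normK ?num_real// normc_sqr.
  have : Re z ^+ 2 + Im z ^+ 2 != 0 by rewrite -normc_sqr expf_eq0/= gt_eqF.
  by move=> h; field.
apply: complex_ext; rewrite ?Re_cexp ?Im_cexp/= lnK ?posrE// /carg.
- case: ifP => _; rewrite ?cosN acosK ?in_itv//=; by rewrite mulrC divfK// gt_eqF.
- case: ifPn => h; rewrite ?sinN sin_acos// y0.
  + by rewrite ger0_norm// mulrC divfK// gt_eqF.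
  + by rewrite ler0_norm ?ltW ?ltNge// mulNr opprK mulrC divfK// gt_eqF.
Qed.

Lemma cpowD z v w : cpow z (v + w) = cpow z v * cpow z w.
Proof. by rewrite /cpow mulrDl cexpD. Qed.

Lemma cpow1 z : z != 0 -> cpow z 1 = z.
Proof. by move=> z0; rewrite /cpow mul1r cexp_clog. Qed.

Lemma cpowN z w : cpow z (- w) = (cpow z w)^-1.
Proof. by rewrite /cpow mulNr cexpN. Qed.

Lemma cpow_neq0 z w : cpow z w != 0. Proof. exact: cexp_neq0. Qed.

(* For a real variable; the real and imaginary parts are derived separately. *)
Definition is_cderive (f : R -> C) (t : R) (df : C) :=
  is_derive t 1 (fun t => Re (f t)) (Re df) /\
  is_derive t 1 (fun t => Im (f t)) (Im df).

Lemma is_derive_congr (f g : R -> R) t a b :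
  is_derive t 1 f a -> (forall x, f x = g x) -> a = b -> is_derive t 1 g b.
Proof. by move=> fa /funext <- <-. Qed.

Lemma is_cderive_congr (f g : R -> C) t a b :
  is_cderive f t a -> (forall x, f x = g x) -> a = b -> is_cderive g t b.
Proof. by move=> fa /funext <- <-. Qed.

Lemma is_cderive_cst z t : is_cderive (fun=> z) t 0.
Proof. by split; exact: is_derive_cst. Qed.

Lemma is_cderive_real (f : R -> R) t (df : R) :
  is_derive t 1 f df -> is_cderive (fun t => (f t)%:C) t df%:C.
Proof. by move=> fd; split => //; exact: is_derive_cst. Qed.

Lemma is_cderiveD (f g : R -> C) t df dg : is_cderive f t df -> is_cderive g t dg ->
  is_cderive (fun t => f t + g t) t (df + dg).
Proof.
move=> [f1 f2] [g1 g2]; split.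
- by apply: (is_derive_congr (is_deriveD f1 g1)); [move=> x; rewrite ReD|rewrite ReD].
- by apply: (is_derive_congr (is_deriveD f2 g2)); [move=> x; rewrite ImD|rewrite ImD].
Qed.

Lemma is_cderiveM (f g : R -> C) t df dg : is_cderive f t df -> is_cderive g t dg ->
  is_cderive (fun t => f t * g t) t (df * g t + f t * dg).
Proof.
move=> [f1 f2] [g1 g2]; split.
- apply: (is_derive_congr (is_deriveB (is_deriveM f1 g1) (is_deriveM f2 g2))).
    by move=> x; rewrite ReM.
  by rewrite ReD !ReM /GRing.scale/=; ring.
- apply: (is_derive_congr (is_deriveD (is_deriveM f1 g2) (is_deriveM f2 g1))).
    by move=> x; rewrite ImM.
  by rewrite ImD !ImM /GRing.scale/=; ring.
Qed.

Lemma is_cderiveMl (g : R -> C) t z dg : is_cderive g t dg ->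
  is_cderive (fun t => z * g t) t (z * dg).
Proof.
move=> gd; apply: (is_cderive_congr (is_cderiveM (is_cderive_cst z t) gd)) => //.
by rewrite mul0r add0r.
Qed.

Lemma is_cderiveN (f : R -> C) t df : is_cderive f t df ->
  is_cderive (fun t => - f t) t (- df).
Proof.
move=> fd; apply: (is_cderive_congr (is_cderiveMl (-1) fd)); last by rewrite mulN1r.
by move=> x; rewrite mulN1r.
Qed.

Lemma is_cderiveB (f g : R -> C) t df dg : is_cderive f t df -> is_cderive g t dg ->
  is_cderive (fun t => f t - g t) t (df - dg).
Proof. by move=> fd /is_cderiveN; exact: is_cderiveD. Qed.

Lemma is_cderive_cexp (f : R -> C) t df : is_cderive f t df ->
  is_cderive (fun t => cexp (f t)) t (df * cexp (f t)).
Proof.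
move=> [f1 f2].
have e1 := is_derive1_comp (is_derive_expR (Re (f t))) f1.
have c1 := is_derive1_comp (is_derive_cos (Im (f t))) f2.
have s1 := is_derive1_comp (is_derive_sin (Im (f t))) f2.
split.
- apply: (is_derive_congr (is_deriveM e1 c1)) => [x|]; first by rewrite Re_cexp.
  by rewrite ReM Re_cexp Im_cexp /GRing.scale/=; ring.
- apply: (is_derive_congr (is_deriveM e1 s1)) => [x|]; first by rewrite Im_cexp.
  by rewrite ImM Re_cexp Im_cexp /GRing.scale/=; ring.
Qed.

Lemma is_cderive_id t : is_cderive (fun t => t%:C) t 1.
Proof. by split; [exact: is_derive_id|exact: is_derive_cst]. Qed.

Lemma is_cderive_ln t : 0 < t -> is_cderive (fun t => (ln t)%:C) t (t^-1)%:C.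
Proof. by move=> t0; apply: is_cderive_real; exact: is_derive1_ln. Qed.

Lemma is_cderiveX (f : R -> C) t df n : is_cderive f t df ->
  is_cderive (fun t => f t ^+ n.+1) t (n.+1%:R * f t ^+ n * df).
Proof.
move=> fd; elim: n => [|n IH].
  by apply: (is_cderive_congr fd); [move=> x; rewrite expr1|rewrite expr0 !mul1r].
apply: (is_cderive_congr (is_cderiveM fd IH)) => [x|]; first by rewrite [RHS]exprS.
by rewrite -[in RHS]addn1 natrD exprS; ring.
Qed.

Lemma is_cderive_sum I (r : seq I) (F : I -> R -> C) (dF : I -> C) t :
  (forall i, is_cderive (F i) t (dF i)) ->
  is_cderive (fun t => \sum_(i <- r) F i t) t (\sum_(i <- r) dF i).
Proof.
move=> Fd; elim: r => [|i r IH].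
  by under eq_fun do rewrite big_nil; rewrite big_nil; exact: is_cderive_cst.
under eq_fun do rewrite big_cons; rewrite big_cons.
exact: (is_cderiveD (Fd i) IH).
Qed.

Lemma is_cderive_continuous (f : R -> C) t df : is_cderive f t df ->
  {for t, continuous (fun t => Re (f t))} /\ {for t, continuous (fun t => Im (f t))}.
Proof.
by move=> [[d1 _] [d2 _]]; split;
  apply/differentiable_continuous/derivable1_diffP.
Qed.

(** The mean value theorem gives different intermediate points for the real and the imaginary part,
    whence the factor 2. *)
Lemma cmean_value_le (f df : R -> C) (K : R) :
  (forall t, is_cderive f t (df t)) ->
  (forall t, 0 <= t <= 1 -> normc (df t) <= K) -> normc (f 1 - f 0) <= 2 * K.
Proof.
move=> fd dfK; rewrite (le_trans (normc_le_ReIm _))// mulr_natl mulr2n ReB ImB.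
have H (g dg : R -> R) : (forall t, is_derive t 1 g (dg t)) ->
    (forall t, 0 <= t <= 1 -> `|dg t| <= K) -> `|g 1 - g 0| <= K.
  move=> gd dgK.
  have cg : {within `[0, 1], continuous g}.
    by apply: derivable_within_continuous => x _; case: (gd x).
  have [c c01 ->] := MVT ltr01 (fun x _ => gd x) cg.
  rewrite subr0 mulr1; apply: dgK.
  by move: c01; rewrite in_itv/= => /andP[/ltW -> /ltW ->].
apply: lerD.
- apply: (H _ (fun t => Re (df t)) (fun t => (fd t).1)) => t /dfK.
  exact: (le_trans (normc_ge_Re _)).
- apply: (H _ (fun t => Im (df t)) (fun t => (fd t).2)) => t /dfK.
  exact: (le_trans (normc_ge_Im _)).
Qed.

(** With [S] the partial sum at [t z], the product [e^(-t z) S t] is 1 at [t = 0] and its derivative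
    telescopes to [- z e^(-t z) (t z)^n / n!]. The mean value inequality on [0, 1] then bounds the
    error by a term of the real exponential series. *)
Lemma cvg_cexp_series z : series (fun n => (n`!)%:R^-1 * z ^+ n) @ \oo --> cexp z.
Proof.
pose r := normc z.
apply/cvgc_shiftS.
apply: (@squeeze_cvgc _ _ _ _ _ _
  (fun n => expR (2 * r) * (2 * r) * exp_coeff r n)); last first.
  rewrite -[X in _ --> X](mulr0 (expR (2 * r) * (2 * r))).
  by apply: cvgMr; exact: cvg_exp_coeff.
apply: nearW => n; rewrite seriesC_E.
pose S (t : R) : C := \sum_(k < n.+1) (k`!)%:R^-1 * (t%:C * z) ^+ k.
have dS t : is_cderive S t (z * (S t - (n`!)%:R^-1 * (t%:C * z) ^+ n)).
  have dtz : is_cderive (fun t => t%:C * z) t z.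
    apply: (is_cderive_congr (is_cderiveM (is_cderive_id t) (is_cderive_cst z t))) => //.
    by rewrite mul1r mulr0 addr0.
  have h := is_cderiveD (is_cderive_cst (0`!%:R^-1 * 1) t)
    (@is_cderive_sum _ (index_enum 'I_n) (fun k t => (k.+1`!)%:R^-1 * (t%:C * z) ^+ k.+1)
      _ t (fun k => is_cderiveMl (k.+1`!)%:R^-1 (is_cderiveX k dtz))).
  apply: (is_cderive_congr h) => [x|].
    by rewrite /S big_ord_recl expr0.
  rewrite add0r /S big_ord_recr/= addrK mulr_sumr; apply: eq_bigr => k _.
  have k0 : k.+1%:R != 0 :> C by rewrite pnatr_eq0.
  have kf0 : k`!%:R != 0 :> C by rewrite pnatr_eq0 -lt0n fact_gt0.
  rewrite factS natrM; move: (k.+1%:R : C) (k`!%:R : C) k0 kf0 => A B A0 B0.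
  by field; rewrite A0 B0.
pose f t := cexp (- (t%:C * z)) * S t.
have df t : is_cderive f t (- (z * cexp (- (t%:C * z)) * ((n`!)%:R^-1 * (t%:C * z) ^+ n))).
  have dtz : is_cderive (fun t => - (t%:C * z)) t (- z).
    apply: is_cderiveN.
    apply: (is_cderive_congr (is_cderiveM (is_cderive_id t) (is_cderive_cst z t))) => //.
    by rewrite mul1r mulr0 addr0.
  apply: (is_cderive_congr (is_cderiveM (is_cderive_cexp dtz) (dS t))) => //.
  by ring.
have := @cmean_value_le f _ (expR r * r * exp_coeff r n) df.
have f0 : f 0 = 1.
  rewrite /f mul0r oppr0 cexp0 mul1r /S big_ord_recl expr0 mulr1 fact0 invr1.
  by rewrite big1 ?addr0// => i _; rewrite mul0r expr0n mulr0.
have -> : \sum_(k < n.+1) (k`!)%:R^-1 * z ^+ k - cexp z = cexp z * (f 1 - f 0).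
  rewrite f0 /f mul1r mulrBr mulr1 mulrA -cexpD subrr cexp0 mul1r.
  by congr (_ - _); apply: eq_bigr => k _; rewrite mul1r.
move=> h; rewrite normcM normc_cexp.
apply: (@le_trans _ _ (expR r * (2 * (expR r * r * exp_coeff r n)))); last first.
  rewrite le_eqVlt; apply/orP; left; apply/eqP.
  have -> : 2 * r = r + r by ring.
  by rewrite expRD; ring.
apply: ler_pM; rewrite ?expR_ge0 ?normc_ge0//.
  by rewrite ler_expR (le_trans (ler_norm _))// normc_ge_Re.
apply: h => t /andP[t0 t1].
rewrite normcN 2!normcM normc_cexp normcM normcX normcM normc_real ger0_norm// normcV normc_nat.
rewrite -/r /exp_coeff/= -mulrA mulrCA -mulrA; apply: ler_pM.
- exact: expR_ge0.
- by rewrite !mulr_ge0 ?normc_ge0 ?invr_ge0// exprn_ge0// mulr_ge0// normc_ge0.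
- rewrite ler_expR ReN ReMr (le_trans (ler_norm _))// normrN normrM ger0_norm//.
  by rewrite (le_trans _ (normc_ge_Re _))// ler_piMl.
- rewrite ler_wpM2l ?normc_ge0// mulrC ler_wpM2r ?invr_ge0//.
  rewrite lerXn2r ?nnegrE ?normc_ge0// ?mulr_ge0 ?normc_ge0//.
  by rewrite ler_piMl// normc_ge0.
Qed.

Lemma analytic_cexp (l : C) a : analytic_at (fun w => cexp (w * l)) a.
Proof.
apply: (@pseries_analytic _ _ _ (fun n => cexp (a * l) * ((n`!)%:R^-1 * l ^+ n)) 1) => // w _.
have -> : cexp (w * l) = cexp (a * l) * cexp ((w - a) * l).
  by rewrite -cexpD -mulrDl addrC subrK.
apply: (eq_cvgc _ (cvgcMl (k := cexp (a * l)) (@cvg_cexp_series ((w - a) * l)))) => n.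
rewrite !seriesC_E mulr_sumr; apply: eq_bigr => k _.
by rewrite exprMn; ring.
Qed.

End ComplexExponential.

(** * Integrals on the half-line and the Gamma function *)

Section HalfLine.
Context {R : realType}.
Local Notation C := R[i].
Local Notation mu := (@lebesgue_measure R).
Local Notation pos := (`]0%R, +oo[%classic : set R).
Implicit Types (f g G : R -> R) (h H phi : R -> C) (s u v w : C) (t c sigma K : R).

Lemma posP t : pos t <-> 0 < t.
Proof. by rewrite /= in_itv/= andbT. Qed.

Lemma measurable_pos : measurable pos. Proof. exact: measurable_itv. Qed.

(** The endpoints are exponentials, so that in boundary terms their logarithms are plainly [- n.+1]
    and [n.+1]. *)
Definition exhaust (n : nat) : set R := `[expR (- n.+1%:R), expR n.+1%:R]%classic.

Lemma exhaust_pos n : exhaust n `<=` pos.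
Proof.
by move=> t; rewrite /exhaust/= !in_itv/= andbT => /andP[+ _]; apply: lt_le_trans; exact: expR_gt0.
Qed.

Lemma exhaust_near t : 0 < t -> \forall n \near \oo, exhaust n t.
Proof.
move=> t0; exists (Num.truncn `|ln t|) => // n /= nt.
have h : `|ln t| <= n.+1%:R.
  have := truncnS_gt `|ln t|; move/ltW/le_trans; apply.
  by rewrite ler_nat.
rewrite /exhaust/= in_itv/= -{1 2}(@lnK _ t) ?posrE// !ler_expR.
by rewrite -ler_norml.
Qed.

Lemma exhaust_bigcup : \bigcup_n exhaust n = pos.
Proof.
apply/seteqP; split=> [t [n _]|t /posP t0]; first exact: exhaust_pos.
by have [N _ /(_ N (leqnn N)) ?] := exhaust_near t0; exists N.
Qed.

Lemma exhaust_homo : {homo exhaust : n m / (n <= m)%N >-> (n <= m)%O}.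
Proof.
move=> n m nm; apply/subsetPset => t; rewrite /exhaust/= !in_itv/= => /andP[a b].
rewrite (le_trans _ a) ?(le_trans b)// ler_expR ?lerN2 ler_nat//.
Qed.

Lemma is_derive_continuous f t (df : R) : is_derive t 1 f df -> {for t, continuous f}.
Proof. by move=> [d _]; apply/differentiable_continuous/derivable1_diffP. Qed.

Lemma within_continuous_exhaust n f : (forall t, 0 < t -> {for t, continuous f}) ->
  {within exhaust n, continuous f}.
Proof.
move=> cf; apply: continuous_in_subspaceT => t; rewrite inE => /exhaust_pos/posP.
exact: cf.
Qed.

Lemma FTC_exhaust n f G : (forall t, 0 < t -> is_derive t 1 G (f t)) ->
  (forall t, 0 < t -> {for t, continuous f}) ->
  (\int[mu]_(t in exhaust n) (f t)%:E = (G (expR n.+1%:R))%:E - (G (expR (- n.+1%:R)))%:E)%E.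
Proof.
move=> dG cf; apply: continuous_FTC2.
- by rewrite ltr_expR gtrN.
- exact: within_continuous_exhaust.
- have cG t : 0 < t -> {for t, continuous G} by move=> /dG/is_derive_continuous.
  split.
  + move=> t; rewrite in_itv/= => /andP[a b].
    by have [] : is_derive t 1 G (f t) by apply: dG; exact: lt_trans (expR_gt0 _) a.
  + by apply: cvg_at_right_filter; apply: cG; exact: expR_gt0.
  + by apply: cvg_at_left_filter; apply: cG; exact: expR_gt0.
- move=> t; rewrite in_itv/= => /andP[a b].
  have [_ h] : is_derive t 1 G (f t) by apply: dG; exact: lt_trans (expR_gt0 _) a.
  by rewrite derive1E h.
Qed.

Lemma continuous_pos_measurable f : (forall t, 0 < t -> {for t, continuous f}) ->
  measurable_fun pos f.
Proof.
move=> cf; apply: open_continuous_measurable_fun; first exact: interval_open.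
by move=> t; rewrite inE => /posP/cf.
Qed.

(** On each compact interval the integral of [g] is a difference of values of [G], hence at most
    [B]; monotone convergence extends the bound to the half-line. *)
Lemma integrable_dom_primitive f g G (B : R) : measurable_fun pos f ->
  (forall t, 0 < t -> 0 <= f t <= g t) ->
  (forall t, 0 < t -> is_derive t 1 G (g t)) ->
  (forall t, 0 < t -> {for t, continuous g}) ->
  (forall t, 0 < t -> 0 <= G t <= B) ->
  mu.-integrable pos (EFin \o f).
Proof.
move=> mf fg dG cg GB; have mg := continuous_pos_measurable cg.
have g0 t : pos t -> 0 <= g t by move=> /posP/fg/andP[]; exact: le_trans.
apply: (@le_integrable _ _ _ mu _ measurable_pos _ (EFin \o g)).
- exact/measurable_EFinP.
- move=> t tp; rewrite /= lee_fin (ger0_norm (g0 t tp)).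
  by have /posP/fg/andP[f0 fgt] := tp; rewrite ger0_norm.
apply/integrableP; split; first exact/measurable_EFinP.
have -> : (\int[mu]_(t in pos) `|(EFin \o g) t| = \int[mu]_(t in pos) (g t)%:E)%E.
  by apply: eq_integral => t; rewrite inE => tp; rewrite /= ger0_norm// g0.
have H := @ge0_nondecreasing_set_cvg_integral _ (measurableTypeR R) R exhaust (EFin \o g) mu exhaust_homo.
have {}H : (\int[mu]_(x in exhaust i) (g x)%:E)%E @[i --> \oo] -->
    (\int[mu]_(x in pos) (g x)%:E)%E.
  rewrite -exhaust_bigcup; apply: H.
  - by move=> i; exact: measurable_itv.
  - move=> i; apply/measurable_EFinP; apply: measurable_funS mg; first exact: measurable_pos.
    exact: exhaust_pos.
  - by move=> i x /exhaust_pos/g0; rewrite lee_fin.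
rewrite -(cvg_lim _ H)//.
apply: (@le_lt_trans _ _ B%:E); last exact: ltry.
apply: lime_le; first by apply/cvg_ex; eexists; exact: H.
apply: nearW => n; rewrite (FTC_exhaust n dG cg) -EFinB lee_fin.
have /andP[_ a] := GB _ (expR_gt0 n.+1%:R).
have /andP[b _] := GB _ (expR_gt0 (- n.+1%:R)).
by rewrite (le_trans _ a)// lerBlDr lerDl.
Qed.

(* [gker sigma c t] is [t ^ (sigma - 1) exp (- c t)] for [0 < t]. *)
Definition gker sigma c t : R := expR ((sigma - 1) * ln t - c * t).

Lemma gker_ge0 sigma c t : 0 <= gker sigma c t. Proof. exact: expR_ge0. Qed.

(** This is [ln y < y] at [y = c t / sigma]. *)
Lemma mulr_ln_le sigma c : 0 < sigma -> 0 < c ->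
  exists K, forall t, 0 < t -> sigma * ln t <= c * t + K.
Proof.
move=> s0 c0; exists (sigma * ln (sigma / c)) => t t0.
have := @ln_sublinear R (c / sigma * t).
rewrite mulr_gt0 ?divr_gt0// => /(_ isT).
rewrite lnM ?posrE ?divr_gt0// -[c / sigma]invf_div lnV ?posrE ?divr_gt0// => /ltW h.
rewrite -lerBlDr -mulrBr.
have -> : c * t = sigma * ((sigma / c)^-1 * t) by rewrite invf_div mulrA mulrCA divff ?gt_eqF// mulr1.
by rewrite ler_pM2l// addrC.
Qed.

Lemma measurable_gker sigma c : measurable_fun pos (gker sigma c).
Proof.
rewrite /gker; apply: measurableT_comp; first exact: measurable_expR.
apply: measurable_funB.
- apply: measurable_funM; first exact: measurable_cst.
  by apply: measurable_funS (@measurable_ln R).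
- by apply: measurable_funM; [exact: measurable_cst|exact: measurable_id].
Qed.

(** With [P = t^sigma], the majorant is the derivative of [A P / (1 + P)], a function bounded by
    [A]. It dominates the kernel as soon as [e^(-c t) (1 + P)^2 <= A sigma]. *)
Lemma integrable_gker sigma c : 0 < sigma -> 0 < c ->
  mu.-integrable pos (EFin \o gker sigma c).
Proof.
move=> s0 c0.
(* Exponent [2 * sigma], because [e^(-c t)] has to absorb the square of [P]. *)
have [K HK] := @mulr_ln_le (2 * sigma) c (mulr_gt0 (ltr0Sn R 1) s0) c0.
pose P t := expR (sigma * ln t).
have dP t : 0 < t -> is_derive t 1 P (sigma / t * P t).
  move=> t0.
  have h1 : is_derive t 1 (fun t => sigma * ln t) (sigma / t).
    apply: (is_derive_congr (is_deriveZ sigma (is_derive1_ln t0))) => //.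
  apply: (is_derive_congr (@is_derive1_comp _ expR (fun t => sigma * ln t) t _ _ (is_derive_expR _) h1)) => //.
  by rewrite mulrC.
have P0 t : 0 < P t by exact: expR_gt0.
pose A := 2 / sigma * (1 + expR K).
have A0 : 0 <= A by rewrite mulr_ge0 ?divr_ge0 ?(ltW s0)// addr_ge0 ?expR_ge0.
pose g t := A * (sigma / t * P t * ((1 + P t) ^+ 2)^-1).
pose G t := A * (P t / (1 + P t)).
have P1 t : 1 + P t != 0 by rewrite gt_eqF// addr_gt0.
have dG t : 0 < t -> is_derive t 1 G (g t).
  move=> t0.
  have h1 : is_derive t 1 (fun t => 1 + P t) (sigma / t * P t).
    have c1 : is_derive t 1 (cst 1 : R -> R) 0 by exact: is_derive_cst.
    by apply: (is_derive_congr (is_deriveD c1 (dP t t0))) => [x|]; rewrite /= ?add0r.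
  have h2 := is_deriveZ A (is_deriveM (dP t t0) (@is_deriveV R (fun t => 1 + P t) t _ 1 (P1 t) h1)).
  apply: (is_derive_congr h2); first by [].
  rewrite /g /GRing.scale/=.
  have := P1 t; move: (P t) (sigma / t) => p q p1.
  by field.
have cg t : 0 < t -> {for t, continuous g}.
  move=> t0; have cP : {for t, continuous P} := is_derive_continuous (dP t t0).
  apply: cvgMr; apply: cvgM.
    apply: cvgM; last exact: cP.
    by apply: cvgMr; apply: cvgV; [rewrite gt_eqF|exact: cvg_id].
  apply: cvgV; first by rewrite expf_neq0.
  have c1 : {for t, continuous (fun x => 1 + P x)}.
    by apply: cvgD; [exact: cvg_cst|exact: cP].
  by under eq_fun do rewrite expr2; rewrite expr2; apply: cvgM; exact: c1.
apply: (@integrable_dom_primitive _ g G A) => //; first exact: measurable_gker.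
- move=> t t0; rewrite gker_ge0/= /g /gker mulrBl mul1r.
  have -> : sigma * ln t - ln t - c * t = sigma * ln t + (- ln t) + (- (c * t)) by ring.
  rewrite !expRD expRN lnK ?posrE// -/(P t).
  rewrite [leRHS](_ : _ = P t * t^-1 * (A * sigma / (1 + P t) ^+ 2)); last first.
    by ring.
  rewrite ler_wpM2l ?mulr_ge0 ?invr_ge0 ?(ltW t0) ?(ltW (P0 t))//.
  rewrite ler_pdivlMr ?exprn_gt0 ?addr_gt0//.
  have -> : A * sigma = 2 * (1 + expR K) by rewrite /A; field; rewrite gt_eqF.
  apply: (@le_trans _ _ (expR (- (c * t)) * (2 * (1 + P t ^+ 2)))).
    rewrite ler_wpM2l ?expR_ge0//.
    have : 0 <= (1 - P t) ^+ 2 by exact: sqr_ge0.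
    by rewrite -subr_ge0 => h; rewrite -subr_ge0; move: h; congr (_ <= _); ring.
  rewrite mulrCA ler_pM2l// mulrDr mulr1 lerD//.
    by rewrite -expR0 ler_expR oppr_le0 mulr_ge0// ltW.
  rewrite /P -expRM_natl -expRD ler_expR.
  have := HK t t0; rewrite mulrA; lra.
- move=> t t0; rewrite /G; apply/andP; split.
    by rewrite mulr_ge0// divr_ge0 ?addr_ge0// ltW.
  rewrite ler_piMr// ler_pdivrMr ?addr_gt0// mul1r lerDr//.
Qed.

End HalfLine.

(** * The complex kernel and integration by parts on the half-line *)

Section HalfLineComplex.
Context {R : realType}.
Local Notation C := R[i].
Local Notation mu := (@lebesgue_measure R).
Local Notation pos := (`]0%R, +oo[%classic : set (measurableTypeR R)).
Let mp : measurable pos := measurable_itv _.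
Implicit Types (h H phi : R -> C) (s u v w : C) (t c sigma K : R).

Lemma derivable_cmeasurable h (dh : R -> C) :
  (forall t, 0 < t -> is_cderive h t (dh t)) -> cmeasurable pos h.
Proof.
by move=> hd; split; apply: continuous_pos_measurable => t /hd/is_cderive_continuous[].
Qed.

Lemma cFTC_pos H h (dh : R -> C) (l0 l1 : C) :
  (forall t, 0 < t -> is_cderive H t (h t)) ->
  (forall t, 0 < t -> is_cderive h t (dh t)) ->
  cintegrable mu pos h ->
  H (expR (- n.+1%:R)) @[n --> \oo] --> l0 ->
  H (expR n.+1%:R) @[n --> \oo] --> l1 ->
  cintegral mu pos h = l1 - l0.
Proof.
move=> dH hd hi H0 H1.
pose h_ n (t : measurableTypeR R) := (\1_(@exhaust R n) t)%:C * h t.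
have [|||_ cv] := @cvg_cintegral R _ _ mu pos mp h_ h
   (fun t => normc (h t)) _ _ _ (cintegrable_normc mp hi).
- move=> n; apply: cmeasurableM; last exact: derivable_cmeasurable hd.
  by apply: cmeasurable_real; apply: measurable_indic; exact: measurable_itv.
- move=> t /posP/(@exhaust_near R)[N _ NP]; apply: (@cvgc_near_cst _ _ _ N) => n /NP nt.
  by rewrite /h_ indicE mem_set// mul1r.
- move=> n t tp; rewrite /h_ normcM normc_real ler_piMl ?normc_ge0//.
  by rewrite indicE; case: (_ \in _); rewrite ?normr1 ?normr0.
apply: (cvgc_unique cv).
apply: (eq_cvgc _ (cvgcB H1 H0)) => n.
have E (f F : R -> R) : (forall t, 0 < t -> is_derive t 1 F (f t)) ->
    (forall t, 0 < t -> {for t, continuous f}) ->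
    \int[mu]_(t in pos) (\1_(@exhaust R n) t * f t) = F (expR n.+1%:R) - F (expR (- n.+1%:R)).
  move=> dF cf; transitivity (\int[mu]_(t in @exhaust R n) f t).
    transitivity (\int[mu]_(t in pos) (f \_ (@exhaust R n)) t).
      by apply: eq_Rintegral => t _; rewrite patch_indic mulrC.
    rewrite -Rintegral_mkcondl; congr (Rintegral _ _ _).
    by apply: setIidl; exact: exhaust_pos.
  by rewrite /Rintegral (FTC_exhaust n dF cf).
apply: complex_ext; rewrite ?ReB ?ImB/=.
- transitivity (\int[mu]_(t in pos) (\1_(@exhaust R n) t * Re (h t))); last first.
    by apply: eq_Rintegral => t _; rewrite /h_ ReMr.
  symmetry; apply: (E (fun t => Re (h t)) (fun t => Re (H t))).
  + by move=> t /dH[].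
  + by move=> t /hd/is_cderive_continuous[].
- transitivity (\int[mu]_(t in pos) (\1_(@exhaust R n) t * Im (h t))); last first.
    by apply: eq_Rintegral => t _; rewrite /h_ ImMr.
  symmetry; apply: (E (fun t => Im (h t)) (fun t => Im (H t))).
  + by move=> t /dH[].
  + by move=> t /hd/is_cderive_continuous[].
Qed.

Lemma cvg_expRn (a : R) : 0 < a -> expR (- (a * n.+1%:R)) @[n --> \oo] --> (0 : R).
Proof.
move=> a0.
have -> : (fun n => expR (- (a * n.+1%:R))) = (fun n => expR (- a) ^+ n.+1).
  by apply/funext => n; rewrite -mulNr expRM_natr.
rewrite (@cvg_shiftS _ (fun n => expR (- a) ^+ n)); apply: cvg_expr.
by rewrite ger0_norm ?expR_ge0// expR_lt1 oppr_lt0.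
Qed.

(** Both boundary values vanish: [t^sigma] is small at 0 and [e^(-c t)] wins at infinity. *)
Lemma cFTC_pos0 H h (dh : R -> C) sigma c K :
  0 < sigma -> 0 < c ->
  (forall t, 0 < t -> is_cderive H t (h t)) ->
  (forall t, 0 < t -> is_cderive h t (dh t)) ->
  cintegrable mu pos h ->
  (forall t, 0 < t -> normc (H t) <= K * expR (sigma * ln t - c * t)) ->
  cintegral mu pos h = 0.
Proof.
move=> s0 c0 dH hd hi HK.
have K0 : 0 <= K.
  have := le_trans (normc_ge0 _) (HK 1 ltr01).
  by rewrite pmulr_lge0 ?expR_gt0.
rewrite (@cFTC_pos H h dh 0 0) ?subrr//.
- apply: (@squeeze_cvgc _ _ _ _ _ _ (fun n => K * expR (- (sigma * n.+1%:R)))).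
    apply: nearW => n; rewrite subr0 (le_trans (HK _ (expR_gt0 _)))//.
    rewrite ler_wpM2l// ler_expR expRK mulrN lerBlDr lerDl.
    by rewrite mulr_ge0 ?expR_ge0// ltW.
  by rewrite -[X in _ --> X](mulr0 K); apply: cvgMr; exact: cvg_expRn.
(* One power of [t] more than needed is absorbed by [e^(c t)], which leaves a decay like [1 / t]. *)
- have [K' HK'] := @mulr_ln_le R (sigma + 1) c (addr_gt0 s0 ltr01) c0.
  apply: (@squeeze_cvgc _ _ _ _ _ _ (fun n => K * expR K' * expR (- (1 * n.+1%:R)))).
    apply: nearW => n; rewrite subr0 (le_trans (HK _ (expR_gt0 _)))//.
    rewrite -mulrA ler_wpM2l// -expRD ler_expR expRK.
    have := HK' _ (expR_gt0 n.+1%:R); rewrite expRK; lra.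
  by rewrite -[X in _ --> X](mulr0 (K * expR K')); apply: cvgMr; exact: cvg_expRn.
Qed.

(* [ker s u t] is [t ^ (s - 1) exp (- u t)] for [0 < t]. *)
Definition ker s u t : C := cexp ((s - 1) * (ln t)%:C - u * t%:C).

Lemma normc_ker s u t : normc (ker s u t) = gker (Re s) (Re u) t.
Proof.
rewrite normc_cexp /gker ReB mulrC ReMr [u * _]mulrC ReMr ReB/=.
by rewrite [ln t * _]mulrC [t * _]mulrC.
Qed.

Lemma is_cderive_ker s u t : 0 < t ->
  is_cderive (ker s u) t (((s - 1) * (t^-1)%:C - u) * ker s u t).
Proof.
move=> t0; apply: is_cderive_cexp; apply: is_cderiveB.
  by apply: is_cderiveMl; exact: is_cderive_ln.
by rewrite -[X in is_cderive _ _ X]mulr1; apply: is_cderiveMl; exact: is_cderive_id.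
Qed.

Lemma kerS s u t : 0 < t -> ker (s + 1) u t = t%:C * ker s u t.
Proof.
move=> t0; have E : t%:C = cexp (ln t)%:C by rewrite cexp_real lnK ?posrE.
by rewrite /ker [X in _ = X * _]E -cexpD; congr cexp; ring.
Qed.

Lemma cmeasurable_ker s u : cmeasurable pos (ker s u).
Proof. by apply: derivable_cmeasurable => t; exact: is_cderive_ker. Qed.

Lemma cintegrable_ker s u : 0 < Re s -> 0 < Re u -> cintegrable mu pos (ker s u).
Proof.
move=> s0 u0; apply: (cintegrable_dom mp _ _ (integrable_gker s0 u0)).
  exact: cmeasurable_ker.
by move=> t _; rewrite normc_ker.
Qed.

Lemma gamma_integral_ker s : gamma_integral s = cintegral mu pos (ker s 1).
Proof.
apply: eq_cintegral => t /posP t0.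
by rewrite cpow_real// -cexp_real -cexpD /ker mul1r; congr (cexp (_ + _)); exact: rcN.
Qed.

(** Integration by parts: the difference of the two integrands is the derivative of
    [ker (s + 1) u]. *)
Lemma ker_integral_rec s u : 0 < Re s -> 0 < Re u ->
  s * cintegral mu pos (ker s u) = u * cintegral mu pos (ker (s + 1) u).
Proof.
move=> s0 u0.
have s10 : 0 < Re (s + 1) by rewrite ReD/= addr_gt0.
have i1 := cintegrable_ker s0 u0; have i2 := cintegrable_ker s10 u0.
apply/eqP; rewrite -subr_eq0 -!cintegralZl// -cintegralB//; last 2 first.
- exact: cintegrableZl.
- exact: cintegrableZl.
apply/eqP.
apply: (@cFTC_pos0 (ker (s + 1) u) _
  (fun t => s * (((s - 1) * (t^-1)%:C - u) * ker s u t) -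
            u * (((s + 1 - 1) * (t^-1)%:C - u) * ker (s + 1) u t)) (Re s) (Re u) 1) => //.
- move=> t t0; apply: (is_cderive_congr (is_cderive_ker (s + 1) u t0)) => //.
  rewrite mulrBl; congr (_ - _).
  rewrite addrK kerS// -mulrA; congr (_ * _).
  by rewrite mulrA -rcM mulVf ?gt_eqF// mul1r.
- move=> t t0; apply: is_cderiveB; apply: is_cderiveMl; exact: is_cderive_ker.
- by apply: cintegrableB => //; exact: cintegrableZl.
- by move=> t t0; rewrite mul1r normc_ker /gker ReD/= addrK.
Qed.

(** The mean value inequality along the segment from [b] to [a], on which the real part stays at
    most [m]. *)
Lemma cexpB_le (a b : C) (m : R) : Re a <= m -> Re b <= m ->
  normc (cexp a - cexp b) <= 2 * (normc (a - b) * expR m).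
Proof.
move=> am bm.
pose f (t : R) := cexp (b + t%:C * (a - b)).
have df t : is_cderive f t ((a - b) * f t).
  apply: is_cderive_cexp.
  apply: (is_cderive_congr (is_cderiveD (is_cderive_cst b t)
    (is_cderiveM (is_cderive_id t) (is_cderive_cst (a - b) t)))) => //.
  by rewrite add0r mul1r mulr0 addr0.
have -> : cexp a - cexp b = f 1 - f 0.
  by rewrite /f mul0r addr0 mul1r [b + _]addrC subrK.
apply: (cmean_value_le df) => t /andP[t0 t1].
rewrite normcM normc_cexp ler_wpM2l ?normc_ge0// ler_expR ReD ReMr ReB.
have : (1 - t) * Re b + t * Re a <= (1 - t) * m + t * m.
  by rewrite lerD// ler_wpM2l// subr_ge0.
lra.
Qed.

End HalfLineComplex.

(** * Euler's integral with a complex parameter *)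

Section GammaFunction.
Context {R : realType}.
Local Notation C := R[i].
Local Notation mu := (@lebesgue_measure R).
Local Notation pos := (`]0%R, +oo[%classic : set (measurableTypeR R)).
Let mp : measurable pos := measurable_itv _.
Implicit Types (s u v w : C) (t c sigma K : R).

Lemma cderive_under_integral (f df : R -> measurableTypeR R -> C) (M : R -> R) (x0 a b : R) :
  a < x0 < b ->
  (forall x, a < x < b -> cintegrable mu pos (f x)) ->
  (forall x t, a < x < b -> 0 < t -> is_cderive (f ^~ t) x (df x t)) ->
  (forall x t, a < x < b -> 0 < t -> normc (df x t) <= M t) ->
  (forall t, 0 <= M t) ->
  mu.-integrable pos (EFin \o M) ->
  is_cderive (fun x => cintegral mu pos (f x)) x0 (cintegral mu pos (df x0)).
Proof.
move=> x0ab fi fd dfM M0 iM.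
have x0i : (`]a, b[ : set R)%classic x0 by rewrite /= in_itv.
have H (g dg : R -> measurableTypeR R -> R) :
    (forall x, a < x < b -> mu.-integrable pos (EFin \o g x)) ->
    (forall x t, a < x < b -> 0 < t -> is_derive x 1 (g ^~ t) (dg x t)) ->
    (forall x t, a < x < b -> 0 < t -> `|dg x t| <= M t) ->
    is_derive x0 1 (fun x => \int[mu]_(t in pos) g x t) (\int[mu]_(t in pos) dg x0 t).
  move=> gi gd dgM.
  have P x t : a < x < b -> 0 < t -> partial1of2 g x t = dg x t.
    by move=> xab t0; rewrite partial1of2E; have [] := gd x t xab t0.
  have h1 x : (`]a, b[ : set R)%classic x -> mu.-integrable pos (EFin \o g x).
    by rewrite /= in_itv/=; exact: gi.
  have h2 x t : (`]a, b[ : set R)%classic x -> pos t -> derivable (g ^~ t) x 1.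
    by rewrite [in X in X -> _]/= in_itv/= => xab /posP t0; have [] := gd x t xab t0.
  have h3 x t : (`]a, b[ : set R)%classic x -> pos t -> `|partial1of2 g x t| <= M t.
    by rewrite [in X in X -> _]/= in_itv/= => xab /posP t0; rewrite P//; exact: dgM.
  split.
    exact: (derivable_under_integral mp x0i h1 h2 M0 iM h3).
  rewrite -derive1E (differentiation_under_integral mp x0i h1 h2 M0 iM h3).
  by apply: eq_Rintegral => t; rewrite inE => /posP t0; rewrite P.
split.
- apply: (H (fun x t => Re (f x t)) (fun x t => Re (df x t))).
  + by move=> x /fi[].
  + by move=> x t xab t0; have [] := fd x t xab t0.
  + by move=> x t xab t0; rewrite (le_trans (normc_ge_Re _))// dfM.
- apply: (H (fun x t => Im (f x t)) (fun x t => Im (df x t))).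
  + by move=> x /fi[].
  + by move=> x t xab t0; have [] := fd x t xab t0.
  + by move=> x t xab t0; rewrite (le_trans (normc_ge_Im _))// dfM.
Qed.

Lemma carg_lt_pihalf u : 0 < Re u -> `|carg u| < pi / 2.
Proof.
move=> u0.
have n0 : 0 < normc u by rewrite (lt_le_trans u0)// (le_trans (ler_norm _))// normc_ge_Re.
have x1 : -1 <= Re u / normc u <= 1.
  rewrite -ler_norml normrM normfV [X in _ / X]ger0_norm ?normc_ge0//.
  by rewrite ler_pdivrMr// mul1r normc_ge_Re.
have -> : `|carg u| = acos (Re u / normc u).
  by rewrite /carg; case: ifP => _; rewrite ?normrN ger0_norm// acos_ge0.
rewrite ltNge; apply/negP; rewrite le_eqVlt => /orP[/eqP h|].
  have := acosK x1; rewrite -h cos_pihalf => /esym/eqP.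
  by rewrite mulf_eq0 invr_eq0 !gt_eqF.
rewrite -ltr_cos ?in_itv/= ?acos_ge0 ?acos_lepi//; last first.
  by rewrite divr_ge0 ?pi_ge0//= ler_pdivrMr// ler_peMr ?pi_ge0// ler1n.
by rewrite acosK ?in_itv//= cos_pihalf ltNge divr_ge0// ltW.
Qed.

Lemma gkerS sigma c t : 0 < t -> gker (sigma + 1) c t = t * gker sigma c t.
Proof.
by move=> t0; rewrite /gker -[X in _ = X * _](@lnK R) ?posrE// -expRD; congr expR; ring.
Qed.

Lemma is_cderive_eq0 (f : R -> C) (a b : R) : a < b ->
  (forall x, a <= x <= b -> is_cderive f x 0) -> f b = f a.
Proof.
move=> ab fd.
have H (g : R -> R) : (forall x, a <= x <= b -> is_derive x 1 g 0) -> g b = g a.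
  move=> gd; have cg : {within `[a, b], continuous g}.
    by apply: derivable_within_continuous => x; rewrite in_itv/= => /gd[].
  have gd' x : x \in `]a, b[ -> is_derive x 1 g 0.
    by rewrite in_itv/= => /andP[/ltW x1 /ltW x2]; apply: gd; rewrite x1.
  have [c _ /eqP] := MVT ab gd' cg.
  by rewrite mul0r subr_eq0 => /eqP.
by apply: complex_ext; [apply: (H (fun x => Re (f x)))|apply: (H (fun x => Im (f x)))] => x /fd[].
Qed.

(* Along the path [t |-> u ^ t] from 1 to [u], the integral times [(u ^ t) ^ s]
   has derivative 0. *)
Lemma ker_integral_scale s u : 0 < Re s -> 0 < Re u ->
  cintegral mu pos (ker s u) = gamma_integral s * cpow u (- s).
Proof.
move=> s0 u0.
have un0 : u != 0 by rewrite -normc_gt0 (lt_le_trans u0)// (le_trans (ler_norm _))// normc_ge_Re.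
have [th_lt th0] := (carg_lt_pihalf u0, normr_ge0 (carg u)).
set th := `|carg u| in th_lt th0.
pose w := clog u; pose x (t : R) := cexp (t%:C * w).
have x1 : x 1 = u by rewrite /x mul1r cexp_clog.
have x0 : x 0 = 1 by rewrite /x mul0r cexp0.
have pi0 : 0 < pi :> R by exact: pi_gt0.
(* The path is prolonged to []-eta, 1 + eta[] so that it can be differentiated at both ends. This
   [eta] keeps the argument of [x t] at most [th' < pi / 2], so [Re (x t)] stays above a positive
   constant. *)
pose eta := (pi / 2 - th) / pi.
have eta0 : 0 < eta by rewrite divr_gt0// subr_gt0.
have eta1 : eta <= 1 by rewrite ler_pdivrMr// mul1r; lra.
pose th' := (th + pi / 2) / 2.
have th'0 : 0 <= th' by rewrite divr_ge0// addr_ge0// divr_ge0// ltW.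
have th'1 : th' < pi / 2 by rewrite /th'; lra.
have etath : (1 + eta) * th <= th'.
  have : eta * th <= eta * (pi / 2) by rewrite ler_wpM2l// ltW.
  have -> : eta * (pi / 2) = (pi / 2 - th) / 2 by rewrite mulrA /eta divfK// gt_eqF.
  by rewrite /th'; lra.
pose k := cos th'; have k0 : 0 < k by rewrite cos_gt0_pihalf// th'1 andbT; lra.
pose L := `|ln (normc u)|.
pose c := expR (- (2 * L)) * k; have c0 : 0 < c by rewrite mulr_gt0 ?expR_gt0.
have abst t : - eta < t < 1 + eta -> `|t| <= 1 + eta.
  by move=> /andP[t0 t1]; rewrite ler_norml; apply/andP; split; lra.
have lnt t : - eta < t < 1 + eta -> `|t * ln (normc u)| <= 2 * L.
  move=> /abst t1; rewrite normrM ler_wpM2r//; lra.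
have Rex t : - eta < t < 1 + eta -> c <= Re (x t).
  move=> ht; rewrite Re_cexp ReMr ImMr/=.
  apply: ler_pM; rewrite ?expR_ge0 ?(ltW k0)//.
    by rewrite ler_expR; move: (lnt t ht); rewrite ler_norml => /andP[].
  have cosabs (y : R) : cos `|y| = cos y by case: (ger0P y) => // _; rewrite cosN.
  rewrite -[leRHS]cosabs /k.
  have h : `|t * carg u| <= th'.
    by rewrite normrM (le_trans _ etath)// ler_wpM2r// abst.
  by rewrite leNgt ltr_cos -?leNgt// in_itv/= ?normr_ge0 ?th'0/=; lra.
have nx t : - eta < t < 1 + eta -> normc (x t) <= expR (2 * L).
  move=> ht; rewrite normc_cexp ReMr/= ler_expR.
  exact: le_trans (ler_norm _) (lnt t ht).
pose P (t : R) := cexp (t%:C * (s * w)).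
have nP t : - eta < t < 1 + eta -> normc (P t) <= expR (2 * normc (s * w)).
  move=> /abst t1; rewrite normc_cexp ReMr ler_expR (le_trans (ler_norm _))// normrM.
  by rewrite ler_pM// ?normc_ge_Re//; lra.
have Rex0 t : - eta < t < 1 + eta -> 0 < Re (x t) by move=> /Rex; exact: lt_le_trans.
pose f t (y : measurableTypeR R) := P t * ker s (x t) y.
pose df t (y : measurableTypeR R) := P t * (w * ((s - x t * y%:C) * ker s (x t) y)).
have dmul (z : C) t : is_cderive (fun t => t%:C * z) t z.
  apply: (is_cderive_congr (is_cderiveM (is_cderive_id t) (is_cderive_cst z t))) => //.
  by rewrite mul1r mulr0 addr0.
have dP t : is_cderive P t (s * w * P t) by apply: is_cderive_cexp; exact: dmul.
have dx t : is_cderive x t (w * x t) by apply: is_cderive_cexp; exact: dmul.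
have s10 : 0 < Re (s + 1) by rewrite ReD/= addr_gt0.
pose E := expR (2 * normc (s * w)).
pose M (y : R) := E * (normc w * normc s) * gker (Re s) c y +
  E * (normc w * expR (2 * L)) * gker (Re s + 1) c y.
have gker_le a b y : 0 < y -> c <= b -> gker a b y <= gker a c y.
  by move=> y0 cb; rewrite ler_expR lerD2l lerN2 ler_wpM2r// ltW.
have E0 : 0 <= E by exact: expR_ge0.
have M1 : 0 <= E * (normc w * normc s) by rewrite !mulr_ge0 ?normc_ge0.
have M2 : 0 <= E * (normc w * expR (2 * L)) by rewrite !mulr_ge0 ?normc_ge0 ?expR_ge0.
have dfM t y : - eta < t < 1 + eta -> 0 < y -> normc (df t y) <= M y.
  move=> ht y0; rewrite /df 3!normcM normc_ker /M gkerS//.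
  have hx : normc (s - x t * y%:C) <= normc s + expR (2 * L) * y.
    rewrite (le_trans (le_normcB _ _))// lerD2l normcM normc_real gtr0_norm//.
    by rewrite ler_wpM2r ?(ltW y0)// nx.
  have gl := gker_le (Re s) _ y y0 (Rex t ht).
  rewrite [leRHS](_ : _ = E * (normc w * ((normc s + expR (2 * L) * y) * gker (Re s) c y))); last by ring.
  apply: ler_pM; rewrite ?normc_ge0 ?mulr_ge0 ?normc_ge0 ?gker_ge0 ?nP//.
  rewrite ler_wpM2l ?normc_ge0//.
  by apply: ler_pM; rewrite ?normc_ge0 ?gker_ge0.
have iM : mu.-integrable pos (EFin \o M).
  have h a : 0 < a -> mu.-integrable pos (EFin \o gker a c) by move=> a0; exact: integrable_gker.
  have -> : EFin \o M = (fun y => (E * (normc w * normc s))%:E * (gker (Re s) c y)%:E +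
      (E * (normc w * expR (2 * L)))%:E * (gker (Re s + 1) c y)%:E)%E by [].
  apply: integrableD => //; apply: integrableZl => //; apply: h => //.
  by rewrite addr_gt0.
(* In the variable [y], [df t] is the derivative of [P t * (w * ker (s + 1) (x t) y)], whose
   boundary values vanish. *)
have idf t : - eta < t < 1 + eta -> cintegral mu pos (df t) = 0.
  move=> ht.
  pose dh y := P t * (w * (- x t * ker s (x t) y + (s - x t * y%:C) *
    (((s - 1) * (y^-1)%:C - x t) * ker s (x t) y))).
  have ddf y : 0 < y -> is_cderive (df t) y (dh y).
    move=> y0; do 2 apply: is_cderiveMl; apply: is_cderiveM; last exact: is_cderive_ker.
    rewrite -sub0r; apply: is_cderiveB; first exact: is_cderive_cst.
    by rewrite -[X in is_cderive _ _ X]mulr1; apply: is_cderiveMl; exact: is_cderive_id.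
  apply: (@cFTC_pos0 R (fun y => P t * (w * ker (s + 1) (x t) y)) (df t) dh (Re s) c
    (normc (P t) * normc w) s0 c0 _ ddf).
  - move=> y y0; do 2 apply: is_cderiveMl.
    apply: (is_cderive_congr (is_cderive_ker (s + 1) (x t) y0)) => //.
    rewrite addrK kerS// mulrA mulrBl; congr (_ * _).
    by rewrite -mulrA -rcM mulVf ?gt_eqF// mulr1.
  - apply: (cintegrable_dom mp _ _ iM); first exact: derivable_cmeasurable ddf.
    by move=> y /posP y0; exact: dfM.
  - move=> y y0; rewrite 2!normcM mulrA ler_wpM2l ?mulr_ge0 ?normc_ge0//.
    rewrite normc_ker ReD/= (le_trans (gker_le _ _ _ y0 (Rex t ht)))//.
    by rewrite /gker addrK.
have dG t : - eta < t < 1 + eta ->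
    is_cderive (fun t => cintegral mu pos (f t)) t 0.
  move=> ht; rewrite -(idf t ht).
  apply: (@cderive_under_integral f df M t (- eta) (1 + eta) ht _ _ dfM _ iM).
  - by move=> a /Rex0 ha; apply: cintegrableZl; [exact: mp|exact: cintegrable_ker].
  - move=> a y ha y0.
    have hk : is_cderive (fun a => ker s (x a) y) a (- (w * x a * y%:C) * ker s (x a) y).
      apply: is_cderive_cexp; rewrite -[X in is_cderive _ _ X]sub0r.
      apply: is_cderiveB; first exact: is_cderive_cst.
      apply: (is_cderive_congr (is_cderiveM (dx a) (is_cderive_cst (y%:C) a))) => //.
      by rewrite mulr0 addr0.
    apply: (is_cderive_congr (is_cderiveM (dP a) hk)) => //.
    by rewrite /df; ring.
  - by move=> y; rewrite addr_ge0// mulr_ge0// gker_ge0.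
have : cintegral mu pos (f 1) = cintegral mu pos (f 0).
  apply: (@is_cderive_eq0 (fun t => cintegral mu pos (f t)) 0 1 ltr01) => t /andP[t0 t1].
  by apply: dG; apply/andP; split; lra.
have Re1 : 0 < Re (1 : C) by [].
rewrite /f x1 x0 !(cintegralZl mp _ (cintegrable_ker _ _))//.
have -> : P 0 = 1 by rewrite /P mul0r cexp0.
have -> : P 1 = cpow u s by rewrite /P mul1r.
rewrite mul1r gamma_integral_ker cpowN => <-.
by rewrite mulrAC divff ?mul1r// cpow_neq0.
Qed.

End GammaFunction.

(** * Zeros of Gamma and the difference kernel *)

Section GammaProperties.
Context {R : realType}.
Local Notation C := R[i].
Local Notation mu := (@lebesgue_measure R).
Local Notation pos := (`]0%R, +oo[%classic : set (measurableTypeR R)).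
Let mp : measurable pos := measurable_itv _.
Implicit Types (s u v w : C) (t c sigma tau k K : R).

Lemma integrable_mulrl (f : R -> R) k :
  mu.-integrable pos (EFin \o f) -> mu.-integrable pos (EFin \o (fun t => k * f t)).
Proof. by move=> fi; exact: (integrableZl mp k fi). Qed.

Lemma integrable_subr (f h : R -> R) : mu.-integrable pos (EFin \o f) ->
  mu.-integrable pos (EFin \o h) -> mu.-integrable pos (EFin \o (fun t => f t - h t)).
Proof. by move=> fi hi; exact: (integrableB mp fi hi). Qed.

Lemma Re_cintegral (h : measurableTypeR R -> C) :
  Re (cintegral mu pos h) = \int[mu]_(t in pos) Re (h t).
Proof. by []. Qed.

Lemma Im_cintegral (h : measurableTypeR R -> C) :
  Im (cintegral mu pos h) = \int[mu]_(t in pos) Im (h t).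
Proof. by []. Qed.

Lemma gamma_integral_rec s : 0 < Re s -> gamma_integral (s + 1) = s * gamma_integral s.
Proof.
by move=> s0; rewrite !gamma_integral_ker ker_integral_rec// mul1r.
Qed.

Lemma Gamma_pos s : 0 < Re s -> Gamma s = gamma_integral s.
Proof. by move=> s0; rewrite /Gamma /gamma_shift s0 addr0 big_ord0 divr1. Qed.

(** For [-1 < Re s <= 0] the shift in the definition of [Gamma] is exactly 1; for [0 < Re s] this is
    the functional equation. *)
Lemma Gamma_gtN1 s : -1 < Re s -> s != 0 -> s * Gamma s = gamma_integral (s + 1).
Proof.
move=> s1 sn0; have [s0|s0] := ltP 0 (Re s).
  by rewrite Gamma_pos// gamma_integral_rec.
have shift1 : gamma_shift s = 1%N.
  rewrite /gamma_shift ltNge s0/=.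
  suff -> : Num.floor (- Re s) = 0 by [].
  apply: floor_def; rewrite /= oppr_ge0 s0/= add0r; lra.
by rewrite /Gamma shift1 big_ord1 addr0 mulrCA mulfV// mulr1.
Qed.

Lemma ker_real k t : ker k%:C 1 t = (gker k 1 t)%:C.
Proof. by rewrite /ker /gker -cexp_real; congr cexp; rewrite !(rcB, rcM). Qed.

Let g k := \int[mu]_(t in pos) gker k 1 t.

Let gammaE k : gamma_integral k%:C = (g k)%:C.
Proof.
rewrite gamma_integral_ker; apply: complex_ext.
  by rewrite Re_cintegral; apply: eq_Rintegral => t _; rewrite ker_real.
rewrite Im_cintegral; under eq_Rintegral do rewrite ker_real.
by rewrite /Rintegral integral0.
Qed.

Let g_rec k : 0 < k -> g (k + 1) = k * g k.
Proof.
move=> k0; have := @gamma_integral_rec k%:C k0.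
have -> : k%:C + 1 = (k + 1)%:C :> C by rewrite rcD.
by rewrite !gammaE -rcM => -[].
Qed.

(** The integrand is nonnegative, and on [1, 2] it is at least [expR (- 2)] because [1 <= k]. *)
Let g_gt0 k : 1 <= k -> 0 < g k.
Proof.
move=> k1; have k0 : 0 < k by exact: lt_le_trans k1.
pose A : set (measurableTypeR R) := `[1, 2]%classic.
have mA : measurable A by exact: measurable_itv.
have muA : mu A = 1%:E.
  rewrite /A lebesgue_measure_itv/= lte_fin ltr1n/= -EFinB; congr EFin; ring.
have Apos : A `<=` pos.
  by move=> t; rewrite /A/= !in_itv/= andbT => /andP[+ _]; apply: lt_le_trans.
apply: (@lt_le_trans _ _ (expR (- 2))); first exact: expR_gt0.
have iA : mu.-integrable pos (EFin \o (\1_A : _ -> R)).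
  apply: (@integrableS _ _ _ mu [set: measurableTypeR R] pos) => //.
  exact: (integrable_indic_itv 1 2 true false).
have -> : expR (- 2) = \int[mu]_(t in pos) (expR (- 2) * \1_A t).
  rewrite RintegralZl// /Rintegral integral_indic//.
  by rewrite setIidl// [X in fine X]muA mulr1.
apply: le_Rintegral => //.
- exact: integrable_mulrl.
- exact: integrable_gker.
- move=> t _; rewrite indicE; have [|_] := boolP (t \in A); last first.
    by rewrite mulr0 gker_ge0.
  rewrite inE /A/= in_itv/= => /andP[t1 t2].
  rewrite mulr1 /gker ler_expR mul1r -[leLHS]add0r lerD ?lerN2//.
  by rewrite mulr_ge0 ?subr_ge0// ln_ge0.
Qed.

(** With [a = ln x / 2], the right-hand side is 4 times the square of [e^a - e^-a], which exceeds
    [a] in absolute value. Such a bound by powers of [x] can be integrated against the kernel by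
    means of the recurrence of Gamma. *)
Lemma ln_sqr_le (x : R) : 0 < x -> ln x ^+ 2 <= 4 * (x - 2 + x^-1).
Proof.
move=> x0.
have H (a : R) : 0 <= a -> a <= expR a - expR (- a).
  move=> a0; have a1 := expR_ge1Dx a.
  have : expR (- a) <= 1 by rewrite -expR0 ler_expR oppr_le0.
  lra.
have H2 (a : R) : a ^+ 2 <= (expR a - expR (- a)) ^+ 2.
  have [a0|a0] := leP 0 a.
    by rewrite lerXn2r ?nnegrE ?H// (le_trans a0)// H.
  have := H (- a); rewrite oppr_ge0 opprK => /(_ (ltW a0)) h.
  rewrite -[leRHS]sqrrN opprB -[leLHS]sqrrN lerXn2r ?nnegrE//; last first.
  - by rewrite (le_trans _ h)// oppr_ge0 ltW.
  - by rewrite oppr_ge0 ltW.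
have := H2 (ln x / 2).
have E1 : expR (ln x / 2) * expR (ln x / 2) = x.
  by rewrite -expRD -splitr lnK// posrE.
have E2 : expR (- (ln x / 2)) * expR (- (ln x / 2)) = x^-1.
  by rewrite -expRD -opprD -splitr expRN lnK// posrE.
have E3 : expR (ln x / 2) * expR (- (ln x / 2)) = 1 by rewrite -expRD subrr expR0.
have -> : (expR (ln x / 2) - expR (- (ln x / 2))) ^+ 2 = x - 2 + x^-1.
  by rewrite sqrrB !expr2 E1 E2 E3.
move=> h; have -> : ln x ^+ 2 = 4 * (ln x / 2) ^+ 2 by field.
by rewrite ler_pM2l.
Qed.

(** From [|e^(iy) - 1| <= 2 |y|], since the square of the left-hand side is [2 - 2 cos y]. *)
Lemma cos_ge (y : R) : 1 - 2 * y ^+ 2 <= cos y.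
Proof.
pose z : C := 0 +i* y.
have := @cexpB_le R z 0 0 (lexx _) (lexx _).
rewrite expR0 mulr1 cexp0 subr0 => h.
have nz : normc z = `|y| by rewrite /= expr0n/= add0r sqrtr_sqr.
have : normc (cexp z - 1) ^+ 2 <= (2 * `|y|) ^+ 2.
  by rewrite -nz lerXn2r ?nnegrE ?normc_ge0 ?mulr_ge0 ?normc_ge0.
rewrite normc_sqr ReB ImB Re_cexp Im_cexp/= expR0 !mul1r subr0 exprMn real_normK ?num_real//.
have := cos2Dsin2 y; rewrite !expr2; nra.
Qed.

(* For a large real part [sigma] the kernel concentrates around [t = sigma]; once
   rotated by [sigma ^ (- i tau)], its real part has a positive integral. *)
Let gamma_integral_neq0_large sigma tau : 2 < sigma -> 8 * tau ^+ 2 < sigma - 1 ->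
  gamma_integral (sigma +i* tau) != 0.
Proof.
move=> s2 st; apply/negP => /eqP G0.
have s0 : 0 < sigma by lra. have s1 : 0 < sigma - 1 by lra.
set s : C := sigma +i* tau in G0.
pose w : C := cexp (0 -i* (tau * ln sigma)).
have i0 : cintegrable mu pos (ker s 1) by exact: cintegrable_ker.
have : Re (w * gamma_integral s) = 0 by rewrite G0 mulr0.
rewrite gamma_integral_ker -cintegralZl// Re_cintegral => I0.
(* [cos_ge] at [tau ln (t / sigma)] and [ln_sqr_le] bound the cosine below by
   [1 - 8 tau^2 (t / sigma - 2 + sigma / t)]. Multiplied by the kernel this is a combination of
   three kernels, whose integrals are tied by the recurrence. *)
pose low t := (1 + 16 * tau ^+ 2) * gker sigma 1 t
  - 8 * tau ^+ 2 / sigma * gker (sigma + 1) 1 t - 8 * tau ^+ 2 * sigma * gker (sigma - 1) 1 t.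
have low_le t : 0 < t -> low t <= Re (w * ker s 1 t).
  move=> t0.
  have -> : w * ker s 1 t = cexp (((sigma - 1) * ln t - t) +i* (tau * ln (t / sigma))).
    rewrite -cexpD ln_div ?posrE//; congr cexp.
    by apply: complex_ext; rewrite ?(ReD,ImD,ReM,ImM,ReN,ImN)/=; ring.
  have Eg : expR ((sigma - 1) * ln t - t) = gker sigma 1 t by rewrite /gker mul1r.
  rewrite Re_cexp/= Eg /low.
  have g1 : gker (sigma + 1) 1 t = t * gker sigma 1 t by exact: gkerS.
  have g2 : gker (sigma - 1) 1 t = t^-1 * gker sigma 1 t.
    by rewrite -{2}(subrK 1 sigma) gkerS// mulKf// gt_eqF.
  rewrite g1 g2.
  apply: (@le_trans _ _ (gker sigma 1 t * (1 - 8 * tau ^+ 2 * (t / sigma - 2 + (t / sigma)^-1)))).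
    by rewrite invf_div le_eqVlt; apply/orP; left; apply/eqP; ring.
  rewrite ler_wpM2l ?gker_ge0// (le_trans _ (cos_ge _))//.
  rewrite lerD2l lerN2 exprMn.
  have := ln_sqr_le (divr_gt0 t0 s0); have := sqr_ge0 tau; nra.
have low_int : \int[mu]_(t in pos) low t = g sigma * (1 - 8 * tau ^+ 2 / (sigma - 1)).
  have i1 a : 0 < a -> mu.-integrable pos (EFin \o gker a 1) by move=> a0; exact: integrable_gker.
  have i2 b a : 0 < a -> mu.-integrable pos (EFin \o (fun t => b * gker a 1 t)).
    by move=> /i1; exact: integrable_mulrl.
  have s10 : 0 < sigma + 1 by lra.
  rewrite /low RintegralB//; last 2 first.
  - by apply: integrable_subr; exact: i2.
  - exact: i2.
  rewrite RintegralB//; [|exact: i2|exact: i2].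
  rewrite !RintegralZl//; [|exact: i1|exact: i1|exact: i1].
  rewrite -/(g _) -/(g (sigma + 1)) -/(g (sigma - 1)) g_rec//.
  have : g sigma = (sigma - 1) * g (sigma - 1) by rewrite -g_rec// subrK.
  move=> ->; field; by rewrite !gt_eqF.
have : \int[mu]_(t in pos) low t <= 0.
  rewrite -[leRHS]I0; apply: le_Rintegral => //; last by move=> t /posP; exact: low_le.
    by do 2 (apply: integrable_subr; last by apply/integrable_mulrl/integrable_gker; lra);
      apply/integrable_mulrl/integrable_gker; lra.
  by have [] := cintegrableZl mp w i0.
rewrite low_int leNgt mulr_gt0//; first by apply: g_gt0; lra.
by rewrite subr_gt0 ltr_pdivrMr// mul1r.
Qed.

(** By the functional equation a zero at [s] gives zeros at all [s + n]. The imaginary part stays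
    fixed, so for large [n] this contradicts the estimate for large real part. *)
Lemma gamma_integral_neq0 s : 0 < Re s -> gamma_integral s != 0.
Proof.
move=> s0.
have H n : gamma_integral s = 0 -> gamma_integral (s + n%:R) = 0.
  move=> G0; elim: n => [|n IH]; first by rewrite addr0.
  rewrite -addn1 natrD addrA gamma_integral_rec ?IH ?mulr0//.
  by rewrite ReD Re_nat ltr_wpDr.
apply/negP => /eqP G0.
pose n := (Num.truncn (2 + 8 * Im s ^+ 2)).+1.
have n1 : 2 + 8 * Im s ^+ 2 < n%:R by exact: truncnS_gt.
have : gamma_integral (s + n%:R) != 0.
  have -> : s + n%:R = (Re s + n%:R) +i* Im s.
    by apply: complex_ext; rewrite ?ReD ?ImD ?Re_nat ?Im_nat ?addr0.
  by apply: gamma_integral_neq0_large; have := sqr_ge0 (Im s); lra.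
by rewrite H// eqxx.
Qed.

Lemma Gamma_neq0 s : -1 < Re s -> s != 0 -> Gamma s != 0.
Proof.
move=> s1 s0; have : gamma_integral (s + 1) != 0.
  by apply: gamma_integral_neq0; rewrite ReD/=; lra.
by rewrite -Gamma_gtN1// mulf_eq0 negb_or => /andP[].
Qed.

(* The singularity of [ker] at [0] cancels in the difference, which extends
   Euler's integral to [-1 < Re s]. *)
Definition dker s v u t : C := ker s v t - ker s u t.

(** The two exponents differ by [(u - v) t], so the mean value inequality for [cexp] gains a factor
    [t]. *)
Lemma normc_dker_le s v u c t : 0 < t -> c <= Re v -> c <= Re u ->
  normc (dker s v u t) <= 2 * normc (u - v) * gker (Re s + 1) c t.
Proof.
move=> t0 cv cu.
have h (w : C) : c <= Re w -> Re ((s - 1) * (ln t)%:C - w * t%:C) <= (Re s - 1) * ln t - c * t.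
  move=> cw; rewrite ReB mulrC ReMr [w * _]mulrC ReMr ReB/= [ln t * _]mulrC lerD2l lerN2.
  by rewrite mulrC ler_wpM2l// ltW.
rewrite /dker/ker (le_trans (cexpB_le (h v cv) (h u cu)))// -mulrA ler_pM2l//.
rewrite gkerS// mulrA ler_wpM2r ?gker_ge0//.
have -> : (s - 1) * (ln t)%:C - v * t%:C - ((s - 1) * (ln t)%:C - u * t%:C) = (u - v) * t%:C.
  by ring.
by rewrite normcM normc_real gtr0_norm.
Qed.

Lemma cmeasurable_dker s v u : cmeasurable pos (dker s v u).
Proof. by apply: cmeasurableB; exact: cmeasurable_ker. Qed.

Lemma cintegrable_dker s v u : -1 < Re s -> 0 < Re v -> 0 < Re u ->
  cintegrable mu pos (dker s v u).
Proof.
move=> s1 v0 u0; pose c := Num.min (Re v) (Re u).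
have c0 : 0 < c by rewrite lt_min v0.
have i1 : mu.-integrable pos (EFin \o gker (Re s + 1) c) by apply: integrable_gker => //; lra.
apply: (cintegrable_dom mp _ _ (integrable_mulrl (2 * normc (u - v)) i1)).
  exact: cmeasurable_dker.
by move=> t /posP t0; apply: normc_dker_le => //; rewrite ge_min lexx ?orbT.
Qed.

(** Integration by parts on the difference, with primitive [ker (s + 1) v - ker (s + 1) u], reduces
    the integral to kernels at [s + 1], where each converges separately. *)
Lemma dker_integral s v u : -1 < Re s -> s != 0 -> 0 < Re v -> 0 < Re u ->
  cintegral mu pos (dker s v u) = Gamma s * (cpow v (- s) - cpow u (- s)).
Proof.
move=> s1 s0 v0 u0.
have s10 : 0 < Re (s + 1) by rewrite ReD/=; lra.
have iv := cintegrable_ker s10 v0; have iu := cintegrable_ker s10 u0.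
have idk := cintegrable_dker s1 v0 u0.
have pw (w : C) : 0 < Re w -> w * cpow w (- (s + 1)) = cpow w (- s).
  move=> w0; have wn0 : w != 0 by rewrite -normc_gt0 (lt_le_trans w0)// (le_trans (ler_norm _))// normc_ge_Re.
  by rewrite -{1}(cpow1 wn0) -cpowD; congr cpow; ring.
pose c := Num.min (Re v) (Re u).
have c0 : 0 < c by rewrite lt_min v0.
pose h t := s * dker s v u t - (v * ker (s + 1) v t - u * ker (s + 1) u t).
have hi2 : cintegrable mu pos (fun t => v * ker (s + 1) v t - u * ker (s + 1) u t).
  by apply: cintegrableB; [exact: mp|exact: cintegrableZl|exact: cintegrableZl].
have h0 : cintegral mu pos h = 0.
  pose D (w : C) t := ((s - 1) * (t^-1)%:C - w) * ker s w t.
  pose D1 (w : C) t := ((s + 1 - 1) * (t^-1)%:C - w) * ker (s + 1) w t.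
  apply: (@cFTC_pos0 R (fun t => ker (s + 1) v t - ker (s + 1) u t) h
    (fun t => s * (D v t - D u t) - (v * D1 v t - u * D1 u t)) (Re s + 1) c
    (2 * normc (u - v))).
  - by move: s1; lra.
  - exact: c0.
  - move=> t t0; apply: (is_cderive_congr (is_cderiveB (is_cderive_ker (s + 1) v t0)
      (is_cderive_ker (s + 1) u t0))); first by [].
    rewrite /h addrK !mulrBl /dker mulrBr.
    have e (w : C) : s * (t^-1)%:C * ker (s + 1) w t = s * ker s w t.
      by rewrite kerS// -mulrA; congr (_ * _); rewrite mulrA -rcM mulVf ?gt_eqF// mul1r.
    by rewrite !e; ring.
  - move=> t t0; apply: is_cderiveB.
      by apply: is_cderiveMl; apply: is_cderiveB; exact: is_cderive_ker.
    by apply: is_cderiveB; apply: is_cderiveMl; exact: is_cderive_ker.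
  - by apply: cintegrableB; [exact: mp|exact: cintegrableZl|exact: hi2].
  - move=> t t0; have := @normc_dker_le (s + 1) v u c t t0.
    rewrite !ge_min !lexx orbT => /(_ isT isT).
    by rewrite /gker addrK ReD.
move: h0; rewrite /h cintegralB//; last exact: cintegrableZl.
rewrite (cintegralZl mp _ idk) (cintegralB mp (cintegrableZl mp v iv) (cintegrableZl mp u iu)).
rewrite (cintegralZl mp _ iv) (cintegralZl mp _ iu) !ker_integral_scale// => /eqP; rewrite subr_eq0 => /eqP h0.
apply: (mulfI s0); rewrite h0 [RHS]mulrA Gamma_gtN1//.
by rewrite -(pw v)// -(pw u)//; ring.
Qed.

End GammaProperties.

Lemma cmeasurableX (R : realType) (d : measure_display) (T : measurableType d) (D : set T)
    (f : T -> R[i]) n : cmeasurable D f -> cmeasurable D (fun x => f x ^+ n).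
Proof.
move=> fm; elim: n => [|n IH].
  have -> : (fun x => f x ^+ 0) = fun=> 1 by apply/funext => x; rewrite expr0.
  exact: cmeasurable_cst.
have -> : (fun x => f x ^+ n.+1) = fun x => f x * f x ^+ n by apply/funext => x; rewrite exprS.
exact: cmeasurableM.
Qed.

(** * Integrals depending analytically on a parameter *)

Section ParametricIntegrals.
Context {R : realType}.
Local Notation C := R[i].
Local Notation mu := (@lebesgue_measure R).
Local Notation pos := (`]0%R, +oo[%classic : set (measurableTypeR R)).
Let mp : measurable pos := measurable_itv _.
Implicit Types (s u v w z a x : C) (t c sigma K p : R) (phi : measurableTypeR R -> C).

(** With [p = e^-t] this bounds the denominator of all the integrands away from 0, uniformly on the
    half-line. *)
Lemma slit_plane_bound z : slit_plane z ->
  exists2 d : R, 0 < d & forall p, 0 <= p <= 1 -> d <= normc (1 - z * p%:C).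
Proof.
case: z => x y sz.
have ReE p : Re (1 - (x +i* y) * p%:C) = 1 - x * p by rewrite ReB ReM/= mulr0 subr0.
have ImE p : Im (1 - (x +i* y) * p%:C) = - (y * p) by rewrite ImB ImM/= mulr0 !add0r.
have [y0|y0] := eqVneq y 0.
  have x1 : x < 1 by rewrite ltNge; apply/negP => x1; apply: sz.
  exists (Num.min 1 (1 - x)); first by rewrite lt_min ltr01 subr_gt0.
  move=> p /andP[p0 p1]; rewrite (le_trans _ (normc_ge_Re _))// ReE.
  rewrite (le_trans _ (ler_norm _))// ge_min.
  have [x0|x0] := leP x 0.
    by rewrite lerBrDr gerDl mulr_le0_ge0.
  by apply/orP; right; rewrite lerD2l lerN2 ler_piMr// ltW.
(* For [p X <= 1] the real part of [1 - z p] is at least 1/2; for larger [p] its imaginary part is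
   at least [|y| / X] in absolute value. *)
pose X := 2 * (`|x| + 1).
have X0 : 0 < X by rewrite mulr_gt0// ltr_wpDl.
exists (Num.min 2^-1 (`|y| / X)).
  by rewrite lt_min invr_gt0 ltr0Sn/= divr_gt0// normr_gt0.
move=> p /andP[p0 p1]; rewrite ge_min.
have [pX|pX] := leP (p * X) 1.
  apply/orP; left; rewrite (le_trans _ (normc_ge_Re _))// ReE.
  rewrite (le_trans _ (ler_norm _))//.
  have : x * p <= `|x| * p by rewrite ler_wpM2r// ler_norm.
  have := pX; rewrite /X => h1 h2.
  have : p * 2 * `|x| <= 1 by rewrite (le_trans _ h1)// -mulrA ler_wpM2l// /= ; lra.
  lra.
apply/orP; right; rewrite (le_trans _ (normc_ge_Im _))// ImE normrN normrM.
rewrite ler_wpM2l// ger0_norm// -[leLHS]mul1r ler_pdivrMr//.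
by rewrite ltW.
Qed.

Lemma cvg_cgeometric x : normc x < 1 -> series (fun n => x ^+ n) @ \oo --> (1 - x)^-1.
Proof.
move=> x1; have nx0 := normc_ge0 x.
have x1' : 1 - x != 0.
  apply/negP => /eqP/subr0_eq x1E; move: x1.
  by rewrite -x1E Normc.normc1 ltxx.
apply: (@squeeze_cvgc _ _ _ _ _ _ (fun n => normc x ^+ n * normc (1 - x)^-1)); last first.
  rewrite -[X in _ --> X](mul0r (normc (1 - x)^-1)); apply: cvgMl => //.
  by apply: cvg_expr; rewrite ger0_norm.
apply: nearW => n; rewrite seriesC_E.
have -> : \sum_(k < n) x ^+ k - (1 - x)^-1 = - (x ^+ n * (1 - x)^-1).
  apply: (mulIf x1'); rewrite mulrBl mulNr -mulrA mulVf// mulr1.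
  have -> : x ^+ n = 1 + (x - 1) * \sum_(k < n) x ^+ k by rewrite -subrX1; ring.
  by ring.
by rewrite normcN normcM normcX.
Qed.

Let expN01 t : 0 < t -> 0 <= expR (- t) <= 1.
Proof. by move=> t0; rewrite expR_ge0 -expR0 ler_expR oppr_le0 ltW. Qed.

Let cm_exp : cmeasurable pos (fun t : measurableTypeR R => (expR (- t))%:C).
Proof.
apply: cmeasurable_real; apply: measurableT_comp; first exact: measurable_expR.
by apply: measurable_funN; exact: measurable_id.
Qed.

Lemma cmeasurable_zker z : cmeasurable pos (fun t : measurableTypeR R => (1 - z * (expR (- t))%:C)^-1).
Proof.
apply: cmeasurableV; apply: cmeasurableB; first exact: cmeasurable_cst.
by apply: cmeasurableM; [exact: cmeasurable_cst|exact: cm_exp].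
Qed.

Lemma cmeasurable_expn n : cmeasurable pos (fun t : measurableTypeR R => (expR (- t))%:C ^+ n).
Proof.
exact: cmeasurableX.
Qed.

Lemma cintegrable_slit phi z : slit_plane z -> cintegrable mu pos phi ->
  cintegrable mu pos (fun t => phi t / (1 - z * (expR (- t))%:C)).
Proof.
move=> /slit_plane_bound[d d0 dz] iphi.
have i1 := cintegrable_normc mp iphi.
apply: (cintegrable_dom mp (M := fun t => d^-1 * normc (phi t))).
- by apply: cmeasurableM; [exact: cintegrable_measurable iphi|exact: cmeasurable_zker].
- move=> t /posP t0; rewrite normc_div mulrC ler_wpM2r ?normc_ge0//.
  by rewrite lef_pV2 ?posrE ?dz ?expN01// (lt_le_trans d0)// dz// expN01.
- exact: integrable_mulrl.
Qed.

(** With [p = e^-t], [1 / (1 - z p)] is a geometric series about [a] of ratio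
    [(z - a) p / (1 - a p)], convergent for [|z - a| < d] whatever [t] is. *)
Lemma analytic_slit phi a : cintegrable mu pos phi -> slit_plane a ->
  analytic_at (fun z => cintegral mu pos (fun t => phi t / (1 - z * (expR (- t))%:C))) a.
Proof.
move=> iphi /slit_plane_bound[d d0 da].
have mphi := cintegrable_measurable iphi.
have i1 := cintegrable_normc mp iphi.
pose q (t : measurableTypeR R) := (1 - a * (expR (- t))%:C)^-1.
apply: (@analytic_integral _ _ _ mu pos mp
  (fun z t => phi t / (1 - z * (expR (- t))%:C))
  (fun n t => phi t * q t * ((expR (- t))%:C ^+ n * q t ^+ n))
  (fun t => d^-1 * normc (phi t)) a d d0).
- move=> n; apply: cmeasurableM; first by apply: cmeasurableM => //; exact: cmeasurable_zker.
  apply: cmeasurableM; first exact: cmeasurable_expn.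
  by apply: cmeasurableX; exact: cmeasurable_zker.
- move=> n t /posP t0.
  have q1 : normc (q t) <= d^-1.
    by rewrite normcV lef_pV2 ?posrE ?da ?expN01// (lt_le_trans d0)// da// expN01.
  have dq : d * normc (q t) <= 1 by rewrite -ler_pdivlMl// mulr1.
  have dq0 : 0 <= d * normc (q t) by rewrite mulr_ge0 ?normc_ge0// ltW.
  rewrite !normcM !normcX normc_real ger0_norm ?expR_ge0//.
  rewrite [leLHS](_ : _ = (normc (q t) * normc (phi t)) * (expR (- t) ^+ n * (d * normc (q t)) ^+ n)); last first.
    by rewrite [(d * _) ^+ n]exprMn; ring.
  have e1 : expR (- t) ^+ n <= 1.
    by rewrite exprn_ile1 ?expR_ge0//; have /andP[] := expN01 t0.
  have qp : normc (q t) * normc (phi t) <= d^-1 * normc (phi t).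
    by rewrite ler_wpM2r ?normc_ge0.
  rewrite -[leRHS]mulr1; apply: ler_pM qp _.
  - by rewrite mulr_ge0 ?normc_ge0.
  - by rewrite mulr_ge0 ?exprn_ge0 ?expR_ge0.
  - apply: mulr_ile1; [|exact: exprn_ge0|exact: e1|exact: exprn_ile1].
    by rewrite exprn_ge0 ?expR_ge0.
- exact: integrable_mulrl.
move=> w t wd /posP t0.
have da0 := lt_le_trans d0 (da _ (expN01 t0)).
have a0 : 1 - a * (expR (- t))%:C != 0 by rewrite -normc_gt0.
pose y := (w - a) * ((expR (- t))%:C * q t).
have y1 : normc y < 1.
  rewrite !normcM normc_real ger0_norm ?expR_ge0// normcV.
  rewrite mulrA ltr_pdivrMr// mul1r (le_lt_trans _ (lt_le_trans wd (da _ (expN01 t0))))//.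
  by rewrite ler_piMr ?normc_ge0//; have /andP[] := expN01 t0.
have -> : phi t / (1 - w * (expR (- t))%:C) = phi t * q t * (1 - y)^-1.
  rewrite -mulrA -invfM /q; congr (_ / _).
  by rewrite /y /q; field.
apply: (eq_cvgc _ (cvgcMl (k := phi t * q t) (cvg_cgeometric y1))) => n.
rewrite !seriesC_E mulr_sumr; apply: eq_bigr => k _.
by rewrite /y !exprMn; ring.
Qed.

(** The finite geometric sum is [(1 - x^n) / (1 - x)] with [|x| < 1], so twice the limiting
    integrand dominates. This reaches the circle [|z| = 1], and in particular [z = 1]. *)
Lemma cvg_geometric_integral phi z : normc z <= 1 -> cmeasurable pos phi ->
  cintegrable mu pos (fun t => phi t / (1 - z * (expR (- t))%:C)) ->
  series (fun n => z ^+ n * cintegral mu pos (fun t => phi t * (expR (- t))%:C ^+ n)) @ \oo -->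
    cintegral mu pos (fun t => phi t / (1 - z * (expR (- t))%:C)).
Proof.
move=> z1 mphi iphi; have i1 := cintegrable_normc mp iphi.
have zt t : 0 < t -> normc (z * (expR (- t))%:C) < 1.
  move=> t0; rewrite normcM normc_real ger0_norm ?expR_ge0// (le_lt_trans (ler_wpM2r _ z1)) ?expR_ge0//.
  by rewrite mul1r -expR0 ltr_expR oppr_lt0.
have z0 t : 0 < t -> 1 - z * (expR (- t))%:C != 0.
  by move=> /zt h; apply/negP => /eqP/subr0_eq E; move: h; rewrite -E Normc.normc1 ltxx.
have le2 t : 0 < t -> normc (phi t) <= 2 * normc (phi t / (1 - z * (expR (- t))%:C)).
  move=> t0; rewrite normc_div mulrA ler_pdivlMr ?normc_gt0 ?z0//.
  rewrite mulrC ler_wpM2r ?normc_ge0// (le_trans (le_normcB _ _))// Normc.normc1.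
  by have := zt t t0; lra.
have in_ n : cintegrable mu pos (fun t => phi t * (expR (- t))%:C ^+ n).
  apply: (cintegrable_dom mp _ _ (integrable_mulrl 2 i1)).
    by apply: cmeasurableM => //; exact: cmeasurable_expn.
  move=> t /posP t0; rewrite (le_trans _ (le2 t t0))// normcM normcX normc_real.
  rewrite ler_piMr ?normc_ge0// ger0_norm ?expR_ge0// exprn_ile1 ?expR_ge0//.
  by have /andP[] := expN01 t0.
have [||||_] := @cvg_cintegral _ _ _ mu pos mp
  (fun N t => \sum_(n < N) z ^+ n * (phi t * (expR (- t))%:C ^+ n))
  (fun t => phi t / (1 - z * (expR (- t))%:C))
  (fun t => 2 * normc (phi t / (1 - z * (expR (- t))%:C))).
- move=> n; apply: cmeasurable_sum => i; apply: cmeasurableM; first exact: cmeasurable_cst.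
  by apply: cmeasurableM => //; exact: cmeasurable_expn.
- move=> t /posP t0.
  apply: (eq_cvgc _ (cvgcMl (k := phi t) (cvg_cgeometric (zt t t0)))) => n.
  rewrite seriesC_E mulr_sumr; apply: eq_bigr => k _.
  by rewrite exprMn; ring.
- move=> n t /posP t0.
  have -> : \sum_(i < n) z ^+ i * (phi t * (expR (- t))%:C ^+ i) =
      (1 - (z * (expR (- t))%:C) ^+ n) * (phi t / (1 - z * (expR (- t))%:C)).
    apply: (mulIf (z0 t t0)); rewrite -mulrA divfK ?z0//.
    have -> : \sum_(i < n) z ^+ i * (phi t * (expR (- t))%:C ^+ i) =
        phi t * \sum_(i < n) (z * (expR (- t))%:C) ^+ i.
      by rewrite mulr_sumr; apply: eq_bigr => i _; rewrite exprMn; ring.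
    have -> : (z * (expR (- t))%:C) ^+ n = 1 + (z * (expR (- t))%:C - 1) *
        \sum_(i < n) (z * (expR (- t))%:C) ^+ i by rewrite -subrX1; ring.
    by ring.
  rewrite [leLHS]normcM; apply: ler_wpM2r; first exact: normc_ge0.
  rewrite (le_trans (le_normcB _ _))// Normc.normc1 normcX.
  by rewrite -[leRHS]/(1 + 1) lerD2l exprn_ile1 ?normc_ge0// ltW// zt.
- exact: integrable_mulrl.
apply: eq_cvgc => N; rewrite seriesC_E.
rewrite (@cintegral_sum _ _ _ mu pos mp _ (index_enum 'I_N)
  (fun (n : 'I_N) t => z ^+ n * (phi t * (expR (- t))%:C ^+ n))).
  by apply: eq_bigr => i _; rewrite cintegralZl.
by move=> i; exact: cintegrableZl.
Qed.

(** A consequence of [1 + t <= expR t]. The factor [1 *] keeps the form of the general denominator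
    at [z = 1]. *)
Lemma invr_1Bexp_le t : 0 < t -> normc (1 - 1 * (expR (- t))%:C)^-1 <= 1 + t^-1.
Proof.
move=> t0; rewrite mul1r -rcB normcV normc_real ger0_norm; last first.
  by rewrite subr_ge0 -expR0 ler_expR oppr_le0 ltW.
have e1 : 1 + t <= expR t := expR_ge1Dx t.
have e0 : 0 < 1 + t by rewrite addr_gt0.
have h : t / (1 + t) <= 1 - expR (- t).
  rewrite expRN lerBrDr -lerBrDl.
  have -> : 1 - t / (1 + t) = (1 + t)^-1 by field; rewrite gt_eqF.
  by rewrite lef_pV2 ?posrE ?expR_gt0.
have -> : 1 + t^-1 = (t / (1 + t))^-1 by field; rewrite !gt_eqF.
rewrite lef_pV2 ?posrE ?divr_gt0// (lt_le_trans _ h)// divr_gt0//.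
Qed.

(** The denominator costs [1 + 1 / t], that is one unit of the exponent at 0, hence [1 < sigma]. *)
Lemma cintegrable_1Bexp phi K sigma c : 1 < sigma -> 0 < c -> cmeasurable pos phi ->
  (forall t, 0 < t -> normc (phi t) <= K * gker sigma c t) ->
  cintegrable mu pos (fun t => phi t / (1 - 1 * (expR (- t))%:C)).
Proof.
move=> s1 c0 mphi phiK.
have i1 (a : R) : 0 < a -> mu.-integrable pos (EFin \o (fun t => K * gker a c t)).
  by move=> a0; apply: integrable_mulrl; exact: integrable_gker.
have i2 : mu.-integrable pos (EFin \o (fun t => K * gker sigma c t + K * gker (sigma - 1) c t)).
  by apply: (integrableD mp (i1 sigma _) (i1 (sigma - 1) _)); lra.
apply: (cintegrable_dom mp _ _ i2).
  by apply: cmeasurableM => //; exact: cmeasurable_zker.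
move=> t /posP t0; rewrite normcM.
have -> : K * gker sigma c t + K * gker (sigma - 1) c t = (K * gker sigma c t) * (1 + t^-1).
  by rewrite -{1 3}(subrK 1 sigma) gkerS//; field; rewrite gt_eqF.
by apply: ler_pM; rewrite ?normc_ge0 ?phiK ?invr_1Bexp_le.
Qed.

Lemma expr_fact_le (x : R) n : 0 <= x -> x ^+ n / n`!%:R <= expR x.
Proof.
case: n => [|n] x0; first by rewrite expr0 fact0 divr1 -expR0 ler_expR.
by rewrite (le_trans _ (expR_ge1Dxn n x0))// lerDr.
Qed.

(** Expand [t^s] about [a] in powers of [ln t]. The Cauchy bound [(r |ln t|)^n / n!] is at most
    [e^(r |ln t|)], hence at most [t^r + t^-r], and [Re a - r] is still above [sigma]. *)
Lemma analytic_mellin phi (sigma : R) a : cmeasurable pos phi ->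
  (forall r, sigma < r -> mu.-integrable pos (EFin \o (fun t => expR (r * ln t) * normc (phi t)))) ->
  sigma < Re a ->
  analytic_at (fun s => cintegral mu pos (fun t => cexp (s * (ln t)%:C) * phi t)) a.
Proof.
move=> mphi iphi sa.
pose r := (Re a - sigma) / 2; have r0 : 0 < r by rewrite divr_gt0// subr_gt0.
have mln : measurable_fun pos (@ln R) by exact: measurable_funS (@measurable_ln R).
have mexp w : cmeasurable pos (fun t => cexp (w * (ln t)%:C)).
  apply: (@derivable_cmeasurable _ _ (fun t => w * (t^-1)%:C * cexp (w * (ln t)%:C))) => t t0.
  by apply: is_cderive_cexp; apply: is_cderiveMl; exact: is_cderive_ln.
apply: (@analytic_integral _ _ _ mu pos mp _
  (fun n t => cexp (a * (ln t)%:C) * phi t * ((ln t ^+ n / n`!%:R)%:C))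
  (fun t => expR ((Re a + r) * ln t) * normc (phi t) + expR ((Re a - r) * ln t) * normc (phi t)) a r r0).
- move=> n; apply: cmeasurableM; first by apply: cmeasurableM.
  by apply: cmeasurable_real; apply: measurable_funM; [exact: measurable_funX|exact: measurable_cst].
- move=> n t _; rewrite normcM normcM normc_cexp [a * _]mulrC ReMr normc_real.
  rewrite normrM normrX normfV (@ger0_norm _ n`!%:R)//.
  rewrite [leLHS](_ : _ = expR (ln t * Re a) * normc (phi t) * ((r * `|ln t|) ^+ n / n`!%:R)); last first.
    by rewrite [(r * _) ^+ n]exprMn; ring.
  have := expr_fact_le n (mulr_ge0 (ltW r0) (normr_ge0 (ln t))).
  move=> /(ler_wpM2l (mulr_ge0 (expR_ge0 (ln t * Re a)) (normc_ge0 (phi t)))) /le_trans; apply.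
  rewrite mulrAC -mulrDl ler_wpM2r ?normc_ge0// -expRD.
  have [l0|l0] := ger0P (ln t).
    rewrite (@le_trans _ _ (expR ((Re a + r) * ln t)))// ?lerDl ?expR_ge0//.
    by rewrite ler_expR; lra.
  rewrite (@le_trans _ _ (expR ((Re a - r) * ln t)))// ?lerDr ?expR_ge0//.
  by rewrite ler_expR; lra.
- by apply: (integrableD mp (iphi _ _) (iphi _ _)); rewrite /r; lra.
move=> w t _ _.
have -> : cexp (w * (ln t)%:C) * phi t =
    cexp (a * (ln t)%:C) * phi t * cexp ((w - a) * (ln t)%:C).
  by rewrite [RHS]mulrAC -cexpD -mulrDl [a + _]addrC subrK.
apply: (eq_cvgc _ (cvgcMl (k := cexp (a * (ln t)%:C) * phi t) (@cvg_cexp_series _ ((w - a) * (ln t)%:C)))) => n.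
rewrite !seriesC_E mulr_sumr; apply: eq_bigr => k _.
by rewrite rcM rcX rcV rc_nat exprMn; ring.
Qed.

Lemma ker0E s u t : ker s u t = cexp (s * (ln t)%:C) * ker 0 u t.
Proof. by rewrite /ker -cexpD; congr cexp; ring. Qed.

Lemma analytic_gamma_integral a : 0 < Re a -> analytic_at (@gamma_integral R) a.
Proof.
move=> a0.
have -> : @gamma_integral R = fun s => cintegral mu pos (fun t => cexp (s * (ln t)%:C) * ker 0 1 t).
  by apply/funext => s; rewrite gamma_integral_ker; apply: eq_cintegral => t _; exact: ker0E.
apply: (@analytic_mellin _ 0) => //; first exact: cmeasurable_ker.
move=> r r0; have := integrable_gker r0 (@ltr01 R); congr (integrable _ _ _).
apply/funext => t; rewrite -[RHS]/((expR (r * ln t) * normc (ker 0 1 t))%:E).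
rewrite normc_ker /gker -expRD; congr ((expR _)%:E).
by rewrite -[Re 0]/(0 : R) -[Re 1]/(1 : R); ring.
Qed.

End ParametricIntegrals.

(** * Integral representation of the Lerch transcendent *)

Section LerchSlit.
Context {R : realType}.
Local Notation C := R[i].
Local Notation mu := (@lebesgue_measure R).
Local Notation pos := (`]0%R, +oo[%classic : set (measurableTypeR R)).
Let mp : measurable pos := measurable_itv _.
Implicit Types (s u v w z a x : C) (t c sigma K p : R) (phi : measurableTypeR R -> C).

Definition zintegral phi z : C :=
  cintegral mu pos (fun t => phi t / (1 - z * (expR (- t))%:C)).

Lemma ker_expn s u n t : ker s u t * (expR (- t))%:C ^+ n = ker s (u + n%:R) t.
Proof.
rewrite -cexp_real -cexpMn -cexpD /ker; congr cexp.
by rewrite rcN mulrDl; ring.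
Qed.

Lemma dker_expn s v u n t :
  dker s v u t * (expR (- t))%:C ^+ n = dker s (v + n%:R) (u + n%:R) t.
Proof. by rewrite /dker mulrBl !ker_expn. Qed.

Lemma Re_addn u n : 0 < Re u -> 0 < Re (u + n%:R).
Proof. by move=> u0; rewrite ReD Re_nat ltr_wpDr. Qed.

(** A factor [e^(-n t)] shifts the parameter of the kernel to [u + n], and [ker_integral_scale]
    turns the n-th term into [(u + n)^-s] times Gamma. *)
Lemma cvg_lerch_series s u z : 0 < Re s -> 0 < Re u -> normc z <= 1 ->
  cintegrable mu pos (fun t => ker s u t / (1 - z * (expR (- t))%:C)) ->
  series (fun n => z ^+ n / cpow (u + n%:R) s) @ \oo --> zintegral (ker s u) z / gamma_integral s.
Proof.
move=> s0 u0 z1 iz; have G0 := gamma_integral_neq0 s0.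
have := cvg_geometric_integral z1 (cmeasurable_ker s u) iz.
move=> /(cvgcMl (k := (gamma_integral s)^-1)); rewrite mulrC.
apply: eq_cvgc => N; rewrite !seriesC_E mulr_sumr; apply: eq_bigr => n _.
have -> : cintegral mu pos (fun t => ker s u t * (expR (- t))%:C ^+ n) =
    gamma_integral s * cpow (u + n%:R) (- s).
  rewrite -ker_integral_scale//; last exact: Re_addn.
  by apply: eq_cintegral => t _; rewrite ker_expn.
by rewrite cpowN mulrCA mulKf.
Qed.

Lemma slit_plane_disc z : normc z < 1 -> slit_plane z.
Proof.
move=> z1 [_ z2]; have : 1 < 1 :> R; last by rewrite ltxx.
by rewrite (le_lt_trans z2)// (le_lt_trans (ler_norm _))// (le_lt_trans (normc_ge_Re _)).
Qed.

Lemma slit_plane_segment z t : slit_plane z -> 0 <= t <= 1 -> slit_plane (0 + t%:C * (z - 0)).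
Proof.
rewrite add0r subr0 => sz /andP[t0 t1] []; rewrite ImMr ReMr => /eqP.
rewrite mulf_eq0 => /orP[/eqP ->|/eqP z0 tz]; first by rewrite mul0r ler10.
apply: sz; split => //; rewrite leNgt; apply/negP => z1.
have [z2|z2] := ltP (Re z) 0.
  by move: tz; rewrite leNgt (le_lt_trans _ ltr01)// mulr_ge0_le0// ltW.
by move: tz; rewrite leNgt (le_lt_trans _ z1)// ler_piMl.
Qed.

Lemma slit_plane_neq1 z : slit_plane z -> z != 1.
Proof. by move=> sz; apply/negP => /eqP z1; apply: sz; rewrite z1. Qed.

Lemma lerch_region_le1 z s : lerch_region z s -> normc z <= 1.
Proof.
rewrite /lerch_region normE ltcR => -[/ltW //|[/eqP + _]].
by rewrite eq_complex/= => /andP[/eqP -> _].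
Qed.

(** The unit disc lies in the region of the series for every [s], and the slit plane is star-shaped
    about 0, so the segment from 0 reaches every [z]. *)
Lemma lerch_slit_eq (g : C -> C) s u z :
  analytic_on (@slit_plane R) g ->
  (forall w, slit_plane w -> lerch_region w s ->
    series (fun n => w ^+ n / cpow (u + n%:R) s) @ \oo --> g w) ->
  slit_plane z -> lerch z s u = g z.
Proof.
move=> ga gs sz; rewrite /lerch (negbTE (slit_plane_neq1 sz)).
apply: (@continuation_eq _ _ _ _ g 0 z 1) => //.
- move=> w [sw rw]; apply/esym.
  exact: cvgc_lim (gs w sw rw).
- move=> w; rewrite subr0 => w1; split; first exact: slit_plane_disc.
  by left; rewrite normE ltcR.
- by move=> t; exact: slit_plane_segment.
Qed.

Lemma lerch_slit_pos s u z : 0 < Re s -> 0 < Re u -> slit_plane z ->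
  lerch z s u = zintegral (ker s u) z / gamma_integral s.
Proof.
move=> s0 u0; apply: (@lerch_slit_eq (fun z => zintegral (ker s u) z / gamma_integral s)).
- move=> a sa; apply: (analyticM (analytic_slit (cintegrable_ker s0 u0) sa)).
  exact: analytic_cst.
- move=> w sw /lerch_region_le1 w1; apply: cvg_lerch_series => //.
  by apply: cintegrable_slit => //; exact: cintegrable_ker.
Qed.

(* With [S] the Lerch series and [D] the series of [(u + n)^-s - (u + 1 + n)^-s],
   [z (S - D) = S - u^-s]; and [D] is an integral as soon as [-1 < Re s]. *)
Lemma lerch_slit_neg s u z : -1 < Re s <= 0 -> s != 0 -> 0 < Re u -> slit_plane z ->
  lerch z s u = (cpow u (- s) - z * (zintegral (dker s u (u + 1)) z / Gamma s)) / (1 - z).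
Proof.
move=> /andP[s1 s0] sn0 u0.
have u10 : 0 < Re (u + 1) by rewrite ReD/= addr_gt0.
have idk := cintegrable_dker s1 u0 u10.
have G0 := Gamma_neq0 s1 sn0.
pose D z := zintegral (dker s u (u + 1)) z / Gamma s.
apply: (@lerch_slit_eq (fun z => (cpow u (- s) - z * D z) / (1 - z))).
- move=> a sa; apply: analyticM.
    apply: analyticB; first exact: analytic_cst.
    apply: analyticM; first exact: analytic_id.
    by apply: (analyticM (analytic_slit idk sa)); exact: analytic_cst.
  apply: analyticV; first by apply: analyticB; [exact: analytic_cst|exact: analytic_id].
  by rewrite subr_eq0 eq_sym slit_plane_neq1.
move=> w sw rw.
(* As [Re s <= 0], the region of the series has no point with [|w| = 1]. *)
have w1 : normc w < 1.
  case: rw => [|[_ s2]]; first by rewrite normE ltcR.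
  by move: s2; rewrite ltNge (le_trans s0).
have wn1 : 1 - w != 0 by rewrite subr_eq0 eq_sym slit_plane_neq1.
pose e n := cpow (u + n%:R) (- s).
have cD : series (fun n => w ^+ n * (e n - e n.+1)) @ \oo --> D w.
  have := cvg_geometric_integral (ltW w1) (cmeasurable_dker s u (u + 1)) (cintegrable_slit sw idk).
  move=> /(cvgcMl (k := (Gamma s)^-1)); rewrite [X in _ --> X]mulrC.
  apply: eq_cvgc => N; rewrite !seriesC_E mulr_sumr; apply: eq_bigr => n _.
  have -> : cintegral mu pos (fun t => dker s u (u + 1) t * (expR (- t))%:C ^+ n) =
      Gamma s * (e n - e n.+1).
    rewrite /e -[in n.+1%:R]addn1 natrD [n%:R + 1]addrC addrA -dker_integral//; try exact: Re_addn.
    by apply: eq_cintegral => t _; rewrite dker_expn.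
  by rewrite mulrCA mulKf.
(* Since [-1 < Re s], [e n] grows at most linearly: it is [u + n] times a power of exponent
   [- (s + 1)], which Euler's integral bounds uniformly in [n]. *)
have cE : (w ^+ n * e n) @[n --> \oo] --> (0 : C).
  have s10 : 0 < Re (s + 1) by rewrite ReD/=; lra.
  have Gs0 : 0 < normc (gamma_integral (s + 1)) by rewrite normc_gt0 gamma_integral_neq0.
  pose B := 2 * \int[mu]_(t in pos) gker (Re (s + 1)) (Re u) t / normc (gamma_integral (s + 1)).
  have eB n : normc (e n) <= (normc u + n%:R) * B.
    have un0 := Re_addn n u0.
    have wn0 : u + n%:R != 0.
      by rewrite -normc_gt0 (lt_le_trans un0)// (le_trans (ler_norm _))// normc_ge_Re.
    have -> : e n = (u + n%:R) * cpow (u + n%:R) (- (s + 1)).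
      rewrite -[X in _ = X * _](cpow1 wn0) -cpowD /e; congr cpow; ring.
    rewrite normcM; apply: ler_pM; rewrite ?normc_ge0//.
      by rewrite (le_trans (le_normcD _ _))// normc_nat.
    rewrite /B ler_pdivlMr// mulrC -normcM -ker_integral_scale//.
    apply: (normc_cintegral_le mp); first exact: cmeasurable_ker.
      move=> t /posP t0; rewrite normc_ker ler_expR lerD2l lerN2 ler_wpM2r ?(ltW t0)//.
      by rewrite ReD Re_nat lerDl.
    exact: integrable_gker.
  apply: (@squeeze_cvgc _ _ _ _ _ _ (fun n => normc u * B * normc w ^+ n + B * (n%:R * normc w ^+ n))).
    apply: nearW => n; rewrite subr0 normcM normcX.
    have := ler_wpM2l (exprn_ge0 n (normc_ge0 w)) (eB n) => /le_trans; apply.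
    by rewrite le_eqVlt; apply/orP; left; apply/eqP; ring.
  have -> : 0 = normc u * B * 0 + B * 0 :> R by rewrite !mulr0 addr0.
  apply: cvgD; apply: cvgMr.
    by apply: cvg_expr; rewrite ger0_norm ?normc_ge0.
  by apply: cvg_mulr_expr; rewrite normc_ge0.
have FF : Filter (\oo : set_system nat) by exact: _.
have H1 := @cvgcMl _ _ _ FF _ w _ cD.
have H2 := @cvgcB _ _ _ FF _ _ _ _ (@cvgc_cst _ _ _ FF (e 0%N)) H1.
move: (@cvgcMl _ _ _ FF _ (1 - w)^-1 _ (@cvgcB _ _ _ FF _ _ _ _ H2 cE)).
have -> : (1 - w)^-1 * (e 0%N - w * D w - 0) = (cpow u (- s) - w * D w) / (1 - w).
  by rewrite subr0 {1}/e addr0 mulrC.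
apply: eq_cvgc => N; rewrite !seriesC_E; apply: (mulfI wn1); rewrite mulVKf//.
under [in RHS]eq_bigr => n _ do rewrite -cpowN -/(e n).
(* Summation by parts on partial sums: [(1 - w)] times the sum of [w^n e_n] is [e_0 - w] times the
   sum of [w^n (e_n - e_(n+1))], minus [w^N e_N]. *)
elim: N => [|N IH]; first by rewrite !big_ord0 !mulr0 subr0 expr0 mul1r subrr.
rewrite !big_ord_recr/= [RHS]mulrDr -IH exprS; ring.
Qed.

(** For [0 < Re s] the two integrals subtract. Otherwise both values come from [lerch_slit_neg], and
    their combination has to be recognised as [1 - z] times one integral. *)
Lemma lerch_slit_sub s u v z : -1 < Re s -> s != 0 -> 0 < Re u -> 0 < Re v -> slit_plane z ->
  Gamma s * (lerch z s v - lerch z s u) = zintegral (dker s v u) z.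
Proof.
move=> s1 sn0 u0 v0 sz.
have [s0|s0] := ltP 0 (Re s).
  rewrite !lerch_slit_pos// Gamma_pos// -mulrBl mulrC divfK ?gamma_integral_neq0//.
  rewrite -(cintegralB mp) /zintegral; [|exact: cintegrable_slit sz (cintegrable_ker _ _)..].
  by apply: eq_cintegral => t _; rewrite -mulrBl.
have s10 : -1 < Re s <= 0 by rewrite s1.
have u10 : 0 < Re (u + 1) by rewrite ReD/= addr_gt0.
have v10 : 0 < Re (v + 1) by rewrite ReD/= addr_gt0.
have G0 := Gamma_neq0 s1 sn0.
have z1 : 1 - z != 0 by rewrite subr_eq0 eq_sym slit_plane_neq1.
rewrite !lerch_slit_neg//.
have [d d0 dz] := slit_plane_bound sz.
have iv := cintegrable_slit sz (cintegrable_dker s1 v0 v10).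
have iu := cintegrable_slit sz (cintegrable_dker s1 u0 u10).
have ivu := cintegrable_dker s1 v0 u0.
(* The integrands agree pointwise: [dker s w (w + 1)] is [ker s w] times [1 - e^-t], and
   [(1 - z e^-t) - z (1 - e^-t) = 1 - z]. *)
have : Gamma s * (cpow v (- s) - cpow u (- s)) - z * (zintegral (dker s v (v + 1)) z -
    zintegral (dker s u (u + 1)) z) = (1 - z) * zintegral (dker s v u) z.
  rewrite -dker_integral// /zintegral.
  rewrite -(cintegralB mp iv iu) -(cintegralZl mp _ (cintegrableB mp iv iu)).
  rewrite -(cintegralB mp ivu (cintegrableZl mp _ (cintegrableB mp iv iu))).
  rewrite -(cintegralZl mp _ (cintegrable_slit sz ivu)).
  apply: eq_cintegral => t /posP t0.
  have dt : 1 - z * (expR (- t))%:C != 0.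
    rewrite -normc_gt0 (lt_le_trans d0)// dz// expR_ge0 -expR0 ler_expR oppr_le0 ltW//.
  have e (w : C) : dker s w (w + 1) t = ker s w t * (1 - (expR (- t))%:C).
    by rewrite /dker -(ker_expn s w 1 t) expr1; ring.
  rewrite !e /dker; field.
  exact: dt.
move=> h; apply: (mulfI z1); rewrite -h; field.
by rewrite z1 G0.
Qed.

(** Once [t^s] is split off, the remaining factor is bounded near 0, so the Mellin integral
    converges from [-1 < Re s] on. *)
Lemma analytic_zintegral_dker (a u v z : C) : slit_plane z -> 0 < Re u -> 0 < Re v -> -1 < Re a ->
  analytic_at (fun s => zintegral (dker s v u) z) a.
Proof.
move=> sz u0 v0 a1; have [d d0 dz] := slit_plane_bound sz.
have -> : (fun s => zintegral (dker s v u) z) = fun s => cintegral mu pos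
    (fun t => cexp (s * (ln t)%:C) * (dker 0 v u t / (1 - z * (expR (- t))%:C))).
  apply/funext => s; apply: eq_cintegral => t _.
  by rewrite /dker !(ker0E s); ring.
pose c := Num.min (Re v) (Re u); have c0 : 0 < c by rewrite lt_min v0.
have mphi : cmeasurable pos (fun t => dker 0 v u t / (1 - z * (expR (- t))%:C)).
  by apply: cmeasurableM; [exact: cmeasurable_dker|exact: cmeasurable_zker].
apply: (analytic_mellin mphi _ a1) => r r1.
apply: (@le_integrable _ _ _ mu pos mp _ (EFin \o (fun t => d^-1 * (2 * normc (u - v)) * gker (r + 1) c t))).
- apply/measurable_EFinP; apply: measurable_funM; last exact: measurable_normc.
  apply: measurableT_comp; first exact: measurable_expR.
  apply: measurable_funM; first exact: measurable_cst.
  exact: measurable_funS (@measurable_ln R).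
- move=> t /posP t0; rewrite lee_fin.
  rewrite ger0_norm ?mulr_ge0 ?expR_ge0 ?normc_ge0//.
  rewrite ger0_norm ?mulr_ge0 ?invr_ge0 ?(ltW d0) ?gker_ge0 ?normc_ge0//.
  rewrite normc_div.
  have h := @normc_dker_le _ 0 v u c t t0.
  rewrite !ge_min !lexx orbT in h.
  have {}h := h isT isT.
  have dt : d <= normc (1 - z * (expR (- t))%:C).
    by rewrite dz// expR_ge0 -expR0 ler_expR oppr_le0 ltW.
  have q1 : (normc (1 - z * (expR (- t))%:C))^-1 <= d^-1.
    by rewrite lef_pV2 ?posrE// (lt_le_trans d0).
  have -> : gker (r + 1) c t = expR (r * ln t) * gker (Re 0 + 1) c t.
    by rewrite /gker -expRD; congr expR; rewrite -[Re 0]/(0 : R); ring.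
  rewrite [leRHS](_ : _ = expR (r * ln t) * ((2 * normc (u - v) * gker (Re 0 + 1) c t) * d^-1)); last by ring.
  rewrite ler_wpM2l ?expR_ge0//; apply: ler_pM => //; rewrite ?normc_ge0 ?invr_ge0 ?normc_ge0//.
- by apply: integrable_mulrl; apply: integrable_gker => //; lra.
Qed.

End LerchSlit.

(** * The case z = 1: the Hurwitz zeta function *)

Section Hurwitz.
Context {R : realType}.
Local Notation C := R[i].
Local Notation mu := (@lebesgue_measure R).
Local Notation pos := (`]0%R, +oo[%classic : set (measurableTypeR R)).
Let mp : measurable pos := measurable_itv _.
Implicit Types (s u v w z a b : C) (t c sigma K p : R).

(* Remainder of the expansion of [t / (1 - e^-t)] in powers of [y = 1 - e^-t],
   which comes from [t = - ln (1 - y)]. *)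
Definition log_remainder k t : R :=
  t / (1 - expR (- t)) - \sum_(j < k) (1 - expR (- t)) ^+ j / j.+1%:R.

(** With [y = 1 - e^-t], [y' = 1 - y], so the derivative [1 - sum of y^j (1 - y)] telescopes to
    [y^k]. *)
Lemma is_derive_log_partial k t :
  is_derive t 1 (fun t => t - \sum_(j < k) (1 - expR (- t)) ^+ j.+1 / j.+1%:R)
    ((1 - expR (- t)) ^+ k).
Proof.
elim: k => [|k IH].
  apply: (is_derive_congr (is_derive_id t 1)) => // x.
  by rewrite big_ord0 subr0.
have d1 : is_derive t 1 (fun t : R => 1 - expR (- t)) (expR (- t)).
  have h : is_derive t 1 (fun t : R => expR (- t)) (- expR (- t)).
    have hN : is_derive t 1 (fun t : R => - t) (-1).
      exact: (is_derive_congr (is_deriveN (is_derive_id t 1))).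
    apply: (is_derive_congr (is_derive1_comp (is_derive_expR (- t)) hN)) => //.
    by rewrite mulrN1.
  have h1 : is_derive t 1 (cst 1 : R -> R) 0 by exact: is_derive_cst.
  apply: (is_derive_congr (is_deriveB h1 h)) => //.
  by rewrite sub0r opprK.
have d2 := is_deriveX k.+1 d1.
apply: (is_derive_congr (is_deriveB IH (is_deriveZ k.+1%:R^-1 d2))).
  move=> x; rewrite big_ord_recr/= [in RHS]opprD addrA; congr (_ - _).
  by rewrite [RHS]mulrC exprfctE.
rewrite exprS /=  -[_ *: expR _]/(_ * _) -[_ *: (_ * _)]/(_ * _) !mulrA mulVf ?pnatr_eq0//.
ring.
Qed.

Lemma onemexpN_ge0 t : 0 <= t -> 0 <= 1 - expR (- t).
Proof. by move=> t0; rewrite subr_ge0 -expR0 ler_expR oppr_le0. Qed.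

Lemma onemexpN_gt0 t : 0 < t -> 0 < 1 - expR (- t).
Proof. by move=> t0; rewrite subr_gt0 -expR0 ltr_expR oppr_lt0. Qed.

Lemma onemexpN_le t : 1 - expR (- t) <= t.
Proof. by have := expR_ge1Dx (- t); lra. Qed.

(** The function [F] equals [y] times the remainder, vanishes at 0 and has derivative [y^k], so
    [F t] is [t] times the value of [y^k] at some [c <= t]. One factor [y] cancels, as [0 < k], and
    the others are at most [t]. *)
Lemma log_remainder_le k t : (0 < k)%N -> 0 < t -> `|log_remainder k t| <= t ^+ k.
Proof.
move=> k0 t0; have y0 := onemexpN_gt0 t0.
pose F (x : R) := x - \sum_(j < k) (1 - expR (- x)) ^+ j.+1 / j.+1%:R.
have FE : F t = (1 - expR (- t)) * log_remainder k t.
  rewrite /F /log_remainder mulrBr mulrCA divff ?gt_eqF// mulr1; congr (_ - _).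
  by rewrite mulr_sumr; apply: eq_bigr => j _; rewrite mulrA exprS.
have cF : {within `[0, t], continuous F}.
  apply: continuous_subspaceT => x; apply: differentiable_continuous.
  by apply/derivable1_diffP; have [] := is_derive_log_partial k x.
have [c] := MVT_segment (ltW t0) (fun x _ => is_derive_log_partial k x) cF.
rewrite in_itv/= => /andP[c0 ct]; rewrite -/(F t) -/(F 0).
have -> : F 0 = 0.
  rewrite /F oppr0 expR0 subrr sub0r big1 ?oppr0// => j _.
  by rewrite expr0n mul0r.
rewrite !subr0 FE => h.
have cy : 0 <= 1 - expR (- c) <= 1 - expR (- t).
  by rewrite onemexpN_ge0// lerD2l lerN2 ler_expR lerN2.
have L : `|log_remainder k t| = (1 - expR (- t))^-1 * ((1 - expR (- c)) ^+ k * t).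
  rewrite -h mulKf ?gt_eqF// ger0_norm// -(pmulr_rge0 _ y0) h.
  by rewrite mulr_ge0 ?(ltW t0)// exprn_ge0//; case/andP: cy.
rewrite L; case: k k0 {F FE cF h L} => // k _.
case/andP: cy => cy0 cyt.
rewrite [leLHS](_ : _ = t * ((1 - expR (- t))^-1 * (1 - expR (- c)) ^+ k.+1)); last by ring.
rewrite [leRHS]exprS ler_wpM2l ?(ltW t0)// ler_pdivrMl//.
apply: (@le_trans _ _ ((1 - expR (- t)) ^+ k.+1)); first by rewrite lerXn2r ?nnegrE// ltW.
rewrite exprS ler_wpM2l ?(ltW y0)// lerXn2r ?nnegrE ?(ltW t0) ?(ltW y0)//.
exact: onemexpN_le.
Qed.

Lemma measurable_log_remainder k : measurable_fun pos (log_remainder k).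
Proof.
have me : measurable_fun pos (fun t : R => 1 - expR (- t)).
  apply: measurable_funB; first exact: measurable_cst.
  apply: measurableT_comp; first exact: measurable_expR.
  exact: measurable_funS (@oppr_measurable R setT).
apply: measurable_funB.
  apply: measurable_funM; first exact: measurable_id.
  have := @measurable_normc _ _ _ pos _ (cmeasurable_zker 1).
  apply: eq_measurable_fun => t /[!inE] /posP t0.
  have -> : (1 - 1 * (expR (- t))%:C)^-1 = ((1 - expR (- t))^-1)%:C by rewrite mul1r rcV rcB.
  by rewrite normc_real ger0_norm// invr_ge0 onemexpN_ge0// ltW.
apply: (@measurable_sum _ _ _ _ _ (index_enum 'I_k)
  (fun j (t : measurableTypeR R) => (1 - expR (- t)) ^+ j / j.+1%:R)) => j.
by apply: measurable_funM; [exact: measurable_funX|exact: measurable_cst].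
Qed.

(** This is the alternating binomial sum of [(-1)^i binom(j, i) (u + i)^(1 - s)]; the sum over [j]
    in [hurwitz] is a partial sum of Hasse's series for the Hurwitz zeta function. *)
Fixpoint cpow_diff j u s : C :=
  if j is j'.+1 then cpow_diff j' u s - cpow_diff j' (u + 1) s else cpow u (1 - s).

Lemma analytic_cpow_diff j u a : analytic_at (cpow_diff j u) a.
Proof.
elim: j u => [|j IH] u /=; last by apply: analyticB; exact: IH.
have -> : (fun s => cpow u (1 - s)) = fun s => cexp (clog u) * cexp (s * - clog u).
  by apply/funext => s; rewrite -cexpD /cpow; congr cexp; ring.
by apply: analyticM; [exact: analytic_cst|exact: analytic_cexp].
Qed.

Lemma ker_onemexpN_integral j s u : 0 < Re s -> 0 < Re u ->
  cintegrable mu pos (fun t => ker s u t * (1 - (expR (- t))%:C) ^+ j) /\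
  cintegral mu pos (fun t => ker s u t * (1 - (expR (- t))%:C) ^+ j) =
    gamma_integral s * cpow_diff j u (s + 1).
Proof.
move=> s0; elim: j u => [|j IH] u u0.
  have -> : (fun t => ker s u t * (1 - (expR (- t))%:C) ^+ 0) = ker s u.
    by apply/funext => t; rewrite expr0 mulr1.
  split; first exact: cintegrable_ker.
  by rewrite ker_integral_scale//=; congr (_ * cpow _ _); ring.
have u10 : 0 < Re (u + 1) by rewrite ReD/= addr_gt0.
have -> : (fun t => ker s u t * (1 - (expR (- t))%:C) ^+ j.+1) =
    fun t => ker s u t * (1 - (expR (- t))%:C) ^+ j - ker s (u + 1) t * (1 - (expR (- t))%:C) ^+ j.
  by apply/funext => t; rewrite -(ker_expn s u 1 t) expr1 exprS; ring.
have [i1 e1] := IH _ u0; have [i2 e2] := IH _ u10.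
by split; [exact: cintegrableB|rewrite (cintegralB mp i1 i2) e1 e2 -mulrBr].
Qed.

Lemma log_remainderC k t : (log_remainder k t)%:C =
  t%:C / (1 - (expR (- t))%:C) - \sum_(j < k) j.+1%:R^-1 * (1 - (expR (- t))%:C) ^+ j.
Proof.
rewrite /log_remainder rcB rcM rcV rcB; congr (_ - _).
elim: k => [|k IH]; first by rewrite !big_ord0.
by rewrite !big_ord_recr/= rcD IH rcM rcV rc_nat rcX rcB mulrC.
Qed.

(** Justifies the prefactor of [hurwitz]: it is [1 / Gamma(s)], in a form that makes sense for
    [- k < Re s]. *)
Lemma gamma_integral_shift s k : 0 < Re s ->
  gamma_integral (s + k%:R) = (\prod_(j < k) (s + j%:R)) * gamma_integral s.
Proof.
move=> s0; elim: k => [|k IH]; first by rewrite big_ord0 mul1r addr0.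
rewrite big_ord_recr/= -[in LHS]addn1 natrD addrA gamma_integral_rec; last exact: Re_addn.
by rewrite IH mulrCA mulrA.
Qed.

Lemma cmeasurable_log_remainder k u :
  cmeasurable pos (fun t => ker (-1) u t * (log_remainder k t)%:C).
Proof.
apply: cmeasurableM; first exact: cmeasurable_ker.
by apply: cmeasurable_real; exact: measurable_log_remainder.
Qed.

(** [ker (-1)] carries [t^-2] and the remainder is at most [t^k], so the integrand is at most
    [t^(p + k - 2)] times a decaying exponential. *)
Lemma integrable_log_remainder k u p : (0 < k)%N -> 0 < Re u -> 1 - k%:R < p ->
  mu.-integrable pos (EFin \o (fun t => expR (p * ln t) * normc (ker (-1) u t * (log_remainder k t)%:C))).
Proof.
move=> k0 u0 kp; have mphi := cmeasurable_log_remainder k u.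
apply: (@le_integrable _ _ _ mu pos mp _ (EFin \o (gker (p - 1 + k%:R) (Re u)))).
- apply/measurable_EFinP; apply: measurable_funM; last exact: measurable_normc.
  apply: measurableT_comp; first exact: measurable_expR.
  apply: measurable_funM; first exact: measurable_cst.
  exact: measurable_funS (@measurable_ln R).
- move=> t /posP t0; rewrite lee_fin.
  rewrite ger0_norm ?mulr_ge0 ?expR_ge0 ?normc_ge0//.
  rewrite ger0_norm ?gker_ge0// normcM normc_ker normc_real.
  have -> : gker (p - 1 + k%:R) (Re u) t = expR (p * ln t) * (gker (Re (-1)) (Re u) t * t ^+ k).
    rewrite -[X in _ * X](_ : gker (Re (-1)) (Re u) t * expR (k%:R * ln t) = _); last first.
      by rewrite mulrC expRM_natl lnK ?posrE// mulrC.
    rewrite /gker -!expRD; congr expR; rewrite ReN -[Re 1]/(1 : R); ring.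
  by rewrite !ler_wpM2l ?expR_ge0 ?gker_ge0// log_remainder_le.
- apply: integrable_gker => //; lra.
Qed.

Lemma cintegrable_log_remainder k u s : (0 < k)%N -> 0 < Re u -> 1 - k%:R < Re s ->
  cintegrable mu pos (fun t => cexp (s * (ln t)%:C) * (ker (-1) u t * (log_remainder k t)%:C)).
Proof.
move=> k0 u0 ks; apply: (cintegrable_dom mp _ _ (integrable_log_remainder k0 u0 ks)).
  have -> : (fun t => cexp (s * (ln t)%:C) * (ker (-1) u t * (log_remainder k t)%:C)) =
      fun t => ker (s - 1) u t * (log_remainder k t)%:C.
    by apply/funext => t; rewrite mulrA /ker -cexpD; congr (cexp _ * _); ring.
  apply: cmeasurableM; first exact: cmeasurable_ker.
  by apply: cmeasurable_real; exact: measurable_log_remainder.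
by move=> t _; rewrite [leLHS]normcM normc_cexp [s * _]mulrC ReMr [ln t * _]mulrC.
Qed.

(* For [1 < Re s], Euler's integral of the series with [t / (1 - e^-t)] split into
   the first [k] terms of its expansion and the remainder; it makes sense for
   [1 - k < Re s]. *)
Definition hurwitz k u s : C :=
  (\sum_(j < k) j.+1%:R^-1 * cpow_diff j u s) / (s - 1) +
  (\prod_(j < k) (s + j%:R)) / gamma_integral (s + k%:R) *
    cintegral mu pos (fun t => cexp (s * (ln t)%:C) * (ker (-1) u t * (log_remainder k t)%:C)).

Lemma analytic_shift (f : C -> C) b a : analytic_at f (a + b) -> analytic_at (fun w => f (w + b)) a.
Proof.
move=> [c [r [r0 H]]]; exists c, r; split => // w wr.
have := H (w + b); rewrite (_ : w + b - (a + b) = w - a); last by ring.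
exact.
Qed.

Lemma analytic_hurwitz k u a : (0 < k)%N -> 0 < Re u -> 1 - k%:R < Re a -> a != 1 ->
  analytic_at (hurwitz k u) a.
Proof.
move=> k0 u0 ka a1.
have ak : 0 < Re (a + k%:R).
  rewrite ReD Re_nat; have : 0 < 1 :> R by []. lra.
apply: analyticD.
  apply: analyticM.
    apply: analytic_sum => j; apply: analyticM; first exact: analytic_cst.
    exact: analytic_cpow_diff.
  apply: analyticV; last by rewrite subr_eq0.
  by apply: analyticB; [exact: analytic_id|exact: analytic_cst].
apply: analyticM.
  apply: analyticM.
    by apply: analytic_prod => j; apply: analyticD; [exact: analytic_id|exact: analytic_cst].
  apply: analyticV; last exact: gamma_integral_neq0.
  by apply: analytic_shift; exact: analytic_gamma_integral.
apply: (analytic_mellin (cmeasurable_log_remainder k u) _ ka) => r kr.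
exact: integrable_log_remainder.
Qed.

(** Here the first [k] terms of the expansion can be integrated back, by [ker_onemexpN_integral] at
    [s - 1]; the denominator [s - 1] comes from [Gamma(s) = (s - 1) Gamma(s - 1)]. *)
Lemma hurwitz_gt1 k u s : 0 < Re u -> 1 < Re s ->
  hurwitz k u s = zintegral (ker s u) 1 / gamma_integral s.
Proof.
move=> u0 s1; have s0 : 0 < Re s by lra.
have sm1 : 0 < Re (s - 1) by rewrite ReB -[Re 1]/(1 : R) subr_gt0.
have G0 := gamma_integral_neq0 s0.
have s1n0 : s - 1 != 0.
  by rewrite -normc_gt0 (lt_le_trans sm1)// (le_trans (ler_norm _))// normc_ge_Re.
have Gs : gamma_integral s = (s - 1) * gamma_integral (s - 1).
  by rewrite -gamma_integral_rec// subrK.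
have iz : cintegrable mu pos (fun t => ker s u t / (1 - 1 * (expR (- t))%:C)).
  apply: (cintegrable_1Bexp (K := 1) s1 u0); first exact: cmeasurable_ker.
  by move=> t t0; rewrite mul1r normc_ker.
have ij j := ker_onemexpN_integral j sm1 u0.
have iS : cintegrable mu pos (fun t => \sum_(j < k) j.+1%:R^-1 * (ker (s - 1) u t * (1 - (expR (- t))%:C) ^+ j)).
  by apply: (cintegrable_sum mp) => j; apply: cintegrableZl => //; case: (ij j).
have E : cintegral mu pos (fun t => cexp (s * (ln t)%:C) * (ker (-1) u t * (log_remainder k t)%:C)) =
    zintegral (ker s u) 1 - gamma_integral (s - 1) * \sum_(j < k) j.+1%:R^-1 * cpow_diff j u s.
  have -> : gamma_integral (s - 1) * \sum_(j < k) j.+1%:R^-1 * cpow_diff j u s =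
      cintegral mu pos (fun t => \sum_(j < k) j.+1%:R^-1 * (ker (s - 1) u t * (1 - (expR (- t))%:C) ^+ j)).
    rewrite (cintegral_sum mp); last by move=> j; apply: cintegrableZl => //; case: (ij j).
    rewrite mulr_sumr; apply: eq_bigr => j _; have [i1 e1] := ij j.
    by rewrite (cintegralZl mp _ i1) e1 subrK mulrCA.
  rewrite -(cintegralB mp iz iS); apply: eq_cintegral => t /posP t0.
  have kE : cexp (s * (ln t)%:C) * ker (-1) u t = ker (s - 1) u t.
    by rewrite /ker -cexpD; congr cexp; ring.
  rewrite log_remainderC mul1r mulrA kE mulrBr; congr (_ - _).
    have kS : ker s u t = t%:C * ker (s - 1) u t by rewrite -kerS// subrK.
    by rewrite kS; ring.
  by rewrite mulr_sumr; apply: eq_bigr => j _; ring.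
rewrite /hurwitz E gamma_integral_shift// Gs.
have P0 : \prod_(j < k) (s + j%:R) != 0.
  apply/prodf_neq0 => j _; have := Re_addn j s0 => h.
  by rewrite -normc_gt0 (lt_le_trans h)// (le_trans (ler_norm _))// normc_ge_Re.
have G1 := gamma_integral_neq0 sm1.
field.
by rewrite P0 s1n0 G1.
Qed.

(** Starting at [2 + i] or [2 - i], on the side of [z], the imaginary part keeps its sign and can
    vanish only at the endpoint [z], which is not 1. *)
Lemma segment_neq1 z : z != 1 -> exists2 b, Re b = 2 &
  forall t, 0 <= t <= 1 -> b + t%:C * (z - b) != 1.
Proof.
move=> z1; pose c : R := if 0 <= Im z then 1 else -1.
have c0 : c != 0 by rewrite /c; case: ifP => _; rewrite ?oner_neq0// oppr_eq0 oner_neq0.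
have cz : 0 <= c * Im z.
  by rewrite /c; case: (leP 0 (Im z)) => [|/ltW] h; rewrite ?mul1r// mulN1r oppr_ge0.
exists (2 +i* c) => // t /andP[t0 t1]; apply/negP => /eqP e.
have : Im (2 +i* c + t%:C * (z - (2 +i* c))) = 0 by rewrite e.
rewrite ImD ImMr ImB /= => h.
have h1 : (1 - t) * c ^+ 2 + t * (c * Im z) = 0.
  have -> : (1 - t) * c ^+ 2 + t * (c * Im z) = c * (c + t * (Im z - c)) by ring.
  by rewrite h mulr0.
have : (1 - t) * c ^+ 2 <= 0 by rewrite -h1 lerDl mulr_ge0.
rewrite pmulr_lle0; last by rewrite exprn_even_gt0.
rewrite subr_le0 => t2; have et : t = 1 by apply/eqP; rewrite eq_le t1.
by move: e; rewrite et mul1r addrC subrK => /eqP; apply/negP.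
Qed.

Lemma Re_ball b w : Re b = 2 -> normc (w - b) < 1 -> 1 < Re w.
Proof.
move=> b2 wb; have := le_lt_trans (normc_ge_Re (w - b)) wb.
by rewrite ReB b2 ltr_norml => /andP[+ _]; lra.
Qed.

(** Both are the same integral for [1 < Re s]. The segment from [b] to [z] avoids 1 and stays in
    both half-planes, so the equality propagates to [z]. *)
Lemma hurwitz_indep k l u z : (0 < k)%N -> (0 < l)%N -> 0 < Re u ->
  1 - k%:R < Re z -> 1 - l%:R < Re z -> z != 1 -> hurwitz k u z = hurwitz l u z.
Proof.
move=> k0 l0 u0 kz lz /segment_neq1[b b2 bz].
have H j t : (0 < j)%N -> 1 - j%:R < Re z -> 0 <= t <= 1 ->
    analytic_at (hurwitz j u) (b + t%:C * (z - b)).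
  move=> j0 jz t01; apply: analytic_hurwitz => //; last exact: bz.
  rewrite ReD ReMr ReB b2; case/andP: t01 => t0 t1.
  have j1 : 1 <= j%:R :> R by rewrite ler1n.
  have [t2|t2] := leP t 2^-1.
    have : t * (1 - j%:R) <= t * Re z by rewrite ler_wpM2l// ltW.
    by nra.
  by nra.
apply: (@analytic_segment_eq _ _ _ b z 1) => // [t|t|w wb]; [exact: H|exact: H|].
have w1 := Re_ball b2 wb.
by rewrite !hurwitz_gt1.
Qed.

Lemma lerch1_hurwitz k u s : (0 < k)%N -> 0 < Re u -> 1 - k%:R < Re s -> s != 1 ->
  lerch 1 s u = hurwitz k u s.
Proof.
move=> k0 u0 ks s1; rewrite /lerch eqxx.
(* The order varies with the point, so that a single function is defined on the whole plane except
   1; by [hurwitz_indep] the choice of order does not affect values. *)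
pose K s := (Num.bound `|1 - Re s|).+1.
have KP w : 1 - (K w)%:R < Re w.
  have := archi_boundP (normr_ge0 (1 - Re w)); have := ler_norm (1 - Re w).
  by rewrite /K -natr1; lra.
have gE j w : (0 < j)%N -> 1 - j%:R < Re w -> w != 1 -> hurwitz (K w) u w = hurwitz j u w.
  by move=> j0 jw w1; apply: hurwitz_indep.
have [b b2 bs] := segment_neq1 s1.
rewrite -(gE k)//.
apply: (@continuation_eq _ _ _ _ (fun s => hurwitz (K s) u s) b s 1) => //.
(* Close enough to [a] the order [K a] remains admissible and the point stays away from 1, so the
   function agrees locally with [hurwitz (K a) u]. *)
- move=> a /eqP a1.
  have e0 : 0 < Num.min (Re a - (1 - (K a)%:R)) (normc (a - 1)).
    by rewrite lt_min subr_gt0 KP normc_gt0 subr_eq0.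
  apply: (eq_analytic_at e0 _ (analytic_hurwitz (ltn0Sn _) u0 (KP a) a1)) => w.
  rewrite lt_min => /andP[h1 h2]; apply/esym; apply: gE => //.
    have := le_lt_trans (normc_ge_Re (w - a)) h1.
    by rewrite ReB ltr_norml -/(K a) => /andP[+ _]; lra.
  by apply: contraTneq h2 => ->; rewrite normc_distC ltxx.
- move=> w [|[_ w1]]; first by rewrite normr1 ltxx.
  rewrite (gE 1%N)//; last 2 first.
  + by rewrite subrr; lra.
  + by apply: contraTneq w1 => ->; rewrite ltxx.
  rewrite hurwitz_gt1//; apply/esym; apply: cvgc_lim.
  have w0 : 0 < Re w by lra.
  have n1 : normc (1 : C) <= 1 by rewrite (normc_nat 1).
  apply: (cvg_lerch_series w0 u0 n1).
  apply: (cintegrable_1Bexp (K := 1) w1 u0); first exact: cmeasurable_ker.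
  by move=> t t0; rewrite mul1r normc_ker.
- by move=> w wb; right; rewrite normr1; split => //; exact: Re_ball wb.
- by move=> t t01; apply/eqP; exact: bs.
Qed.

Lemma lerch1_gt1 u s : 0 < Re u -> 1 < Re s ->
  lerch 1 s u = zintegral (ker s u) 1 / gamma_integral s.
Proof.
move=> u0 s1; rewrite -(hurwitz_gt1 1)//; apply: lerch1_hurwitz => //.
  by rewrite subrr; lra.
by apply: contraTneq s1 => ->; rewrite ltxx.
Qed.

Lemma cintegrable_dker_1Bexp s u v : 0 < Re s -> 0 < Re u -> 0 < Re v ->
  cintegrable mu pos (fun t => dker s v u t / (1 - 1 * (expR (- t))%:C)).
Proof.
move=> s0 u0 v0; pose c := Num.min (Re v) (Re u).
have c0 : 0 < c by rewrite lt_min v0.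
apply: (@cintegrable_1Bexp _ _ (2 * normc (u - v)) (Re s + 1) c) => //.
- by rewrite ltrDr.
- exact: cmeasurable_dker.
by move=> t t0; apply: normc_dker_le => //; rewrite ge_min lexx ?orbT.
Qed.

(** Order 1 suffices: the term kept contributes [Gamma(s - 1)] times a difference of powers, that is
    the integral of [dker (s - 1) v u], and it recombines with the two remainders. *)
Lemma lerch1_sub s u v : 0 < Re s -> s != 1 -> 0 < Re u -> 0 < Re v ->
  Gamma s * (lerch 1 s v - lerch 1 s u) = zintegral (dker s v u) 1.
Proof.
move=> s0 s1 u0 v0; have G0 := gamma_integral_neq0 s0.
have s1n0 : s - 1 != 0 by rewrite subr_eq0.
have Rs1 : -1 < Re (s - 1) by rewrite ReB -[Re 1]/(1 : R); lra.
pose E u := cintegral mu pos (fun t => cexp (s * (ln t)%:C) * (ker (-1) u t * (log_remainder 1 t)%:C)).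
have hE w : 0 < Re w -> gamma_integral s * lerch 1 s w = Gamma (s - 1) * cpow w (1 - s) + E w.
  move=> w0; rewrite (@lerch1_hurwitz 1)// ?subrr// /hurwitz !big_ord1 gamma_integral_rec// addr0.
  have -> : gamma_integral s = (s - 1) * Gamma (s - 1) by rewrite Gamma_gtN1// subrK.
  rewrite /= invr1 mul1r -/(E w); field.
  by rewrite s1n0 Gamma_neq0//= -normc_gt0 (lt_le_trans s0)// (le_trans (ler_norm _))// normc_ge_Re.
rewrite Gamma_pos// mulrBr !hE//.
have E1 := dker_integral Rs1 s1n0 v0 u0.
have -> : Gamma (s - 1) * cpow v (1 - s) + E v - (Gamma (s - 1) * cpow u (1 - s) + E u) =
   cintegral mu pos (dker (s - 1) v u) + (E v - E u).
  by rewrite E1 opprB; ring.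
have iE w : 0 < Re w -> cintegrable mu pos
    (fun t => cexp (s * (ln t)%:C) * (ker (-1) w t * (log_remainder 1 t)%:C)).
  by move=> w0; apply: cintegrable_log_remainder; rewrite ?subrr.
rewrite -(cintegralB mp (iE v v0) (iE u u0)).
rewrite -(cintegralD mp (cintegrable_dker Rs1 v0 u0) (cintegrableB mp (iE v v0) (iE u u0))).
apply: eq_cintegral => t /posP t0; rewrite log_remainderC big_ord1 expr0 invr1 mulr1 mul1r.
have kE w : cexp (s * (ln t)%:C) * (ker (-1) w t * (t%:C / (1 - (expR (- t))%:C) - 1)) =
    ker (s - 1) w t * (t%:C / (1 - (expR (- t))%:C) - 1).
  by rewrite mulrA /ker -cexpD; congr (cexp _ * _); ring.
have kS w : ker s w t = t%:C * ker (s - 1) w t by rewrite -kerS// subrK.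
by rewrite !kE /dker !kS; ring.
Qed.

Lemma analytic_zintegral1_dker (u v a : C) : 0 < Re u -> 0 < Re v -> 0 < Re a ->
  analytic_at (fun s => zintegral (dker s v u) 1) a.
Proof.
move=> u0 v0 a0.
have -> : (fun s => zintegral (dker s v u) 1) = fun s => cintegral mu pos
    (fun t => cexp (s * (ln t)%:C) * (dker 0 v u t / (1 - 1 * (expR (- t))%:C))).
  apply/funext => s; apply: eq_cintegral => t _.
  by rewrite /dker !(ker0E s); ring.
have mphi : cmeasurable pos (fun t => dker 0 v u t / (1 - 1 * (expR (- t))%:C)).
  by apply: cmeasurableM; [exact: cmeasurable_dker|exact: cmeasurable_zker].
apply: (analytic_mellin mphi _ a0) => r r0.
have r0' : 0 < Re r%:C by [].
have -> : (fun t => expR (r * ln t) * normc (dker 0 v u t / (1 - 1 * (expR (- t))%:C))) =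
    fun t => normc (dker r%:C v u t / (1 - 1 * (expR (- t))%:C)).
  apply/funext => t.
  have -> : dker r%:C v u t / (1 - 1 * (expR (- t))%:C) =
      cexp (r%:C * (ln t)%:C) * (dker 0 v u t / (1 - 1 * (expR (- t))%:C)).
    by rewrite /dker !(ker0E r%:C); ring.
  by rewrite [RHS]normcM normc_cexp ReMr.
have := cintegrable_normc mp (cintegrable_dker_1Bexp r0' u0 v0); exact.
Qed.

End Hurwitz.

(** * Lebesgue measure on the unit cube *)

Section ChangeOfVariables.
Context {R : realType}.
Local Notation rT := (measurableTypeR R).
Local Notation mu := (@lebesgue_measure R).
Local Notation pos := (`]0%R, +oo[%classic : set rT).
Local Open Scope ereal_scope.

Import HBNNSimple.

(** Passes from sets to nonnegative functions through simple approximations and monotone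
    convergence. *)
Lemma ge0_integral_density (nu : {measure set rT -> \bar R}) (w : R -> R) :
  measurable_fun [set: rT] w -> (forall t, (0 <= w t)%R) ->
  (forall A, measurable A -> nu A = \int[mu]_(t in A) (w t)%:E) ->
  forall (D : set rT) (f : rT -> \bar R), measurable D -> measurable_fun D f ->
  (forall t, 0 <= f t) -> \int[nu]_(t in D) f t = \int[mu]_(t in D) (f t * (w t)%:E).
Proof.
move=> mw w0 nuE D f mD mf f0.
pose h := nnsfun_approx mD mf.
have mwD : measurable_fun D (EFin \o w) by exact/measurable_EFinP/measurable_funTS.
have -> : \int[nu]_(x in D) f x = limn (fun n => \int[nu]_(x in D) (EFin \o h n) x).
  rewrite -monotone_convergence//.
  - apply: eq_integral => x /[!inE] Dx; apply/esym/cvg_lim => //.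
    exact: cvg_nnsfun_approx.
  - move=> n; apply/measurable_EFinP.
    by apply: (measurable_funS measurableT) => //; exact/measurable_funP.
  - by move=> n x Dx; rewrite lee_fin.
  - by move=> x Dx a b ab; rewrite lee_fin; exact/lefP/nd_nnsfun_approx.
have -> : \int[mu]_(x in D) (f x * (w x)%:E) =
    limn (fun n => \int[mu]_(x in D) ((EFin \o h n) x * (w x)%:E)).
  rewrite -monotone_convergence//.
  - apply: eq_integral => x /[!inE] Dx; apply/esym/cvg_lim => //.
    by apply: cvgeZr => //; exact: cvg_nnsfun_approx.
  - move=> n; apply: emeasurable_funM => //; apply/measurable_EFinP.
    by apply: (measurable_funS measurableT) => //; exact/measurable_funP.
  - by move=> n x Dx; rewrite mule_ge0// lee_fin.
  - move=> x Dx a b ab; rewrite lee_wpmul2r ?lee_fin//.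
    exact/lefP/nd_nnsfun_approx.
congr (limn _); apply/funext => n.
transitivity (\int[nu]_(x in D)
   (\sum_(y \in range (h n)) (y * \1_(h n @^-1` [set y]) x)%:E)).
  by apply: eq_integral => t tE; rewrite /= fimfunE -fsumEFin.
have indich r : measurable_fun D (fun x => (r * \1_(h n @^-1` [set r]) x)%:E).
  by apply: (measurable_comp measurableT) => //; exact: measurable_funM.
rewrite ge0_integral_fsum//; last by move=> m y Ey; exact: nnfun_muleindic_ge0.
transitivity (\int[mu]_(x in D) (\sum_(y \in range (h n))
    (y * \1_(h n @^-1` [set y]) x)%:E * (w x)%:E)); last first.
  apply: eq_integral => x xD.
  rewrite -ge0_mule_fsuml => [|y]; last exact: nnfun_muleindic_ge0.
  by rewrite fsumEFin // -(fimfunE _ x).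
rewrite ge0_integral_fsum//; last 2 first.
- by move=> r; exact: emeasurable_funM.
- by move=> r x Dx; apply: mule_ge0; [exact: nnfun_muleindic_ge0|rewrite lee_fin].
apply: eq_fsbigr => r _.
have [r0|r0] := ltP r 0%R.
  by rewrite !integral0_eq// => x _; rewrite preimage_nnfun0// indic0 mulr0 ?mul0e.
rewrite integralZl_indic_nnsfun// integral_indic//= nuE; last exact: measurableI.
under [RHS]eq_integral do rewrite EFinM -muleA.
rewrite ge0_integralZl//; last first.
- by move=> x _; rewrite mule_ge0 ?lee_fin.
- apply: emeasurable_funM => //; apply/measurable_EFinP.
  by apply: measurable_indic.
congr (_ * _); rewrite setIC integral_mkcondr epatch_indic.
by apply: eq_integral => x _; rewrite /= muleC.
Qed.

Let expN (t : rT) : rT := expR (- t).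

Let measurable_expN : measurable_fun [set: rT] expN.
Proof.
by apply: measurableT_comp; [exact: measurable_expR|exact: oppr_measurable].
Qed.

Let expN_mixin := isMeasurableFun.Build _ _ _ _ _ measurable_expN.
Let expN_pack : {mfun _ >-> _} := HB.pack expN expN_mixin.

(** For [0 < x < 1] the preimage of the ray is [t < - ln x], of probability [1 - x]; every other [x]
    gives probability 0 or 1. *)
Lemma exponential_prob_expN (x : R) :
  exponential_prob 1 (expN @^-1` `]x, +oo[) = mu (`]x, +oo[%classic `&` `[0%R, 1%R]).
Proof.
have [x0|x0] := ltP x 0%R.
  have -> : expN @^-1` `]x, +oo[ = setT.
    by apply/seteqP; split => t // _; rewrite /= in_itv/= andbT (lt_trans x0)// expR_gt0.
  rewrite setIC (_ : _ `&` _ = `[0%R, 1%R]%classic).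
    by rewrite lebesgue_measure_itv/= lte_fin ltr01 oppr0 adde0; apply: integral_exponential_pdf.
  apply/seteqP; split => [t []//|t /= h]; split => //.
  by move: h; rewrite !in_itv/= andbT => /andP[h _]; exact: lt_le_trans h.
have [x1|x1] := leP 1%R x.
  rewrite (_ : _ `&` _ = set0) ?measure0.
    rewrite /exponential_prob integral0_eq// => t /=; rewrite in_itv/= andbT => xt.
    rewrite lt0_exponential_pdf// -oppr_gt0 -ltr_expR expR0; exact: le_lt_trans xt.
  apply/seteqP; split => // t []/=; rewrite !in_itv/= andbT => xt /andP[_ t1].
  by have := lt_le_trans (le_lt_trans x1 xt) t1; rewrite ltxx.
have -> : `]x, +oo[%classic `&` `[0%R, 1%R] = `]x, 1%R]%classic.
  apply/seteqP; split => t /=; rewrite !in_itv/= andbT.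
    by move=> [-> /andP[]].
  by move=> /andP[xt ->]; split => //; rewrite (le_trans x0)// ltW.
rewrite lebesgue_measure_itv/= lte_fin x1.
have [->|xn0] := eqVneq x 0%R.
  have -> : expN @^-1` `]0%R, +oo[ = setT.
    by apply/seteqP; split => t // _; rewrite /= in_itv/= andbT expR_gt0.
  by rewrite oppr0 adde0; apply: integral_exponential_pdf.
have {xn0}x0 : (0 < x)%R by rewrite lt_neqAle eq_sym xn0.
have -> : expN @^-1` `]x, +oo[ = `]-oo, (- ln x)%R[%classic.
  have xE t : (x < expN t)%R = (t < - ln x)%R by rewrite -{1}(lnK x0) ltr_expR ltrNr.
  by apply/seteqP; split => t /=; rewrite !in_itv/= andbT xE.
have lx : (0 < - ln x)%R by rewrite oppr_gt0 ln_lt0// x0.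
have e0c := @exponential_prob_itv0c R 1 _ lx.
rewrite mulN1r opprK lnK// in e0c.
rewrite -[RHS]e0c /exponential_prob -integral_itv_bndo_bndc; last first.
  apply/measurable_EFinP; apply: measurable_funTS.
  exact: measurable_exponential_pdf.
rewrite integral_mkcond [RHS]integral_mkcond; apply: eq_integral => t _.
rewrite !patchE.
have [t0|t0] := leP 0%R t.
  by congr (if _ then _ else _); apply/idP/idP; rewrite !inE/= !in_itv/= t0.
by rewrite lt0_exponential_pdf//; case: ifP; case: ifP.
Qed.

(** Lebesgue measure on the unit interval is the image of the exponential law under [expN]: the two
    agree on the rays []x, +oo[], which are stable under intersection and generate the Borel
    sets. *)
Lemma ge0_integral_unit_expN (f : rT -> \bar R) : measurable_fun setT f ->
  (forall x, 0 <= f x) ->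
  \int[mu]_(a in `[0%R, 1%R]) f a = \int[mu]_(t in pos) (f (expR (- t)) * (expR (- t))%:E).
Proof.
move=> mf f0.
have m01 : measurable (`[0%R, 1%R]%classic : set rT) by exact: measurable_itv.
have E (A : set rT) : measurable A -> mu (A `&` `[0%R, 1%R]) = exponential_prob 1 (expN @^-1` A).
  move=> mA; rewrite -[LHS]/(mrestr mu m01 A) -[RHS]/(pushforward (exponential_prob 1) expN_pack A).
  refine (@measure_unique _ _ rT (@RGenOInfty.G R) (fun n => `](- n%:R)%R, +oo[%classic) _ _ _ _
    (mrestr mu m01) (pushforward (exponential_prob 1) expN_pack) _ _ A mA).
  - exact: RGenOInfty.measurableE.
  - move=> _ _ [x ->] [y ->]; exists (Num.max x y).
    by apply/seteqP; split => t /=; rewrite !in_itv/= !andbT gt_max => /andP.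
  - by move=> n; exists (- n%:R)%R.
  - apply/seteqP; split => // t _; exists (Num.bound `|t|) => //=.
    rewrite in_itv/= andbT ltrNl (le_lt_trans _ (archi_boundP (normr_ge0 t)))//.
    by rewrite -normrN ler_norm.
  - by move=> _ [x ->]; rewrite [RHS]exponential_prob_expN.
  - move=> n; apply: (@le_lt_trans _ _ (mu `[0%R, 1%R])).
      by apply: le_measure; rewrite ?inE//; exact: measurableI.
    by rewrite lebesgue_measure_itv/= lte_fin ltr01 -EFinD ltry.
rewrite (eq_measure_integral (pushforward (exponential_prob 1) expN_pack)); last first.
  move=> A mA A01; rewrite -[RHS]/(exponential_prob 1 (expN @^-1` A)) -E//.
  by rewrite (setIidl A01).
have mfe : measurable_fun setT (fun t : rT => f (expN t)) by exact: measurableT_comp.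
have -> : \int[pushforward (exponential_prob 1) expN_pack]_(x in `[0%R, 1%R]) f x =
    \int[exponential_prob 1]_(t in `[0%R, +oo[) f (expN t).
  rewrite (ge0_integral_pushforward measurable_expN)//=; last exact: measurable_funTS.
  congr (integral _ _ _); apply/seteqP; split => t /=; rewrite !in_itv/= expR_ge0/= andbT.
    by rewrite -expR0 ler_expR oppr_le0.
  by rewrite -expR0 ler_expR oppr_le0.
rewrite (@ge0_integral_density _ (exponential_pdf 1)) => //; last 3 first.
- exact: measurable_exponential_pdf.
- by move=> t; exact: exponential_pdf_ge0.
- exact: measurable_funTS.
rewrite -integral_itv_obnd_cbnd; last first.
  apply: emeasurable_funM; first exact: measurable_funTS.
  by apply/measurable_EFinP/measurable_funTS; exact: measurable_exponential_pdf.
apply: eq_integral => t /[!inE] /= /[!in_itv]/= /[!andbT] t0.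
by rewrite exponential_pdfE ?ltW// mul1r mulN1r.
Unshelve. all: by [].
Qed.

Section Shift.
Variable a : R.

Let measurable_shift : measurable_fun [set: rT] (fun b : rT => (a + b)%R : rT).
Proof. by apply: measurable_funD; [exact: measurable_cst|exact: measurable_id]. Qed.

Let shift_mixin := isMeasurableFun.Build _ _ _ _ _ measurable_shift.
Let shift_pack : {mfun rT >-> rT} := HB.pack (fun b : rT => (a + b)%R : rT) shift_mixin.

Lemma lebesgue_measure_shift (A : set rT) : measurable A ->
  pushforward mu shift_pack A = mu A.
Proof.
move=> mA; apply/esym/lebesgue_measure_unique => //= _ [[x y]] _ <-.
rewrite /pushforward (_ : _ @^-1` _ = `](x - a)%R, (y - a)%R]%classic); last first.
  by apply/seteqP; split => t /=; rewrite !in_itv/= ltrBlDl lerBrDl.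
by rewrite !lebesgue_measure_itv/= !lte_fin ltrD2r; case: ifP => // _;
  rewrite -!EFinB opprB addrA subrK.
Qed.

Lemma ge0_integral_shift (f : rT -> \bar R) : measurable_fun setT f ->
  (forall x, 0 <= f x) -> (0 <= a)%R ->
  \int[mu]_(b in pos) f (a + b)%R = \int[mu]_(t in pos) (f t * (a < t)%R%:R%:E).
Proof.
move=> mf f0 a0.
transitivity (\int[mu]_(t in `]a, +oo[) f t).
  rewrite [RHS](eq_measure_integral (pushforward mu shift_pack)); last first.
    by move=> A mA _; apply/esym; exact: lebesgue_measure_shift.
  rewrite ge0_integral_pushforward//=; last exact: measurable_funTS.
  congr (integral _ _ _); apply/seteqP; split => t /=; rewrite !in_itv/= !andbT.
    by rewrite ltrDl.
  by rewrite ltrDl.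
rewrite (_ : `]a, +oo[%classic = pos `&` `]a, +oo[); last first.
  apply/seteqP; split => t /=; rewrite !in_itv/= !andbT; last by case.
  by move=> h; split => //; exact: le_lt_trans h.
rewrite integral_mkcondr epatch_indic; apply: eq_integral => t _ /=.
by rewrite indicE mem_setE in_itv/= andbT.
Qed.

End Shift.

Lemma measurable_EFin_ltr : measurable_fun setT (fun z : rT * rT => (z.1 < z.2)%R%:R%:E : \bar R).
Proof.
apply/measurable_EFinP.
have -> : (fun z : rT * rT => (z.1 < z.2)%R%:R : R) = fun z => if (z.1 < z.2)%R then 1%R else 0%R.
  by apply/funext => z; case: ltP.
apply: measurable_fun_ifT; [|exact: measurable_cst|exact: measurable_cst].
exact: measurable_fun_ltr.
Qed.

End ChangeOfVariables.

(** * Tonelli on rectangles and convolution of divided powers *)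

Section IteratedPatch.
Context {R : realType} d1 d2 (T1 : measurableType d1) (T2 : measurableType d2).
Variables (m1 : {measure set T1 -> \bar R}) (m2 : {measure set T2 -> \bar R}).
Variables (D1 : set T1) (D2 : set T2) (f : T1 * T2 -> \bar R).
Local Open Scope ereal_scope.

Lemma iterated_integral_patch : \int[m1]_x (\int[m2]_y (f \_ (D1 `*` D2)) (x, y)) =
  \int[m1]_(x in D1) \int[m2]_(y in D2) f (x, y).
Proof.
rewrite [RHS]integral_mkcond; apply: eq_integral => x _; rewrite patchE.
case: ifPn => xD.
  rewrite [RHS]integral_mkcond; apply: eq_integral => y _.
  by rewrite !patchE in_setX xD.
by rewrite integral0_eq// => y _; rewrite patchE in_setX (negbTE xD).
Qed.

End IteratedPatch.

Section TonelliDomain.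
Context {R : realType} d1 d2 (T1 : measurableType d1) (T2 : measurableType d2).
Variables (m1 : {sigma_finite_measure set T1 -> \bar R}) (m2 : {sigma_finite_measure set T2 -> \bar R}).
Variables (D1 : set T1) (D2 : set T2) (mD1 : measurable D1) (mD2 : measurable D2).
Variable f : T1 * T2 -> \bar R.
Local Open Scope ereal_scope.
Hypotheses (mf : measurable_fun setT f) (f0 : forall z, 0 <= f z).

Let mD : measurable (D1 `*` D2). Proof. exact: measurableX. Qed.
Let fD := f \_ (D1 `*` D2).
Let fD0 z : 0 <= fD z. Proof. by rewrite /fD patchE; case: ifP. Qed.
Let mfD : measurable_fun setT fD.
Proof. by apply/(measurable_restrictT _ mD); exact: measurable_funTS. Qed.

Let fDE2 : \int[m2]_y (\int[m1]_x fD (x, y)) = \int[m2]_(y in D2) \int[m1]_(x in D1) f (x, y).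
Proof.
rewrite [RHS]integral_mkcond; apply: eq_integral => y _; rewrite patchE.
case: ifPn => [yD|yD].
  rewrite [RHS]integral_mkcond; apply: eq_integral => x _.
  by rewrite /fD !patchE in_setX yD andbT.
by rewrite integral0_eq// => x _; rewrite /fD patchE in_setX (negbTE yD) andbF.
Qed.

Lemma tonelli_product : \int[m1 \x m2]_(z in D1 `*` D2) f z =
  \int[m1]_(x in D1) \int[m2]_(y in D2) f (x, y).
Proof. rewrite integral_mkcond -iterated_integral_patch; exact: fubini_tonelli1. Qed.

Lemma tonelli_swap : \int[m1]_(x in D1) \int[m2]_(y in D2) f (x, y) =
  \int[m2]_(y in D2) \int[m1]_(x in D1) f (x, y).
Proof. by rewrite -(iterated_integral_patch m1 m2) -fDE2; exact: fubini_tonelli. Qed.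

Lemma measurable_partial_integral : measurable_fun setT (fun x => \int[m2]_(y in D2) f (x, y)).
Proof.
pose g := f \_ (setT `*` D2).
have mT : measurable (setT `*` D2 : set (T1 * T2)) by exact: measurableX.
have -> : (fun x => \int[m2]_(y in D2) f (x, y)) = fun x => \int[m2]_y g (x, y).
  apply/funext => x; rewrite integral_mkcond; apply: eq_integral => y _.
  by rewrite /g !patchE in_setX in_setT.
apply: measurable_fun_fubini_tonelli_F; last by move=> z; rewrite /g patchE; case: ifP.
by apply/(measurable_restrictT _ mT); exact: measurable_funTS.
Qed.

End TonelliDomain.

Section Convolution.
Context {R : realType}.
Local Notation rT := (measurableTypeR R).
Local Notation mu := (@lebesgue_measure R).
Local Notation pos := (`]0%R, +oo[%classic : set rT).
Let mp : measurable pos := measurable_itv _.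

(* The absolute value makes the weight nonnegative on the whole line. *)
Definition divpow n (t : R) : R := `|t| ^+ n / n`!%:R.

Lemma divpow_ge0 n t : 0 <= divpow n t.
Proof. by rewrite divr_ge0// exprn_ge0. Qed.

Lemma measurable_divpow n : measurable_fun [set: rT] (divpow n).
Proof.
apply: measurable_funM; last exact: measurable_cst.
by apply: measurable_funX; exact: normr_measurable.
Qed.

Lemma integral_truncated (F f : R -> R) (x : R) : 0 < x ->
  (forall t : R, is_derive t 1 F (f t)) -> continuous f ->
  mu.-integrable pos (fun t => (f t * (t < x)%R%:R)%:E) /\
  (\int[mu]_(t in pos) (f t * (t < x)%R%:R)%:E = (F x - F 0)%:E)%E.
Proof.
move=> x0 dF cf.
have cF : continuous F.
  by move=> t; apply: differentiable_continuous; apply/derivable1_diffP; have [] := dF t.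
have mf : measurable_fun setT (f : rT -> rT) by exact: continuous_measurable_fun.
have mfE D : measurable_fun D (EFin \o f : rT -> \bar R).
  by apply/measurable_EFinP; exact: measurable_funTS.
have E t : (f t * (t < x)%R%:R)%:E = ((EFin \o f) \_ `]-oo, x[) t.
  by rewrite epatch_indic /= indicE mem_setE in_itv EFinM.
have D : pos `&` `]-oo, x[ = `]0, x[%classic.
  by apply/seteqP; split => t /=; rewrite !in_itv/= andbT; [move=> [-> ->]|move=> /andP[]].
have mx : measurable (`]-oo, x[%classic : set rT) by exact: measurable_itv.
split.
  have -> : (fun t => (f t * (t < x)%R%:R)%:E) = (EFin \o f) \_ `]-oo, x[ by exact/funext.
  apply/(integrable_mkcond _ mp); rewrite -patch_setI.
  apply: (integrable_mkcond _ (measurableI _ _ mp mx)).1; rewrite D.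
  have i0x : mu.-integrable `[0, x] (EFin \o f).
    apply: continuous_compact_integrable; first exact: segment_compact.
    exact: continuous_subspaceT.
  apply: integrableS i0x => // t /=; rewrite !in_itv/= => /andP[t0 tx].
  by rewrite !ltW.
under eq_integral do rewrite E.
rewrite -integral_mkcondr D integral_itv_obnd_cbnd ?integral_itv_bndo_bndc; try exact: mfE.
rewrite (@continuous_FTC2 _ _ F) => //.
- exact: continuous_subspaceT.
- split.
  + by move=> t _; have [] := dF t.
  + by apply: cvg_at_right_filter; exact: cF.
  + by apply: cvg_at_left_filter; exact: cF.
- by move=> t _; rewrite derive1E; have [_ ->] := dF t.
Qed.

Lemma integral_divpow n (x : R) : 0 < x ->
  (\int[mu]_(t in pos) ((divpow n t)%:E * (t < x)%R%:R%:E) = (divpow n.+1 x)%:E)%E.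
Proof.
move=> x0; pose p k (t : R) := t ^+ k / k`!%:R.
have dp k (t : R) : is_derive t 1 (p k.+1) (p k t).
  have d := is_deriveX k.+1 (is_derive_id t 1).
  apply: (is_derive_congr (is_deriveZ k.+1`!%:R^-1 d)).
    by move=> y; rewrite /p mulrC exprfctE.
  rewrite /p -[LHS]/(_ * (_ * _)) /= factS natrM; field.
  by rewrite nat1r !pnatr_eq0 -lt0n fact_gt0.
have cp k : continuous (p k).
  case: k => [|k] t.
    have -> : p 0%N = cst 1 by apply/funext => y; rewrite /p expr0 invr1 mulr1.
    exact: cvg_cst.
  by apply: differentiable_continuous; apply/derivable1_diffP; have [] := dp k t.
have [_ h] := integral_truncated x0 (dp n) (cp n).
transitivity (p n.+1 x - p n.+1 0)%:E.
  by rewrite -h; apply: eq_integral => t /[!inE] /posP t0; rewrite /divpow gtr0_norm.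
by rewrite {2}/p expr0n mul0r subr0 /p /divpow gtr0_norm.
Qed.

(** After the shift [t = c + a], the variable [a] occurs only in the weight and in the constraint
    [a < t]. Exchanging the integrals leaves the integral of [divpow n] over []0, t[], which is
    [divpow n.+1 t]. *)
Lemma ge0_integral_convolution (psi : rT -> \bar R) n : measurable_fun setT psi ->
  (forall x, 0 <= psi x)%E ->
  (\int[mu]_(c in pos) \int[mu]_(a in pos) (psi (c + a)%R * (divpow n a)%:E) =
   \int[mu]_(x in pos) (psi x * (divpow n.+1 x)%:E))%E.
Proof.
move=> mpsi psi0.
have mw : measurable_fun setT (fun a : rT => (divpow n a)%:E).
  by apply/measurable_EFinP; exact: measurable_divpow.
have mw1 : measurable_fun setT (fun z : rT * rT => (divpow n z.1)%:E).
  by have := measurableT_comp mw (@measurable_fst _ _ rT rT); exact.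
have mw2 : measurable_fun setT (fun z : rT * rT => (divpow n z.2)%:E).
  by have := measurableT_comp mw (@measurable_snd _ _ rT rT); exact.
have w0 a : (0 <= (divpow n a)%:E)%E by rewrite lee_fin divpow_ge0.
rewrite (@tonelli_swap _ _ _ _ _ mu mu pos pos mp mp (fun z => psi (z.1 + z.2)%R * (divpow n z.2)%:E)%E) /=; last 2 first.
- apply: emeasurable_funM; last exact: mw2.
  apply: measurableT_comp => //.
  by apply: measurable_funD.
- by move=> z; rewrite mule_ge0.
have ml1 a : measurable_fun [set: rT] (fun t => (a < t)%R%:R%:E : \bar R).
  have h : measurable_fun [set: rT] (fun t : rT => (a : rT, t)).
    by apply: measurable_fun_pair; [exact: measurable_cst|exact: measurable_id].
  have := measurableT_comp (@measurable_EFin_ltr R) h; exact.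
have ml2 t : measurable_fun [set: rT] (fun a => (a < t)%R%:R%:E : \bar R).
  have h : measurable_fun [set: rT] (fun a : rT => (a, t : rT)).
    by apply: measurable_fun_pair; [exact: measurable_id|exact: measurable_cst].
  have := measurableT_comp (@measurable_EFin_ltr R) h; exact.
transitivity (\int[mu]_(a in pos) \int[mu]_(t in pos) (psi t * (a < t)%R%:R%:E * (divpow n a)%:E))%E.
  apply: eq_integral => a /[!inE] /posP a0.
  rewrite [RHS]ge0_integralZr//; last 2 first.
  - by apply: measurable_funTS; exact: emeasurable_funM.
  - by move=> t _; rewrite mule_ge0// lee_fin ler0n.
  rewrite -ge0_integral_shift ?(ltW a0)// -ge0_integralZr//.
  - by apply: eq_integral => t _; rewrite addrC.
  - apply: measurable_funTS; apply: measurableT_comp => //.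
    by apply: measurable_funD; [exact: measurable_cst|exact: measurable_id].
rewrite (@tonelli_swap _ _ _ _ _ mu mu pos pos mp mp (fun z => psi z.2 * (z.1 < z.2)%R%:R%:E * (divpow n z.1)%:E)%E) /=; last 2 first.
- apply: emeasurable_funM; last exact: mw1.
  by apply: emeasurable_funM; [exact: measurableT_comp|exact: measurable_EFin_ltr].
- by move=> z; rewrite !mule_ge0// lee_fin ler0n.
apply: eq_integral => t tp; rewrite -integral_divpow; last first.
  by move: tp; rewrite inE => /posP.
rewrite -ge0_integralZl//.
- by apply: eq_integral => a _; rewrite -muleA [((divpow n a)%:E * _)%E]muleC.
- by apply: measurable_funTS; exact: emeasurable_funM.
- by move=> a _; rewrite mule_ge0// lee_fin ler0n.
Qed.

End Convolution.

(** * Laws of the partial products of the coordinates *)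

Section CubeLaws.
Context {R : realType}.
Local Notation rT := (measurableTypeR R).
Local Notation mu := (@lebesgue_measure R).
Local Notation pos := (`]0%R, +oo[%classic : set rT).
Let mp : measurable pos := measurable_itv _.
Local Open Scope ereal_scope.

Lemma measurable_unit_cube n : measurable (@unit_cube R n).
Proof.
rewrite (_ : @unit_cube R n = \bigcap_(i in [set: 'I_n])
    ((fun x : n.-tuple rT => tnth x i) @^-1` `[0%R, 1%R])).
  apply: fin_bigcap_measurable; first exact: finite_finset.
  by move=> i _; rewrite -[X in measurable X]setTI; exact: measurable_tnth.
by apply/seteqP; split => [x /= h i _|x /= h i]; [rewrite /= in_itv/=; exact: h|have := h i I; rewrite /= in_itv].
Qed.

Lemma prod_all_cons n (a : rT) (y : n.-tuple rT) :
  prod_all (tuple_cons (a, y)) = (a * prod_all y)%R.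
Proof.
rewrite /prod_all big_ord_recl; congr (_ * _)%R.
by apply: eq_bigr => i _; rewrite tnthS.
Qed.

Lemma prod_first0 n (y : n.-tuple rT) : prod_first 0 y = 1%R.
Proof. by rewrite /prod_first big_pred0. Qed.

Lemma prod_first_cons n j (a : rT) (y : n.-tuple rT) :
  prod_first j.+1 (tuple_cons (a, y)) = (a * prod_first j y)%R.
Proof.
rewrite /prod_first big_mkcond big_ord_recl; congr (_ * _)%R.
by rewrite [RHS]big_mkcond; apply: eq_bigr => i _; rewrite tnthS.
Qed.

Lemma measurable_prod_all n : measurable_fun setT (@prod_all R n : _ -> rT).
Proof. by apply: measurable_prod => i _; exact: measurable_tnth. Qed.

Lemma measurable_prod_first n j : measurable_fun setT (@prod_first R n j : _ -> rT).
Proof.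
have -> : @prod_first R n j = fun x => (\prod_(i < n) (if (i < j)%N then tnth x i else 1))%R.
  by apply/funext => x; rewrite /prod_first big_mkcond.
apply: measurable_prod => i _; case: (i < j)%N; last exact: measurable_cst.
exact: measurable_tnth.
Qed.

Lemma ge0_integral_unit_cube n (f : n.+1.-tuple rT -> \bar R) :
  measurable_fun setT f -> (forall x, 0 <= f x) ->
  \int[lebesgue_tuple n.+1]_(x in @unit_cube R n.+1) f x =
  \int[mu]_(a in `[0%R, 1%R]) \int[lebesgue_tuple n]_(y in @unit_cube R n) f (tuple_cons (a, y)).
Proof.
move=> mf f0.
have m01 : measurable (`[0%R, 1%R]%classic : set rT) by exact: measurable_itv.
have mc := @measurable_tuple_cons R n.
have mcube := @measurable_unit_cube.
rewrite -(@tonelli_product _ _ _ _ _ mu (lebesgue_tuple n) _ _ m01 (mcube n) (fun z => f (tuple_cons z))); last 2 first.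
- exact: measurableT_comp.
- by move=> z; exact: f0.
have pre : (@tuple_cons R n) @^-1` (@unit_cube R n.+1) = `[0%R, 1%R] `*` @unit_cube R n.
  apply/seteqP; split => -[a y] /=; rewrite in_itv/=.
    by move=> h; split=> [|i]; [exact: (h ord0)|have := h (lift ord0 i); rewrite tnthS].
  by move=> [h0 h] i; case: (unliftP ord0 i) => [j ->|->//]; rewrite tnthS; exact: h.
rewrite -pre; apply: etrans (ge0_integral_pushforward mc (mu \x lebesgue_tuple n)
  (mcube n.+1) (measurable_funTS mf) (fun x _ => f0 x)).
exact: eq_measure_integral.
Qed.

(* Density of [- ln] of the product of [n + 1] independent uniform variables. *)
Definition gammaw n (t : rT) : R := (expR (- t) * divpow n t)%R.

Lemma gammaw_ge0 n t : (0 <= gammaw n t)%R. Proof. by rewrite mulr_ge0 ?expR_ge0 ?divpow_ge0. Qed.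
#[local] Hint Resolve gammaw_ge0 : core.

Lemma measurable_expRN : measurable_fun setT (fun t : rT => expR (- t) : rT).
Proof.
by apply: measurableT_comp; [exact: measurable_expR|exact: oppr_measurable].
Qed.
#[local] Hint Resolve measurable_expRN : core.

Lemma measurable_gammaw n : measurable_fun setT (fun t : rT => (gammaw n t)%:E).
Proof. by apply/measurable_EFinP; apply: measurable_funM => //; exact: measurable_divpow. Qed.
#[local] Hint Resolve measurable_gammaw : core.

(** A further coordinate adds an independent exponential variable to [- ln] of the product, and the
    convolution raises the degree of [divpow] by one. *)
Lemma ge0_integral_prod_all n (f : rT -> \bar R) : measurable_fun setT f ->
  (forall x, 0 <= f x) ->
  \int[lebesgue_tuple n.+1]_(x in @unit_cube R n.+1) f (prod_all x) =
  \int[mu]_(t in pos) (f (expR (- t)) * (gammaw n t)%:E).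
Proof.
elim: n f => [|n IH] f mf f0.
  rewrite ge0_integral_unit_cube//; last first.
    by apply: (measurableT_comp mf); exact: measurable_prod_all.
  transitivity (\int[mu]_(a in `[0%R, 1%R]) f a).
    apply: eq_integral => a _ /=; rewrite integral_dirac//=; last 2 first.
    - exact: measurable_unit_cube.
    - apply: measurable_funTS; apply: (measurableT_comp mf).
      apply: (measurableT_comp (@measurable_prod_all _)).
      by have := measurableT_comp (@measurable_tuple_cons R 0%N) (pair1_measurable a); exact.
    rewrite diracE mem_set ?mul1e; last by case.
    by rewrite prod_all_cons /prod_all big_ord0 mulr1.
  rewrite ge0_integral_unit_expN//; apply: eq_integral => t _.
  by rewrite /gammaw /divpow expr0 fact0 divr1 mulr1.
rewrite ge0_integral_unit_cube//; last first.
  by apply: (measurableT_comp mf); exact: measurable_prod_all.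
transitivity (\int[mu]_(a in `[0%R, 1%R]) \int[mu]_(t in pos) (f (a * expR (- t))%R * (gammaw n t)%:E)).
  apply: eq_integral => a _.
  under eq_integral do rewrite prod_all_cons.
  apply: (IH (fun x => f (a * x)%R)) => //.
  exact: measurableT_comp.
have mh : measurable_fun setT (fun z : rT * rT => f (z.1 * expR (- z.2))%R * (gammaw n z.2)%:E).
  have me2 : measurable_fun setT (fun z : rT * rT => expR (- z.2) : rT).
    by have := measurableT_comp measurable_expRN (@measurable_snd _ _ rT rT); exact.
  apply: emeasurable_funM; last first.
    by have := measurableT_comp (measurable_gammaw n) (@measurable_snd _ _ rT rT); exact.
  by apply: measurableT_comp => //; apply: measurable_funM.
rewrite ge0_integral_unit_expN; last 2 first.
- have h0 (z : rT * rT) : 0 <= f (z.1 * expR (- z.2))%R * (gammaw n z.2)%:E.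
    by rewrite mule_ge0// lee_fin.
  by have := measurable_partial_integral mu mp mh h0; exact.
- by move=> a; apply: integral_ge0 => t _; rewrite mule_ge0// lee_fin.
(* Both exponential factors together depend only on [c + a]; they go into [psi], and only the
   polynomial weight is convolved. *)
pose psi (t : rT) := f (expR (- t)) * (expR (- t))%:E.
transitivity (\int[mu]_(c in pos) \int[mu]_(a in pos) (psi (c + a)%R * (divpow n a)%:E)).
  apply: eq_integral => c _; rewrite -ge0_integralZr//; last 2 first.
  - by apply: measurable_funTS; have := measurableT_comp mh (pair1_measurable (expR (- c))); exact.
  - by move=> t _; rewrite mule_ge0// lee_fin.
  apply: eq_integral => t _; rewrite /psi opprD expRD /gammaw -!muleA -!EFinM; congr (_ * _%:E); ring.
rewrite ge0_integral_convolution//.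
- by apply: eq_integral => t _; rewrite /psi -muleA.
- apply: emeasurable_funM; first exact: measurableT_comp.
  exact/measurable_EFinP.
- by move=> t; rewrite /psi mule_ge0// lee_fin expR_ge0.
Qed.

Lemma measurable_expRN1 : measurable_fun setT (fun z : rT * rT => expR (- z.1) : rT).
Proof. by have := measurableT_comp measurable_expRN (@measurable_fst _ _ rT rT); exact. Qed.
#[local] Hint Resolve measurable_expRN1 : core.

Lemma measurable_expRN2 : measurable_fun setT (fun z : rT * rT => expR (- z.2) : rT).
Proof. by have := measurableT_comp measurable_expRN (@measurable_snd _ _ rT rT); exact. Qed.
#[local] Hint Resolve measurable_expRN2 : core.

Lemma measurable_expRND : measurable_fun setT (fun z : rT * rT => expR (- (z.1 + z.2)) : rT).
Proof.
have h : measurable_fun setT (fun z : rT * rT => (z.1 + z.2)%R : rT) by apply: measurable_funD.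
by have := measurableT_comp measurable_expRN h; exact.
Qed.
#[local] Hint Resolve measurable_expRND : core.

(* Joint density of [- ln] of the products of [j + 1] and of [k + 1] independent
   uniform variables. *)
Definition gammaw2 j k (z : rT * rT) : R := (expR (- (z.1 + z.2)) * (divpow j z.1 * divpow k z.2))%R.

Lemma gammaw2_ge0 j k z : 0 <= (gammaw2 j k z)%:E.
Proof. by rewrite lee_fin !mulr_ge0 ?expR_ge0 ?divpow_ge0. Qed.
#[local] Hint Resolve gammaw2_ge0 : core.

Lemma measurable_gammaw2 j k : measurable_fun setT (fun z => (gammaw2 j k z)%:E).
Proof.
apply/measurable_EFinP; apply: measurable_funM; first exact: measurable_expRND.
apply: measurable_funM.
- by have := measurableT_comp (@measurable_divpow R j) (@measurable_fst _ _ rT rT); exact.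
- by have := measurableT_comp (@measurable_divpow R k) (@measurable_snd _ _ rT rT); exact.
Qed.
#[local] Hint Resolve measurable_gammaw2 : core.

(** Here [a] belongs to the first [j + 1] coordinates and [b] to the last [k + 1]. Peeling off the
    first coordinate lowers [j]; [b] is integrated last so that the convolution acts on the inner
    variable. *)
Lemma ge0_integral_prod_first j k (g : rT * rT -> \bar R) : measurable_fun setT g ->
  (forall z, 0 <= g z) ->
  \int[lebesgue_tuple (j + k).+2]_(x in @unit_cube R (j + k).+2)
    g (prod_first j.+1 x, prod_all x) =
  \int[mu]_(b in pos) \int[mu]_(a in pos)
    (g (expR (- a), expR (- (a + b))) * (gammaw2 j k (a, b))%:E).
Proof.
elim: j g => [|j IH] g mg g0.
  have mpp : measurable_fun setT (fun x : (0 + k).+2.-tuple rT => g (prod_first 1 x, prod_all x)).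
    apply: (measurableT_comp mg); apply: measurable_fun_pair.
      exact: measurable_prod_first.
    exact: measurable_prod_all.
  rewrite ge0_integral_unit_cube//.
  have mz : measurable_fun setT (fun z : rT * rT => g (z.1, z.1 * expR (- z.2))%R * (gammaw k z.2)%:E).
    apply: emeasurable_funM; last first.
      by have := measurableT_comp (measurable_gammaw k) (@measurable_snd _ _ rT rT); exact.
    apply: (measurableT_comp mg); apply: measurable_fun_pair => //.
    exact: measurable_funM.
  have z0 (z : rT * rT) : 0 <= g (z.1, z.1 * expR (- z.2))%R * (gammaw k z.2)%:E.
    by rewrite mule_ge0// lee_fin.
  transitivity (\int[mu]_(a in `[0%R, 1%R]) \int[mu]_(t in pos) (g (a, a * expR (- t))%R * (gammaw k t)%:E)).
    apply: eq_integral => a _.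
    under eq_integral do rewrite prod_all_cons prod_first_cons prod_first0 mulr1.
    apply: (@ge0_integral_prod_all k (fun x => g (a, a * x)%R)) => //.
    apply: (measurableT_comp mg); apply: measurable_fun_pair; first exact: measurable_cst.
    by apply: measurable_funM; [exact: measurable_cst|exact: measurable_id].
  rewrite ge0_integral_unit_expN; last 2 first.
  - by have := measurable_partial_integral mu mp mz z0; exact.
  - by move=> a; apply: integral_ge0 => t _; exact: (z0 (a, t)).
  transitivity (\int[mu]_(c in pos) \int[mu]_(t in pos)
      (g (expR (- c), expR (- (c + t)))%R * (gammaw2 0 k (c, t))%:E)).
    apply: eq_integral => c _; rewrite -ge0_integralZr//; last 2 first.
    - by apply: measurable_funTS; have := measurableT_comp mz (pair1_measurable (expR (- c))); exact.
    - by move=> t _; exact: (z0 (_, t)).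
    apply: eq_integral => t _; rewrite -muleA -EFinM /gammaw /gammaw2/=.
    have -> : expR (- (c + t)) = (expR (- c) * expR (- t))%R by rewrite opprD expRD.
    congr (_ * _%:E); rewrite {2}/divpow expr0 fact0 divr1; ring.
  rewrite (@tonelli_swap _ _ _ _ _ mu mu pos pos mp mp (fun z => g (expR (- z.1), expR (- (z.1 + z.2)))%R * (gammaw2 0 k z)%:E)) //.
  - apply: emeasurable_funM; last exact: measurable_gammaw2.
    by apply: (measurableT_comp mg); apply: measurable_fun_pair.
  - by move=> z; rewrite mule_ge0.
have mpp : measurable_fun setT (fun x : (j.+1 + k).+2.-tuple rT => g (prod_first j.+2 x, prod_all x)).
  apply: (measurableT_comp mg); apply: measurable_fun_pair.
    exact: measurable_prod_first.
  exact: measurable_prod_all.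
rewrite [LHS](ge0_integral_unit_cube (n := (j + k).+2))//.
(* The triple is [((c, b), a)], with [c] the coordinate peeled off. *)
pose h (z : (rT * rT) * rT) :=
  g (z.1.1 * expR (- z.2), z.1.1 * expR (- (z.2 + z.1.2)))%R * (gammaw2 j k (z.2, z.1.2))%:E.
have mh : measurable_fun setT h.
  have m1 : measurable_fun setT (fun z : (rT * rT) * rT => z.1.1).
    by have := measurableT_comp (@measurable_fst _ _ rT rT) (@measurable_fst _ _ (rT * rT)%type rT); exact.
  have m2 : measurable_fun setT (fun z : (rT * rT) * rT => z.1.2).
    by have := measurableT_comp (@measurable_snd _ _ rT rT) (@measurable_fst _ _ (rT * rT)%type rT); exact.
  have m3 : measurable_fun setT (fun z : (rT * rT) * rT => z.2) := @measurable_snd _ _ _ _.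
  have m32 : measurable_fun setT (fun z : (rT * rT) * rT => (z.2, z.1.2)) by exact: measurable_fun_pair.
  have me3 : measurable_fun setT (fun z : (rT * rT) * rT => expR (- z.2) : rT).
    by have := measurableT_comp measurable_expRN m3; exact.
  have me32 : measurable_fun setT (fun z : (rT * rT) * rT => expR (- (z.2 + z.1.2)) : rT).
    by have := measurableT_comp measurable_expRND m32; exact.
  apply: emeasurable_funM.
    by apply: (measurableT_comp mg); apply: measurable_fun_pair; exact: measurable_funM.
  by have := measurableT_comp (measurable_gammaw2 j k) m32; exact.
have h0 z : 0 <= h z by rewrite mule_ge0.
pose H (z : rT * rT) := \int[mu]_(a in pos) h (z, a).
have mH : measurable_fun setT H by exact: measurable_partial_integral.
have H0 z : 0 <= H z by apply: integral_ge0 => a _.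
transitivity (\int[mu]_(c in `[0%R, 1%R]) \int[mu]_(b in pos) H (c, b)).
  apply: eq_integral => c _.
  under eq_integral do rewrite prod_all_cons prod_first_cons.
  apply: (IH (fun z => g (c * z.1, c * z.2)%R)) => //.
  apply: (measurableT_comp mg); apply: measurable_fun_pair;
    by apply: measurable_funM; [exact: measurable_cst|].
rewrite ge0_integral_unit_expN; last 2 first.
- exact: measurable_partial_integral.
- by move=> a; apply: integral_ge0 => t _.
have mE : measurable_fun setT (fun z : rT * rT => (expR (- z.1))%:E) by exact/measurable_EFinP.
have mH' : measurable_fun setT (fun z : rT * rT => H (expR (- z.1), z.2)%R * (expR (- z.1))%:E).
  by apply: emeasurable_funM => //; apply: (measurableT_comp mH); exact: measurable_fun_pair.
transitivity (\int[mu]_(c in pos) \int[mu]_(b in pos) (H (expR (- c), b)%R * (expR (- c))%:E)).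
  apply: eq_integral => c _; rewrite -ge0_integralZr//.
  apply: measurable_funTS.
  by have := measurableT_comp mH (pair1_measurable (expR (- c) : rT)); exact.
rewrite (@tonelli_swap _ _ _ _ _ mu mu pos pos mp mp (fun z => H (expR (- z.1), z.2)%R * (expR (- z.1))%:E)) //; last first.
  by move=> z; rewrite mule_ge0// lee_fin expR_ge0.
apply: eq_integral => b _.
pose psi (x : rT) := g (expR (- x), expR (- (x + b))) * (expR (- (x + b)) * divpow k b)%:E.
transitivity (\int[mu]_(c in pos) \int[mu]_(a in pos) (psi (c + a)%R * (divpow j a)%:E)).
  apply: eq_integral => c _; rewrite -ge0_integralZr//=; last first.
    apply: measurable_funTS.
    by have := measurableT_comp mh (pair1_measurable (expR (- c) : rT, b : rT)); exact.
  apply: eq_integral => a _; rewrite /h /psi /gammaw2 /= -!muleA -!EFinM.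
  rewrite -!expRD -!opprD !addrA; congr (_ * _%:E).
  have -> : expR (- (c + a + b)) = (expR (- (a + b)) * expR (- c))%R.
    by rewrite -expRD; congr expR; ring.
  ring.
rewrite ge0_integral_convolution.
- by apply: eq_integral => x _; rewrite /psi /gammaw2 /= -muleA -EFinM; congr (_ * _%:E); ring.
- have hb : measurable_fun setT (fun x : rT => (x, b : rT)) by apply: measurable_fun_pair.
  have mb : measurable_fun setT (fun x : rT => expR (- (x + b)) : rT).
    by have := measurableT_comp measurable_expRND hb; exact.
  apply: emeasurable_funM.
    by apply: (measurableT_comp mg); exact: measurable_fun_pair.
  by apply/measurable_EFinP; apply: measurable_funM => //; exact: measurable_cst.
- by move=> x; rewrite /psi mule_ge0// lee_fin mulr_ge0 ?expR_ge0 ?divpow_ge0.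
Qed.

End CubeLaws.

Section CubeSumLaw.
Context {R : realType}.
Local Notation rT := (measurableTypeR R).
Local Notation mu := (@lebesgue_measure R).
Local Notation pos := (`]0%R, +oo[%classic : set rT).
Let mp : measurable pos := measurable_itv _.
Local Open Scope ereal_scope.
#[local] Hint Resolve gammaw_ge0 gammaw2_ge0 measurable_expRN measurable_gammaw measurable_expRN1 measurable_expRN2 measurable_expRND measurable_gammaw2 : core.

(** The binomial theorem; it makes the sum over [j] of the joint densities depend on [a + b]
    alone. *)
Lemma divpowD n (a b : R) : (0 < a)%R -> (0 < b)%R ->
  (\sum_(i < n.+1) divpow i a * divpow (n - i) b = divpow n (a + b))%R.
Proof.
move=> a0 b0; rewrite /divpow !gtr0_norm ?addr_gt0// addrC exprDn mulr_suml.
apply: eq_bigr => i _; have i_n : (i <= n)%N by rewrite -ltnS.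
rewrite -mulr_natr -(bin_fact i_n) !natrM; field.
by rewrite !pnatr_eq0 -!lt0n !fact_gt0 bin_gt0 i_n.
Qed.

(** The term [j = i + 1] has density [gammaw2 i (n - i)]. Summed over [i] by [divpowD] and with
    [t = a + b], these give [gammaw n t] on [a < t]; on the right [z.1] is [t] and [z.2] is [a]. *)
Lemma ge0_sum_integral_prod_first n (g : rT * rT -> \bar R) : measurable_fun setT g ->
  (forall z, 0 <= g z) ->
  \sum_(1 <= j < n.+2) \int[lebesgue_tuple n.+2]_(x in @unit_cube R n.+2)
    g (prod_first j x, prod_all x) =
  \int[mu \x mu]_(z in pos `*` pos)
    (g (expR (- z.2), expR (- z.1)) * (expR (- z.1) * divpow n z.1 * (z.2 < z.1)%R%:R)%:E).
Proof.
move=> mg g0; rewrite big_add1 big_mkord.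
have mG : measurable_fun setT (fun z : rT * rT => g (expR (- z.1), expR (- (z.1 + z.2)))).
  by apply: (measurableT_comp mg); exact: measurable_fun_pair.
have mGw j k : measurable_fun setT (fun z : rT * rT => g (expR (- z.1), expR (- (z.1 + z.2))) * (gammaw2 j k z)%:E).
  exact: emeasurable_funM.
have Gw0 j k (z : rT * rT) : 0 <= g (expR (- z.1), expR (- (z.1 + z.2))) * (gammaw2 j k z)%:E.
  by rewrite mule_ge0.
transitivity (\sum_(i < n.+1) \int[mu]_(a in pos) \int[mu]_(b in pos)
    (g (expR (- a), expR (- (a + b))) * (gammaw2 i (n - i) (a, b))%:E)).
  apply: eq_bigr => i _; have i_n : (i <= n)%N := ltn_ord i.
  have := ge0_integral_prod_first i (n - i) mg g0; rewrite (subnKC i_n) => ->.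
  exact/esym/(tonelli_swap mu mu mp mp (mGw i (n - i)%N) (Gw0 _ _)).
rewrite -ge0_integral_sum//; last 2 first.
- move=> i; apply: measurable_funTS.
  by have := measurable_partial_integral mu mp (mGw i (n - i)%N) (Gw0 _ _); exact.
- by move=> i a _; apply: integral_ge0 => b _; exact: (Gw0 _ _ (a, b)).
pose psi (a t : R) := g (expR (- a), expR (- t)) * (gammaw n t)%:E.
transitivity (\int[mu]_(a in pos) \int[mu]_(t in pos) (psi a t * (a < t)%R%:R%:E)).
  apply: eq_integral => a /[!inE] /posP a0.
  rewrite -ge0_integral_sum//; last 2 first.
  - move=> i; apply: measurable_funTS.
    by have := measurableT_comp (mGw i (n - i)%N) (pair1_measurable a); exact.
  - by move=> i b _; exact: (Gw0 _ _ (a, b)).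
  rewrite -ge0_integral_shift ?(ltW a0)//.
  - apply: eq_integral => b /[!inE] /posP b0; rewrite /psi -ge0_sume_distrr; last by move=> i _; exact: gammaw2_ge0.
    rewrite sumEFin; congr (_ * _%:E).
    by rewrite /gammaw -divpowD// mulr_sumr.
  - apply: emeasurable_funM => //; apply: (measurableT_comp mg).
    by apply: measurable_fun_pair => //; exact: measurable_cst.
  - by move=> t; rewrite mule_ge0// lee_fin gammaw_ge0.
have mf : measurable_fun setT (fun z : rT * rT => psi z.1 z.2 * (z.1 < z.2)%R%:R%:E).
  apply: emeasurable_funM; last exact: measurable_EFin_ltr.
  apply: emeasurable_funM.
    by apply: (measurableT_comp mg); exact: measurable_fun_pair.
  by have := measurableT_comp (measurable_gammaw n) (@measurable_snd _ _ rT rT); exact.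
have f0 (z : rT * rT) : 0 <= psi z.1 z.2 * (z.1 < z.2)%R%:R%:E.
  by rewrite !mule_ge0// lee_fin ?ler0n ?gammaw_ge0.
have := tonelli_swap mu mu mp mp mf f0 => /= ->.
have ms : measurable_fun setT (fun z : rT * rT => (z.2, z.1)) by exact: measurable_fun_pair.
have := tonelli_product mu mu mp mp (measurableT_comp mf ms) (fun z => f0 (z.2, z.1)) => /= <-.
by apply: eq_integral => -[t a] _; rewrite /psi /gammaw /= -muleA -EFinM.
Qed.

End CubeSumLaw.

(** * From laws for nonnegative functions to complex integrals *)

Section Transfer.
Context {R : realType} d d' d'' (T : measurableType d) (T' : measurableType d') (S : measurableType d'').
Variables (mu : {measure set T -> \bar R}) (nu : {measure set T' -> \bar R}).
Variables (D : set T) (E : set T') (mD : measurable D) (mE : measurable E).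
Variables (r : seq nat) (X : nat -> T -> S) (Y : T' -> S) (w : T' -> R).
Hypotheses (mY : measurable_fun setT Y) (mw : measurable_fun setT w).
Hypotheses (mX : forall j, measurable_fun setT (X j)) (w0 : forall y, 0 <= w y).
(** Stated for a sum of image measures because in the first formula it is the sum over [j] that has
    the simple density. *)
Hypothesis law : forall f : S -> \bar R, measurable_fun setT f -> (forall s, 0 <= f s)%E ->
  (\sum_(j <- r) \int[mu]_(x in D) f (X j x) = \int[nu]_(y in E) (f (Y y) * (w y)%:E))%E.

(** Applied to the absolute value of [f], the law has nonnegative terms, so each of them is bounded
    by the finite right-hand side. *)
Lemma transfer_integrable (f : S -> R) j : j \in r -> measurable_fun setT f ->
  nu.-integrable E (fun y => (f (Y y) * w y)%:E) -> mu.-integrable D (fun x => (f (X j x))%:E).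
Proof.
move=> jr mf /integrableP[_ foo]; apply/integrableP; split.
  by apply/measurable_EFinP/measurable_funTS; exact: measurableT_comp.
have := law (f := fun s => `|(f s)%:E|%E); rewrite (big_rem j jr)/= => h.
apply: le_lt_trans foo.
have -> : (\int[nu]_(y in E) `|(f (Y y) * w y)%:E| = \int[nu]_(y in E) (`|(f (Y y))%:E| * (w y)%:E))%E.
  by apply: eq_integral => y _; rewrite EFinM abseM [(`|(w y)%:E|)%E]gee0_abs// lee_fin.
rewrite -h//; last by apply: measurableT_comp => //; exact: measurableT_comp.
by rewrite leeDl//; apply: sume_ge0 => i _; exact: integral_ge0.
Qed.

Lemma transfer_integral (f : S -> R) : measurable_fun setT f ->
  nu.-integrable E (fun y => (f (Y y) * w y)%:E) ->
  \sum_(j <- r) \int[mu]_(x in D) f (X j x) = \int[nu]_(y in E) (f (Y y) * w y).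
Proof.
move=> mf fi.
have pos (h : S -> R) : measurable_fun setT h -> (forall s, 0 <= h s) ->
    nu.-integrable E (fun y => (h (Y y) * w y)%:E) ->
    \sum_(j <- r) \int[mu]_(x in D) h (X j x) = \int[nu]_(y in E) (h (Y y) * w y).
  move=> mh h0 hi; apply: EFin_inj; rewrite -sumEFin {2}/Rintegral fineK ?integrable_fin_num//.
  under [RHS]eq_integral do rewrite EFinM.
  rewrite -(@law (EFin \o h)) => [|//|s]; last 2 first.
  - exact/measurable_EFinP.
  - by rewrite lee_fin.
  apply: eq_big_seq => j jr; rewrite /Rintegral fineK// integrable_fin_num//.
  exact: transfer_integrable.
have half (h : S -> R) : measurable_fun setT h -> (forall s, `|h s| <= `|f s|) ->
    nu.-integrable E (fun y => (h (Y y) * w y)%:E).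
  move=> mh hf; apply: le_integrable fi => //.
    apply/measurable_EFinP; apply: measurable_funTS; apply: measurable_funM => //.
    exact: measurableT_comp.
  by move=> y _; rewrite lee_fin !normrM ler_wpM2r.
pose fp s := Num.max (f s) 0; pose fm s := Num.max (- f s) 0.
have fE s : f s = fp s - fm s.
  rewrite /fp /fm; case/orP: (le_total 0 (f s)) => f0.
    by rewrite max_l// max_r ?oppr_le0// subr0.
  by rewrite max_r// max_l ?oppr_ge0// sub0r opprK.
have mfp : measurable_fun setT fp by exact: measurable_maxr.
have mfm : measurable_fun setT fm.
  by apply: measurable_maxr => //; exact: measurableT_comp.
have fp0 s : 0 <= fp s by rewrite le_max lexx orbT.
have fm0 s : 0 <= fm s by rewrite le_max lexx orbT.
have ip : nu.-integrable E (fun y => (fp (Y y) * w y)%:E).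
  by apply: half => // s; rewrite ger0_norm// ge_max normr_ge0 ler_norm.
have im : nu.-integrable E (fun y => (fm (Y y) * w y)%:E).
  by apply: half => // s; rewrite ger0_norm// ge_max normr_ge0 -normrN ler_norm.
transitivity (\sum_(j <- r) (\int[mu]_(x in D) fp (X j x) - \int[mu]_(x in D) fm (X j x))).
  apply: eq_big_seq => j jr; rewrite -RintegralB//; last 2 first.
  - exact: transfer_integrable.
  - exact: transfer_integrable.
  by apply: eq_Rintegral => x _.
rewrite sumrB !pos// -RintegralB//.
by apply: eq_Rintegral => y _; rewrite -mulrBl -fE.
Qed.

Lemma ctransfer (f : S -> R[i]) : cmeasurable setT f ->
  cintegrable nu E (fun y => f (Y y) * (w y)%:C) ->
  (forall j, j \in r -> cintegrable mu D (fun x => f (X j x))) /\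
  \sum_(j <- r) cintegral mu D (fun x => f (X j x)) = cintegral nu E (fun y => f (Y y) * (w y)%:C).
Proof.
move=> [mr mi] [].
have -> : (fun y => (Re (f (Y y) * (w y)%:C))%:E) = (fun y => (Re (f (Y y)) * w y)%:E).
  by apply/funext => y; rewrite mulrC ReMr mulrC.
have -> : (fun y => (Im (f (Y y) * (w y)%:C))%:E) = (fun y => (Im (f (Y y)) * w y)%:E).
  by apply/funext => y; rewrite mulrC ImMr mulrC.
move=> ir ii; split.
  by move=> j jr; split; [exact: (transfer_integrable jr mr)|exact: (transfer_integrable jr mi)].
rewrite [RHS]/cintegral.
under [in X in _ = X +i* _]eq_Rintegral do rewrite mulrC ReMr mulrC.
under [in X in _ = _ +i* X]eq_Rintegral do rewrite mulrC ImMr mulrC.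
rewrite -(transfer_integral mr ir) -(transfer_integral mi ii) /cintegral.
have H (a b : nat -> R) (l : seq nat) :
    \sum_(j <- l) (a j +i* b j) = (\sum_(j <- l) a j) +i* (\sum_(j <- l) b j).
  by elim: l => [|j l IH]; rewrite ?big_nil// !big_cons IH.
exact: H.
Qed.

End Transfer.

Section RintegralProduct.
Context {R : realType} d1 d2 (T1 : measurableType d1) (T2 : measurableType d2).
Variables (m1 : {sigma_finite_measure set T1 -> \bar R}) (m2 : {sigma_finite_measure set T2 -> \bar R}).
Variables (D1 : set T1) (D2 : set T2) (mD1 : measurable D1) (mD2 : measurable D2).

(** With every section integrable, the inner extended integrals are finite for all [x], so taking
    [fine] inside loses nothing. *)
Lemma Rintegral_prod (f : T1 * T2 -> R) :
  (m1 \x m2)%E.-integrable (D1 `*` D2) (EFin \o f) ->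
  (forall x, D1 x -> m2.-integrable D2 (fun y => (f (x, y))%:E)) ->
  \int[(m1 \x m2)%E]_(z in D1 `*` D2) f z = \int[m1]_(x in D1) \int[m2]_(y in D2) f (x, y).
Proof.
move=> fi fxi; have mD : measurable (D1 `*` D2) by exact: measurableX.
rewrite {1}/Rintegral integral_mkcond -integral12_prod_meas1; last by rewrite -integrable_mkcond.
rewrite /fubini_F iterated_integral_patch /Rintegral; congr fine.
by apply: eq_integral => x /[!inE] Dx; rewrite fineK// integrable_fin_num//; exact: fxi.
Qed.

Lemma cintegral_prod (f : T1 * T2 -> R[i]) : cintegrable (m1 \x m2)%E (D1 `*` D2) f ->
  (forall x, D1 x -> cintegrable m2 D2 (fun y => f (x, y))) ->
  cintegral (m1 \x m2)%E (D1 `*` D2) f = cintegral m1 D1 (fun x => cintegral m2 D2 (fun y => f (x, y))).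
Proof.
move=> [fr fi] fx; rewrite /cintegral.
rewrite (Rintegral_prod fr); last by move=> x /fx[].
by rewrite (Rintegral_prod fi)//; move=> x /fx[].
Qed.

End RintegralProduct.

(** * The integrands in logarithmic coordinates *)

Section ComplexPowerMeasurable.
Context {R : realType}.
Local Notation rT := (measurableTypeR R).
Local Notation C := R[i].

Lemma cmeasurable_comp d d' (T : measurableType d) (T' : measurableType d') (f : T' -> C) (h : T -> T') :
  cmeasurable setT f -> measurable_fun setT h -> cmeasurable setT (f \o h).
Proof. by move=> [fr fi] mh; split; [exact: (measurableT_comp fr mh)|exact: (measurableT_comp fi mh)]. Qed.

Lemma cmeasurable_cexp d (T : measurableType d) (D : set T) (f : T -> C) : cmeasurable D f ->
  cmeasurable D (fun x => cexp (f x)).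
Proof.
move=> [fr fi]; split.
  under eq_fun do rewrite Re_cexp.
  apply: measurable_funM; first exact: measurableT_comp.
  by apply: measurableT_comp => //; apply: continuous_measurable_fun; exact: continuous_cos.
under eq_fun do rewrite Im_cexp.
apply: measurable_funM; first exact: measurableT_comp.
by apply: measurableT_comp => //; apply: continuous_measurable_fun; exact: continuous_sin.
Qed.

Lemma cmeasurable_cpow (w : C) : cmeasurable setT (fun p : rT => cpow p%:C w).
Proof.
apply: cmeasurable_cexp; apply: cmeasurableM; first exact: cmeasurable_cst.
split.
  have -> : (fun p : rT => Re (clog p%:C)) = fun p => ln `|p|.
    by apply/funext => p; rewrite /clog -[LHS]/(ln (normc p%:C)) normc_real.
  by apply: measurableT_comp => //; exact: measurable_ln.
(* On the real line [carg] takes three values; at 0 the division by zero makes it [acos 0]. *)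
have -> : (fun p : rT => Im (clog p%:C)) =
    fun p => if 0 < p then acos 1 else if p < 0 then acos (-1) else acos 0.
  apply/funext => p; rewrite -[LHS]/(carg p%:C) /carg -[Im _]/(0 : R) lexx -[Re _]/p normc_real.
  have [p0|p0|<-] := ltgtP 0 p.
  - by rewrite gtr0_norm// divff ?gt_eqF.
  - by rewrite ltr0_norm// invrN mulrN divff ?lt_eqF.
  - by rewrite mul0r.
apply: measurable_fun_ifT; last apply: measurable_fun_ifT.
- by apply: measurable_fun_ltr; [exact: measurable_cst|exact: measurable_id].
- exact: measurable_cst.
- by apply: measurable_fun_ltr; [exact: measurable_id|exact: measurable_cst].
- exact: measurable_cst.
- exact: measurable_cst.
Qed.

End ComplexPowerMeasurable.

Section Weights.
Context {R : realType}.
Local Notation C := R[i].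
Local Notation rT := (measurableTypeR R).
Local Notation mu := (@lebesgue_measure R).
Local Notation pos := (`]0%R, +oo[%classic : set rT).
Let mp : measurable pos := measurable_itv _.
Implicit Types (u v z s : C).

Lemma cpow_expRN (w : C) (t : R) : cpow (expR (- t))%:C w = cexp (- (w * t%:C)).
Proof.
by rewrite cpow_real ?expR_gt0// expRK; congr cexp; rewrite rcN mulrN.
Qed.

(** The density contributes [t^n e^-t / n!], which completes [e^(-(u - 1) t) t^s] to
    [t^(s + n) e^(-u t)]. *)
Lemma ker_weight n u s (t : R) : 0 < t ->
  cpow (expR (- t))%:C (u - 1) * cpow t%:C s * (expR (- t) * divpow n t)%:C =
  (n`!%:R)^-1 * ker (s + n.+1%:R) u t.
Proof.
move=> t0; rewrite cpow_expRN cpow_real// /divpow gtr0_norm// !rcM rcV rc_nat.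
have -> : (t ^+ n)%:C = cexp (n%:R * (ln t)%:C).
  by rewrite -rc_nat -rcM cexp_real expRM_natl lnK.
rewrite -cexp_real rcN.
rewrite [LHS](_ : _ = n`!%:R^-1 * (cexp (- ((u - 1) * t%:C)) * cexp (s * (ln t)%:C) *
  cexp (- t%:C) * cexp (n%:R * (ln t)%:C))); last by ring.
rewrite -!cexpD; congr (_ * cexp _); rewrite -natr1; ring.
Qed.

Lemma zintegral_ker_lerch u s z : 0 < Re u ->
  (slit_plane z /\ 0 < Re s) \/ (z = 1 /\ 1 < Re s) ->
  cintegrable mu pos (fun t => ker s u t / (1 - z * (expR (- t))%:C)) /\
  zintegral (ker s u) z = Gamma s * lerch z s u.
Proof.
move=> u0 [[sz s0]|[-> s1]].
  split; first by apply: cintegrable_slit => //; exact: cintegrable_ker.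
  by rewrite lerch_slit_pos// Gamma_pos// mulrC divfK// gamma_integral_neq0.
have s0 : 0 < Re s by rewrite (lt_trans ltr01).
split.
  apply: (cintegrable_1Bexp (K := 1) s1 u0); first exact: cmeasurable_ker.
  by move=> t t0; rewrite mul1r normc_ker.
by rewrite lerch1_gt1// Gamma_pos// mulrC divfK// gamma_integral_neq0.
Qed.

Lemma cmeasurable_integrand v s z : cmeasurable setT (fun p : rT =>
  cpow p%:C (v - 1) / (1 - z * p%:C) * cpow (- ln p)%:C s).
Proof.
apply: cmeasurableM.
  apply: cmeasurableM; first exact: cmeasurable_cpow.
  apply: cmeasurableV; apply: cmeasurableB; first exact: cmeasurable_cst.
  apply: cmeasurableM; first exact: cmeasurable_cst.
  by apply: cmeasurable_real; exact: measurable_id.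
have ml : measurable_fun setT (fun p : rT => - ln p : rT).
  by apply: measurableT_comp => //; exact: measurable_ln.
exact: (cmeasurable_comp (cmeasurable_cpow s) ml).
Qed.

Lemma measurable_gammaw_real n : measurable_fun [set: rT] (gammaw n).
Proof. by apply/measurable_EFinP; exact: measurable_gammaw. Qed.

Lemma integrable_prod_all n u s z : 0 < Re u ->
  (slit_plane z /\ 0 < Re (s + n.+1%:R)) \/ (z = 1 /\ 1 < Re (s + n.+1%:R)) ->
  let f := fun x : n.+1.-tuple rT =>
    cpow (prod_all x)%:C (u - 1) / (1 - z * (prod_all x)%:C) * cpow (- ln (prod_all x))%:C s in
  cintegrable (lebesgue_tuple n.+1) (@unit_cube R n.+1) f /\
  cintegral (lebesgue_tuple n.+1) (@unit_cube R n.+1) f =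
    Gamma (s + n.+1%:R) / n`!%:R * lerch z (s + n.+1%:R) u.
Proof.
move=> u0 zs f; have [iz ez] := zintegral_ker_lerch u0 zs.
pose h (p : rT) : C := cpow p%:C (u - 1) / (1 - z * p%:C) * cpow (- ln p)%:C s.
have mh : cmeasurable setT h by exact: cmeasurable_integrand.
have hE t : pos t -> h (expR (- t)) * (expR (- t) * divpow n t)%:C =
    n`!%:R^-1 * (ker (s + n.+1%:R) u t / (1 - z * (expR (- t))%:C)).
  move=> /posP t0; rewrite [RHS]mulrA -ker_weight// /h expRK opprK; ring.
have ih : cintegrable mu pos (fun t => h (expR (- t)) * (expR (- t) * divpow n t)%:C).
  by apply: (eq_cintegrable mp _ (cintegrableZl mp n`!%:R^-1 iz)) => t pt; rewrite hE.
have mE := @measurable_unit_cube R n.+1.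
(* A one-term sum, in the shape that [ctransfer] expects. *)
have law (F : rT -> \bar R) : measurable_fun setT F -> (forall p, 0 <= F p)%E ->
    (\sum_(j <- [:: 0%N]) \int[lebesgue_tuple n.+1]_(x in @unit_cube R n.+1) F (prod_all x) =
     \int[mu]_(t in pos) (F (expR (- t)) * (gammaw n t)%:E))%E.
  by move=> mF F0; rewrite big_seq1; exact: ge0_integral_prod_all.
have [H1 H2] := @ctransfer _ _ _ _ _ _ _ (lebesgue_tuple n.+1) mu _ pos mE mp
  [:: 0%N] (fun _ => @prod_all R n.+1) (fun t : rT => expR (- t) : rT) (gammaw n)
  (@measurable_expRN R) (measurable_gammaw_real n) (fun _ => @measurable_prod_all R n.+1)
  (gammaw_ge0 n) law h mh ih.
split; first exact: (H1 0%N (mem_head _ _)).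
rewrite big_seq1 in H2; rewrite [LHS]H2 (eq_cintegral mu hE).
rewrite (cintegralZl mp _ iz) -/(zintegral _ _) ez; ring.
Qed.

End Weights.

(** * The integral of [F_uv] *)

Section ProdFirst.
Context {R : realType}.
Local Notation C := R[i].
Local Notation rT := (measurableTypeR R).
Local Notation mu := (@lebesgue_measure R).
Local Notation pos := (`]0%R, +oo[%classic : set rT).
Let mp : measurable pos := measurable_itv _.
Implicit Types (u v z s w : C).

Lemma cintegral_truncated (F f df : R -> C) (x : R) : 0 < x ->
  (forall t, is_cderive F t (f t)) -> (forall t, is_cderive f t (df t)) ->
  cintegrable mu pos (fun t => f t * ((t < x)%R%:R)%:C) /\
  cintegral mu pos (fun t => f t * ((t < x)%R%:R)%:C) = F x - F 0.
Proof.
move=> x0 dF df'.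
have cr : continuous (fun t => Re (f t)) by move=> t; have [] := is_cderive_continuous (df' t).
have ci : continuous (fun t => Im (f t)) by move=> t; have [] := is_cderive_continuous (df' t).
have [ir er] := integral_truncated x0 (fun t => (dF t).1) cr.
have [ii ei] := integral_truncated x0 (fun t => (dF t).2) ci.
have rE : (fun t => Re (f t * ((t < x)%R%:R)%:C)) = (fun t => Re (f t) * (t < x)%R%:R).
  by apply/funext => t; rewrite mulrC ReMr mulrC.
have iE : (fun t => Im (f t * ((t < x)%R%:R)%:C)) = (fun t => Im (f t) * (t < x)%R%:R).
  by apply/funext => t; rewrite mulrC ImMr mulrC.
split.
  split.
    by rewrite -[X in integrable _ _ X]/(EFin \o (fun t => Re (f t * ((t < x)%R%:R)%:C))) rE.
  by rewrite -[X in integrable _ _ X]/(EFin \o (fun t => Im (f t * ((t < x)%R%:R)%:C))) iE.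
apply: complex_ext.
  by rewrite Re_cintegral rE /Rintegral er ReB.
by rewrite Im_cintegral iE /Rintegral ei ImB.
Qed.

Lemma cexp_truncated_integral w (x : R) : w != 0 -> 0 < x ->
  cintegrable mu pos (fun t => cexp (- (w * t%:C)) * ((t < x)%R%:R)%:C) /\
  cintegral mu pos (fun t => cexp (- (w * t%:C)) * ((t < x)%R%:R)%:C) =
    (1 - cexp (- (w * x%:C))) / w.
Proof.
move=> w0 x0.
have d0 t : is_cderive (fun t : R => - (w * t%:C)) t (- w).
  by apply: (is_cderive_congr (is_cderiveN (is_cderiveMl w (is_cderive_id t)))) => [//|]; rewrite mulr1.
have d1 t : is_cderive (fun t : R => cexp (- (w * t%:C))) t (- w * cexp (- (w * t%:C))).
  exact: is_cderive_cexp (d0 t).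
have d2 t : is_cderive (fun t : R => - w^-1 * cexp (- (w * t%:C))) t (cexp (- (w * t%:C))).
  apply: (is_cderive_congr (is_cderiveMl (- w^-1) (d1 t))) => [//|].
  by rewrite mulrA mulrNN mulVf// mul1r.
have [h1 h2] := cintegral_truncated x0 d2 d1.
split; first exact: h1.
rewrite h2 -[0%:C]/(0 : C) mulr0 oppr0 cexp0; field.
exact: w0.
Qed.

Lemma measurable_normc_zker z : measurable_fun setT (fun t : rT => normc (1 - z * (expR (- t))%:C)^-1).
Proof.
apply: measurable_normc; apply: cmeasurableV; apply: cmeasurableB; first exact: cmeasurable_cst.
by apply: cmeasurableM; [exact: cmeasurable_cst|apply: cmeasurable_real; exact: measurable_expRN].
Qed.

Lemma measurable_gkerT sigma c : measurable_fun setT (gker sigma c : rT -> rT).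
Proof.
apply: measurableT_comp; first exact: measurable_expR.
apply: measurable_funB; apply: measurable_funM; try exact: measurable_cst; last exact: measurable_id.
exact: measurable_ln.
Qed.

(** Integrating over [0 < a < t] first yields a factor [t], which raises [s] to [s + 1], where the
    single kernel with parameter [c] is already integrable. *)
Lemma integrable_truncated_majorant s z c : 0 < c ->
  (slit_plane z /\ -1 < Re s) \/ (z = 1 /\ 0 < Re s) ->
  (mu \x mu)%E.-integrable (pos `*` pos)
    (fun y => (gker (Re s) c y.1 * normc (1 - z * (expR (- y.1))%:C)^-1 * (y.2 < y.1)%R%:R)%:E).
Proof.
move=> c0 zs.
pose M t : R := gker (Re s) c t * normc (1 - z * (expR (- t))%:C)^-1.
have M0 t : 0 <= M t by rewrite mulr_ge0 ?gker_ge0 ?normc_ge0.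
have mM : measurable_fun setT (fun t : rT => (M t)%:E).
  apply/measurable_EFinP; apply: measurable_funM; first exact: measurable_gkerT.
  exact: measurable_normc_zker.
have ms : measurable_fun setT (fun y : rT * rT => (y.2, y.1)) by exact: measurable_fun_pair.
have ml : measurable_fun setT (fun y : rT * rT => (y.2 < y.1)%R%:R%:E : \bar R).
  by have := measurableT_comp (@measurable_EFin_ltr R) ms; exact.
have mN : measurable_fun setT (fun y : rT * rT => (M y.1 * (y.2 < y.1)%R%:R)%:E).
  under eq_fun do rewrite EFinM.
  apply: emeasurable_funM => //.
  by have := measurableT_comp mM (@measurable_fst _ _ rT rT); exact.
have N0 (y : rT * rT) : (0 <= (M y.1 * (y.2 < y.1)%R%:R)%:E)%E by rewrite lee_fin mulr_ge0// ler0n.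
apply/integrableP; split; first exact: measurable_funTS.
under eq_integral => y _ do rewrite gee0_abs ?(N0 y)//.
rewrite (tonelli_product mu mu mp mp mN N0)/=.
have zs' : (slit_plane z /\ 0 < Re (s + 1)) \/ (z = 1 /\ 1 < Re (s + 1)).
  rewrite ReD -[Re 1]/(1 : R); case: zs => -[? ?]; [left|right]; split => //; lra.
have c0' : 0 < Re c%:C by [].
have [/(cintegrable_normc mp)/integrableP[_ +] _] := zintegral_ker_lerch c0' zs'.
congr (_ < _)%E; apply: eq_integral => t /[!inE] /posP t0.
transitivity (\int[mu]_(a in pos) ((M t)%:E * ((divpow 0 a)%:E * (a < t)%R%:R%:E)))%E; last first.
  by apply: eq_integral => a _; rewrite /divpow expr0 fact0 divr1 mul1e EFinM.
rewrite ge0_integralZl//; last 3 first.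
- apply: measurable_funTS; apply: emeasurable_funM.
    by apply/measurable_EFinP; exact: measurable_divpow.
  by have := measurableT_comp (@measurable_EFin_ltr R) (measurable_fun_pair (@measurable_id _ _ _) (measurable_cst t)); exact.
- by move=> a _; rewrite mule_ge0// lee_fin ?divpow_ge0 ?ler0n.
- by rewrite lee_fin.
rewrite integral_divpow// gee0_abs ?lee_fin ?normc_ge0//; congr (_%:E).
rewrite /divpow expr1 divr1 gtr0_norm// normcM normc_ker ReD gkerS//; rewrite /M; ring.
Qed.

Lemma cintegrable_zdker u v s z : 0 < Re u -> 0 < Re v ->
  (slit_plane z /\ -1 < Re s) \/ (z = 1 /\ 0 < Re s) ->
  cintegrable mu pos (fun t => dker s v u t / (1 - z * (expR (- t))%:C)).
Proof.
move=> u0 v0 [[sz s1]|[-> s0]]; last exact: cintegrable_dker_1Bexp.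
by apply: cintegrable_slit => //; exact: cintegrable_dker.
Qed.

Lemma truncated_kernel_integral u v s z : 0 < Re u -> 0 < Re v -> u - v != 0 ->
  (slit_plane z /\ -1 < Re s) \/ (z = 1 /\ 0 < Re s) ->
  let K := fun y : rT * rT => ker s v y.1 / (1 - z * (expR (- y.1))%:C) *
    (cexp (- ((u - v) * y.2%:C)) * ((y.2 < y.1)%R%:R)%:C) in
  cintegrable (mu \x mu)%E (pos `*` pos) K /\
  cintegral (mu \x mu)%E (pos `*` pos) K = zintegral (dker s v u) z / (u - v).
Proof.
move=> u0 v0 uv zs K.
have iz := cintegrable_zdker u0 v0 zs.
pose c := Num.min (Re v) (Re u); have c0 : 0 < c by rewrite lt_min v0.
have iN := integrable_truncated_majorant c0 zs.
have mP : measurable (pos `*` pos) by exact: measurableX.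
have mreal (f : rT * rT -> rT) : measurable_fun setT f -> cmeasurable setT (fun y => (f y)%:C).
  exact: cmeasurable_real.
have m1 : cmeasurable setT (fun y : rT * rT => y.1%:C) by apply: mreal; exact: measurable_fst.
have m2 : cmeasurable setT (fun y : rT * rT => y.2%:C) by apply: mreal; exact: measurable_snd.
have ml : cmeasurable setT (fun y : rT * rT => (ln y.1)%:C).
  by apply: mreal; have := measurableT_comp (@measurable_ln R) (@measurable_fst _ _ rT rT); exact.
have me : cmeasurable setT (fun y : rT * rT => (expR (- y.1))%:C).
  by apply: mreal; exact: measurable_expRN1.
have mlt : cmeasurable setT (fun y : rT * rT => ((y.2 < y.1)%R%:R)%:C : C).
  have ms : measurable_fun setT (fun y : rT * rT => (y.2, y.1)) by exact: measurable_fun_pair.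
  have h : measurable_fun setT (fun y : rT * rT => (y.2 < y.1)%R%:R : rT).
    by apply/measurable_EFinP; have := measurableT_comp (@measurable_EFin_ltr R) ms; exact.
  exact: mreal h.
have mcst (k : C) : cmeasurable setT (fun _ : rT * rT => k) by exact: cmeasurable_cst.
have mK : cmeasurable setT K.
  apply: cmeasurableM.
    apply: cmeasurableM.
      by apply: cmeasurable_cexp; apply: cmeasurableB; apply: cmeasurableM.
    by apply: cmeasurableV; apply: cmeasurableB => //; exact: cmeasurableM.
  by apply: cmeasurableM => //; apply: cmeasurable_cexp; apply: cmeasurableN; exact: cmeasurableM.
have iK : cintegrable (mu \x mu)%E (pos `*` pos) K.
  apply: (cintegrable_dom mP _ _ iN).
    by case: mK => mr mi; split; exact: measurable_funTS.
  move=> -[t a] [/= /posP t0 /posP a0]; rewrite /K /=.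
  have [at_|_] := ltP a t; last first.
    by rewrite mulr0n -[0%:C]/(0 : C) !mulr0 (normc_nat 0).
  rewrite mulr1n -[1%:C]/(1 : C) !mulr1 2!normcM normc_ker normc_cexp [leLHS]mulrAC ler_wpM2r ?normc_ge0//.
  rewrite /gker -expRD ler_expR ReN [_ * a%:C]mulrC ReMr ReB.
  have cv : c <= Re v by rewrite ge_min lexx.
  have cu : c <= Re u by rewrite ge_min lexx orbT.
  (* The real exponent is regrouped as [Re v (t - a) + Re u a], which is at least [c t] because
     [0 < a < t]. *)
  have h1 : c * (t - a) <= Re v * (t - a) by rewrite ler_wpM2r// subr_ge0 ltW.
  have h2 : c * a <= Re u * a by rewrite ler_wpM2r// ltW.
  lra.
have iKt t : pos t -> cintegrable mu pos (fun a => K (t, a)).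
  move=> /posP t0; have [h1 _] := cexp_truncated_integral uv t0.
  by have := cintegrableZl mp (ker s v t / (1 - z * (expR (- t))%:C)) h1; exact.
split => //.
rewrite (cintegral_prod mp mp iK iKt) /zintegral -(cintegralZr mp _ iz).
apply: eq_cintegral => t /posP t0; have [h1 h2] := cexp_truncated_integral uv t0.
have -> := cintegralZl mp (ker s v t / (1 - z * (expR (- t))%:C)) h1.
rewrite h2.
have -> : dker s v u t = ker s v t * (1 - cexp (- ((u - v) * t%:C))).
  by rewrite mulrBr mulr1 /dker /ker -cexpD; congr (_ - cexp _); ring.
ring.
Qed.

Lemma integrable_F_uv n u v s z : 0 < Re u -> 0 < Re v -> u - v != 0 ->
  (slit_plane z /\ -1 < Re (s + n.+1%:R)) \/ (z = 1 /\ 0 < Re (s + n.+1%:R)) ->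
  let f := fun x : n.+2.-tuple rT =>
    F_uv u v x / (1 - z * (prod_all x)%:C) * cpow (- ln (prod_all x))%:C s in
  cintegrable (lebesgue_tuple n.+2) (@unit_cube R n.+2) f /\
  cintegral (lebesgue_tuple n.+2) (@unit_cube R n.+2) f =
    n`!%:R^-1 * (zintegral (dker (s + n.+1%:R) v u) z / (u - v)).
Proof.
move=> u0 v0 uv zs f; have [iK eK] := truncated_kernel_integral u0 v0 uv zs.
(* One summand of [F_uv] with its common factors, as a function of the pair of a partial product and
   the full product. *)
pose h (y : rT * rT) : C := cpow y.1%:C (u - v) *
  (cpow y.2%:C (v - 1) / (1 - z * y.2%:C) * cpow (- ln y.2)%:C s).
have mh : cmeasurable setT h.
  apply: cmeasurableM.
    exact: (cmeasurable_comp (cmeasurable_cpow (u - v)) (@measurable_fst _ _ rT rT)).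
  exact: (cmeasurable_comp (cmeasurable_integrand v s z) (@measurable_snd _ _ rT rT)).
pose X j (x : n.+2.-tuple rT) : rT * rT := (prod_first j x, prod_all x).
pose Y (y : rT * rT) : rT * rT := (expR (- y.2), expR (- y.1)).
pose w (y : rT * rT) : R := gammaw n y.1 * (y.2 < y.1)%R%:R.
have mX j : measurable_fun setT (X j).
  apply: measurable_fun_pair; first exact: measurable_prod_first.
  exact: measurable_prod_all.
have mY : measurable_fun setT Y.
  by apply: measurable_fun_pair; [exact: measurable_expRN2|exact: measurable_expRN1].
have mw : measurable_fun setT w.
  apply: measurable_funM.
    by have := measurableT_comp (measurable_gammaw_real n) (@measurable_fst _ _ rT rT); exact.
  have ms : measurable_fun setT (fun y : rT * rT => (y.2, y.1)) by exact: measurable_fun_pair.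
  by apply/measurable_EFinP; have := measurableT_comp (@measurable_EFin_ltr R) ms; exact.
have w0 y : 0 <= w y by rewrite mulr_ge0 ?gammaw_ge0.
have hE y : (pos `*` pos) y -> h (Y y) * (w y)%:C =
    n`!%:R^-1 * (ker (s + n.+1%:R) v y.1 / (1 - z * (expR (- y.1))%:C) *
    (cexp (- ((u - v) * y.2%:C)) * ((y.2 < y.1)%R%:R)%:C)).
  move=> [/posP t0 _]; rewrite /h /w /Y /= rcM cpow_expRN expRK opprK.
  rewrite [RHS](_ : _ = (n`!%:R^-1 * ker (s + n.+1%:R) v y.1) / (1 - z * (expR (- y.1))%:C) *
    (cexp (- ((u - v) * y.2%:C)) * ((y.2 < y.1)%R%:R)%:C)); last by ring.
  by rewrite -ker_weight// /gammaw; ring.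
have mE : measurable (pos `*` pos) by exact: measurableX.
have ih : cintegrable (mu \x mu)%E (pos `*` pos) (fun y => h (Y y) * (w y)%:C).
  by apply: (eq_cintegrable mE _ (cintegrableZl mE n`!%:R^-1 iK)) => y py; rewrite hE.
have law (F : rT * rT -> \bar R) : measurable_fun setT F -> (forall p, 0 <= F p)%E ->
    (\sum_(j <- index_iota 1 n.+2) \int[lebesgue_tuple n.+2]_(x in @unit_cube R n.+2) F (X j x) =
     \int[mu \x mu]_(y in pos `*` pos) (F (Y y) * (w y)%:E))%E.
  exact: ge0_sum_integral_prod_first.
have mcube := @measurable_unit_cube R n.+2.
have [H1 H2] := @ctransfer _ _ _ _ _ _ _ (lebesgue_tuple n.+2) (mu \x mu)%E _ _ mcube mE
  (index_iota 1 n.+2) X Y w mY mw mX w0 law h mh ih.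
have fE : f = fun x => \sum_(i < n.+1) h (X i.+1 x).
  apply/funext => x; transitivity (\sum_(i < n.+1) cpow (prod_first i.+1 x)%:C (u - v) *
      (cpow (prod_all x)%:C (v - 1) / (1 - z * (prod_all x)%:C) * cpow (- ln (prod_all x))%:C s)) => //.
  by rewrite -mulr_suml /f /F_uv big_add1 big_mkord; ring.
have iX (i : 'I_n.+1) : cintegrable (lebesgue_tuple n.+2) (@unit_cube R n.+2) (fun x => h (X i.+1 x)).
  by apply: H1; rewrite mem_index_iota /= ltnS ltn_ord.
rewrite fE; split; first exact: (cintegrable_sum mcube).
rewrite (cintegral_sum mcube)//.
rewrite big_add1 big_mkord in H2; rewrite [LHS]H2 (eq_cintegral _ hE).
by rewrite (cintegralZl mE _ iK) eK.
Qed.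

(** The excluded point [(z == 1)%:R] is the pole 0 of Gamma when [z] is not 1, and the pole 1 of the
    zeta function when [z = 1]. *)
Lemma Gamma_lerch_sub u v s z : 0 < Re u -> 0 < Re v ->
  (slit_plane z /\ -1 < Re s) \/ (z = 1 /\ 0 < Re s) -> s != (z == 1)%:R ->
  Gamma s * (lerch z s v - lerch z s u) = zintegral (dker s v u) z.
Proof.
move=> u0 v0 [[sz s1]|[-> s0]].
  by rewrite (negbTE (slit_plane_neq1 sz)) => sn0; exact: lerch_slit_sub.
by rewrite eqxx => s1; exact: lerch1_sub.
Qed.

Lemma analytic_zdker u v z a : 0 < Re u -> 0 < Re v ->
  (slit_plane z /\ -1 < Re a) \/ (z = 1 /\ 0 < Re a) ->
  analytic_at (fun s => zintegral (dker s v u) z) a.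
Proof.
move=> u0 v0 [[sz a1]|[-> a0]]; last exact: analytic_zintegral1_dker.
exact: analytic_zintegral_dker.
Qed.

Lemma analytic_cvg_punctured (f g : C -> C) a (e : R) : analytic_at g a -> 0 < e ->
  (forall w, normc (w - a) < e -> w != a -> f w = g w) -> f @ a^' --> g a.
Proof.
move=> ga e0 fg A /(analytic_cvg ga) /nbhscP[d d0 dA].
apply/nbhscP; exists (Num.min d e); first by rewrite lt_min d0.
move=> w; rewrite lt_min => /andP[wd we] wa.
by rewrite /= fg//; exact: dA.
Qed.

End ProdFirst.

(** * Both formulas, with the removable singularity of the first *)

Theorem theorem3 (R : realType) (m : nat) (u v z s : R[i]) :
  (0 < m)%N ->
  0 < complex.Re u -> 0 < complex.Re v -> u <> v ->
  (slit_plane z /\ - m%:R < complex.Re s) \/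
    (z = 1 /\ 1 - m%:R < complex.Re s) ->
  let mu := lebesgue_tuple m in
  let cube := @unit_cube R m in
  let f1 := fun x : m.-tuple (measurableTypeR R) =>
    F_uv u v x / (1 - z * (prod_all x)%:C) * cpow (- ln (prod_all x))%:C s in
  let f2 := fun x : m.-tuple (measurableTypeR R) =>
    cpow (prod_all x)%:C (u - 1) / (1 - z * (prod_all x)%:C) *
      cpow (- ln (prod_all x))%:C s in
  ((1 < m)%N ->
     cintegrable mu cube f1 /\
     has_value
       (fun s' => Gamma (s' + m%:R - 1) / ((m - 2)`!)%:R *
          ((lerch z (s' + m%:R - 1) v - lerch z (s' + m%:R - 1) u) / (u - v)))
       ((if z == 1 then 2 else 1) - m%:R) s
       (cintegral mu cube f1)) /\
  (cintegrable mu cube f2 /\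
   cintegral mu cube f2 =
     Gamma (s + m%:R) / ((m - 1)`!)%:R * lerch z (s + m%:R) u).
Proof.
move=> m0 u0 v0 /eqP uv zs mu cube f1 f2.
have uv0 : u - v != 0 by rewrite subr_eq0.
split; last first.
  case: m m0 zs @mu @cube @f1 @f2 => // n _ zs mu cube f1 f2.
  rewrite subn1 /=; apply: integrable_prod_all => //.
  by rewrite ReD Re_nat; case: zs => -[? ?]; [left|right]; split => //; lra.
case: m m0 zs @mu @cube @f1 @f2 => [|[|n]]// _ zs mu cube f1 f2 _.
have shift w : w + n.+2%:R - 1 = w + n.+1%:R :> R[i] by rewrite -[in LHS]natr1; ring.
have zs' : (slit_plane z /\ -1 < Re (s + n.+1%:R)) \/ (z = 1 /\ 0 < Re (s + n.+1%:R)).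
  rewrite ReD Re_nat; rewrite -natr1 in zs.
  by case: zs => -[? ?]; [left|right]; split => //; lra.
have [i1 e1] := integrable_F_uv u0 v0 uv0 zs'; split => //.
rewrite subn2 /= e1.
(* The integral side as a function of the exponent. It is analytic at the removable singularity too,
   so its value there is the limit required by [has_value]. *)
pose Q w := n`!%:R^-1 * (zintegral (dker (w + n.+1%:R) v u) z / (u - v)).
have FQ w : (slit_plane z /\ -1 < Re (w + n.+1%:R)) \/ (z = 1 /\ 0 < Re (w + n.+1%:R)) ->
    w != (if z == 1 then 2 else 1) - n.+2%:R ->
    Gamma (w + n.+2%:R - 1) / n`!%:R *
      ((lerch z (w + n.+2%:R - 1) v - lerch z (w + n.+2%:R - 1) u) / (u - v)) = Q w.
  move=> zw wp; rewrite shift /Q -Gamma_lerch_sub//; last first.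
    apply: contraNneq wp => wz; apply/eqP; rewrite -[w](addrK n.+1%:R) wz -[n.+2%:R]natr1.
    by case: (z == 1); rewrite ?mulr1n ?mulr0n /=; ring.
  ring.
rewrite /has_value; case: eqP => [sp|/eqP]; last exact: FQ.
(* The left edge of the half-plane where [Q] is analytic, in the shifted variable; the distance to
   it is a radius on which [FQ] applies off the singular point. *)
pose b : R := if z == 1 then 0 else -1.
have e0 : 0 < Re (s + n.+1%:R) - b.
  by rewrite subr_gt0 /b; case: zs' => -[]; [move=> /slit_plane_neq1/negbTE -> |move=> ->; rewrite eqxx].
apply: (analytic_cvg_punctured (g := Q) _ e0) => [|w we ws].
  apply: analyticM; first exact: analytic_cst.
  apply: analyticM; last exact: analytic_cst.
  by apply: (@analytic_shift _ (fun w => zintegral (dker w v u) z)); exact: analytic_zdker.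
apply: FQ; last by rewrite -sp.
have : b < Re (w + n.+1%:R).
  have := le_lt_trans (normc_ge_Re _) we; rewrite ReB ltr_norml => /andP[+ _].
  by rewrite !ReD; lra.
rewrite /b; case: zs' => -[]; first by move=> sz _; rewrite (negbTE (slit_plane_neq1 sz)); left.
by move=> -> _; rewrite eqxx; right.
Qed.
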